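(* Let $n>2$ be an integer with $n\notin\{3,7\}$, let $V_n$ be a real vector space of dimension $n$, and let $T:V_n\times V_n\times V_n\to\mathbb{R}$ be an alternating trilinear form. Then $T$ possesses a singular line; that is, there exist linearly independent $a,b\in V_n$ such that $T(a,b,x)=0$ for all $x\in V_n$.
   Context: For an alternating trilinear form $T$ on a finite-dimensional vector space $V_n$ of dimension $n$ over a field $\mathbb{F}$, a projective line $\langle a,b\rangle$ of $\mathbb{P}V_n=\mathrm{PG}(n-1,\mathbb{F})$ (i.e. a 2-dimensional subspace of $V_n$ spanned by linearly independent $a,b$) is called $T$-singular if $T(a,b,x)=0$ for all $x\in V_n$. Alternating means that $T(x,y,z)=0$ whenever two of the arguments are equal. *)

(* Defs.v *)
From mathcomp Require Import all_boot all_algebra.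
From mathcomp Require Import reals.

Set Implicit Arguments.
Unset Strict Implicit.
Unset Printing Implicit Defensive.

Import GRing.Theory.
Local Open Scope ring_scope.

Section TrilinearForms.
Variables (F : fieldType) (V : vectType F).
Implicit Types (T : V -> V -> V -> F) (a b : V).

Definition trilinear_form T : Prop :=
  [/\ forall y z, scalar (fun x => T x y z),
      forall x z, scalar (fun y => T x y z)
    & forall x y, scalar (fun z => T x y z)].

Definition alternating T : Prop :=
  forall x y z, x = y \/ y = z \/ x = z -> T x y z = 0.

(* The line is given by two spanning vectors a and b of V; for a trilinear
   alternating T, the condition depends only on the subspace <<[:: a; b]>>. *)
Definition singular_line T a b : Prop :=
  free [:: a; b] /\ forall x, T a b x = 0.

End TrilinearForms.

(* Main.v *)
Require Import Defs.
From HB Require Import structures.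
From mathcomp Require Import boolp classical_sets topology normedtype derive.
From mathcomp Require Import all_boot all_order all_algebra.
From mathcomp Require Import ssrAC separable cyclic cyclotomic.
From mathcomp Require Import reals.
From mathcomp Require Import complex polyrcf.
From mathcomp Require Import ring lra zify.

Set Implicit Arguments.
Unset Strict Implicit.
Unset Printing Implicit Defensive.

(* Suppose T has no singular line, and let a × b be the cross product defined
   by <a × b, x> = T(a, b, x).  Then (x0, a)(t, b) = (x0 t - <a, b>,
   x0 b + t a + a × b) is a bilinear product without zero divisors on R^(n+1),
   that is, a linear family L(x), x in R^(n+1), of real matrices of size
   N = n + 1 that are invertible for x <> 0.  If N is odd then L(x)^-1 L(y) has
   a real eigenvalue, which is impossible.  If the parameter space has dimension
   2d, then 2^(d-1) divides N (a linear, analytic form of Bott periodicity), so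
   N = 2d forces N = 4 or N = 8.

   For the divisibility, write L(z) = sum_j z_j P_j + conj(z_j) Q_j on C^d and
   quantise: z_j and conj(z_j) become the creation and annihilation operators of
   the Fock space with basis the multi-indices a in nat^d, which gives
   D = sum_j P_j cre_j + Q_j ann_j.  An isometry given by an exact quadrature for
   the Gaussian measure turns the pointwise lower bound of L into a Garding
   inequality for D and for its adjoint.  For s in nat, consider the operator on
   the Fock space that acts as D or its adjoint, according to the parity of
   |a| - s, in a window where |a| is close to s, and as the mass term
   +-k(|a| - s) far from it.  The mass anticommutes with D up to a small error,
   so these operators have a uniform spectral gap, and their positive indices of
   inertia, taken over the degrees |a| <= t, are stable under small
   perturbations.
   - Replacing s by s + 2 is such a perturbation.  If p_i denotes the index for
     s + i and the degrees |a| <= t0 + i, then p_(i+2) - p_i is N times the number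
     of multi-indices of degree t0 + i + 2, for t0 = s mod 2.
   - On the sum over all subsets X of {1..d} of the Fock spaces with s replaced
     by s + |X|, the Koszul operator sum_j (cup_j cre_j + cdn_j ann_j) has a
     scalar square in each degree, changes the parity of |X|, and nearly commutes
     with the operator above.  Its kernel is the single state X = {1..d}, a = 0,
     whence sum_X (-1)^|X| p_|X| = +-N.
   If t0 is chosen so that the numbers of multi-indices of degrees t0 + 2, ...,
   t0 + d are even, then both facts together give
   2^(d-1) (p_0 - p_1) = N * (odd integer). *)

Import Order.TTheory GRing.Theory Num.Theory.
Local Open Scope ring_scope.
Local Notation "x %:C" := (real_complex _ x) (format "x %:C") : ring_scope.

(** * Real inner products and the spectral splitting *)

Section InnerProduct.
Variable R : realType.
Local Notation C := R[i].
Local Notation ic := (Complex 0 1 : C).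

Lemma conj_ic : ic^* = - ic.
Proof. by apply/eqP; rewrite eq_complex /= oppr0 !eqxx. Qed.

Lemma ic_sqr : ic * ic = -1.
Proof. by apply/eqP; rewrite eq_complex /=; apply/andP; split; apply/eqP; ring. Qed.

Lemma complex_ReIm (c : C) : c = (complex.Re c)%:C + (complex.Im c)%:C * ic.
Proof.
case: c => a b.
by apply/eqP; rewrite eq_complex /=; apply/andP; split; apply/eqP; ring.
Qed.

(* The real part of [z * w^*]. *)
Definition rd (z w : C) : R :=
  complex.Re z * complex.Re w + complex.Im z * complex.Im w.

Lemma rdC z w : rd z w = rd w z.
Proof. by rewrite /rd ![_ * complex.Re w]mulrC ![_ * complex.Im w]mulrC. Qed.

Lemma rdDl z1 z2 w : rd (z1 + z2) w = rd z1 w + rd z2 w.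
Proof. by move: z1 z2 w => [a b] [c d] [e f]; rewrite /rd /=; ring. Qed.

Lemma rdJ c z w : rd (c * z) w = rd z (c^* * w).
Proof. by move: c z w => [a b] [c d] [e f]; rewrite /rd /=; ring. Qed.

Lemma rdZ (a : R) z w : rd (a%:C * z) w = a * rd z w.
Proof. by move: z w => [c d] [e f]; rewrite /rd /=; ring. Qed.

Lemma rd_ge0 z : 0 <= rd z z.
Proof. by rewrite /rd -!expr2 addr_ge0 ?sqr_ge0. Qed.

Lemma rd_eq0 z : (rd z z == 0) = (z == 0).
Proof.
rewrite /rd -!expr2 paddr_eq0 ?sqr_ge0 // !sqrf_eq0.
by move: z => [a b]; rewrite eq_complex.
Qed.

Lemma rd0l w : rd 0 w = 0. Proof. by rewrite /rd /= !mul0r addr0. Qed.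

Section Vectors.
Variables (I : finType) (N : nat).
Local Notation V := {ffun I -> 'cV[C]_N}.
Implicit Types x y z : V.

(** The real part of the Hermitian product: norms and quadratic forms are real, while subspaces and
    dimensions stay complex. *)
Definition rip x y : R := \sum_i \sum_k rd (x i k 0) (y i k 0).

Lemma ripC x y : rip x y = rip y x.
Proof. by apply: eq_bigr => i _; apply: eq_bigr => k _; rewrite rdC. Qed.

Lemma ripDl x y z : rip (x + y) z = rip x z + rip y z.
Proof.
rewrite -big_split; apply: eq_bigr => i _; rewrite -big_split.
by apply: eq_bigr => k _; rewrite ffunE mxE rdDl.
Qed.

Lemma ripDr x y z : rip z (x + y) = rip z x + rip z y.
Proof. by rewrite ripC ripDl !(ripC z). Qed.

Lemma ripJ c x y : rip (c *: x) y = rip x (c^* *: y).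
Proof.
apply: eq_bigr => i _; apply: eq_bigr => k _.
by rewrite !ffunE !mxE rdJ.
Qed.

Lemma ripZl (a : R) x y : rip (a%:C *: x) y = a * rip x y.
Proof.
rewrite /rip mulr_sumr; apply: eq_bigr => i _.
by rewrite mulr_sumr; apply: eq_bigr => k _; rewrite ffunE mxE rdZ.
Qed.

Lemma ripZr (a : R) x y : rip x (a%:C *: y) = a * rip x y.
Proof. by rewrite ripC ripZl ripC. Qed.

Lemma ripNl x y : rip (- x) y = - rip x y.
Proof.
have -> : - x = (-1)%:C *: x by rewrite raddfN /= scaleN1r.
by rewrite ripZl mulN1r.
Qed.

Lemma ripNr x y : rip x (- y) = - rip x y.
Proof. by rewrite ripC ripNl ripC. Qed.

Lemma ripBl x y z : rip (x - y) z = rip x z - rip y z.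
Proof. by rewrite ripDl ripNl. Qed.

Lemma ripBr x y z : rip z (x - y) = rip z x - rip z y.
Proof. by rewrite ripDr ripNr. Qed.

Lemma rip0l x : rip 0 x = 0.
Proof. by have := ripBl 0 0 x; rewrite subr0 subrr. Qed.

Lemma rip0r x : rip x 0 = 0. Proof. by rewrite ripC rip0l. Qed.

Lemma rip_suml (J : Type) (r : seq J) (P : pred J) (F : J -> V) y :
  rip (\sum_(j <- r | P j) F j) y = \sum_(j <- r | P j) rip (F j) y.
Proof. by elim/big_rec2: _ => [|j u v _ <-]; rewrite ?rip0l ?ripDl. Qed.

Lemma rip_sumr (J : Type) (r : seq J) (P : pred J) (F : J -> V) y :
  rip y (\sum_(j <- r | P j) F j) = \sum_(j <- r | P j) rip y (F j).
Proof. by rewrite ripC rip_suml; apply: eq_bigr => j _; rewrite ripC. Qed.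

Lemma rip_ge0 x : 0 <= rip x x.
Proof. by apply: sumr_ge0 => i _; apply: sumr_ge0 => k _; apply: rd_ge0. Qed.

Lemma rip_eq0 x : (rip x x == 0) = (x == 0).
Proof.
apply/eqP/eqP => [h|->]; last exact: rip0l.
apply/ffunP => i; apply/colP => k; rewrite ffunE mxE; apply/eqP; rewrite -rd_eq0.
move/eqP: h; rewrite psumr_eq0; last first.
  by move=> j _; apply: sumr_ge0 => l _; apply: rd_ge0.
move/allP/(_ i (mem_index_enum _)) => /=; rewrite psumr_eq0; last first.
  by move=> j _; apply: rd_ge0.
by move/allP/(_ k (mem_index_enum _)).
Qed.

Lemma rip_gt0 x : x != 0 -> 0 < rip x x.
Proof. by move=> x0; rewrite lt_def rip_ge0 rip_eq0 x0. Qed.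

Lemma ripi x y : rip (ic *: x) (ic *: y) = rip x y.
Proof.
by rewrite ripJ scalerA conj_ic mulNr ic_sqr opprK scale1r.
Qed.

Definition nm x := Num.sqrt (rip x x).

Lemma nm_ge0 x : 0 <= nm x. Proof. exact: sqrtr_ge0. Qed.

Lemma sqr_nm x : nm x ^+ 2 = rip x x.
Proof. by rewrite sqr_sqrtr ?rip_ge0. Qed.

Lemma nm0 : nm 0 = 0. Proof. by rewrite /nm rip0l sqrtr0. Qed.

Lemma rip_CS x y : rip x y <= nm x * nm y.
Proof.
have [->|y0] := eqVneq y 0; first by rewrite rip0r nm0 mulr0.
have hy := rip_gt0 y0.
have h : rip x y ^+ 2 <= rip x x * rip y y.
  have := rip_ge0 ((rip y y)%:C *: x - (rip x y)%:C *: y).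
  rewrite !ripBl !ripBr !ripZl !ripZr (ripC y x).
  set a := rip x x; set b := rip x y; set c := rip y y in hy * => h0.
  have : 0 <= c * (a * c - b ^+ 2) by apply: le_trans h0 _; lra.
  by rewrite pmulr_rge0 // subr_ge0.
apply: le_trans (ler_norm _) _; rewrite -ler_sqr ?nnegrE ?mulr_ge0 ?nm_ge0 //.
by rewrite exprMn !sqr_nm -normrX ger0_norm ?sqr_ge0.
Qed.

Lemma rip_CSN x y : - (nm x * nm y) <= rip x y.
Proof.
have := rip_CS (- x) y; rewrite ripNl /nm ripNl ripNr opprK => h.
by rewrite lerNl.
Qed.

Lemma nmD x y : nm (x + y) <= nm x + nm y.
Proof.
rewrite -ler_sqr ?nnegrE ?addr_ge0 ?nm_ge0 // sqrrD !sqr_nm ripDl !ripDr (ripC y x).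
by have := rip_CS x y; rewrite mulr2n; lra.
Qed.

Lemma nmN x : nm (- x) = nm x.
Proof. by rewrite /nm ripNl ripNr opprK. Qed.

Lemma nmB x y : nm (x - y) <= nm x + nm y.
Proof. by rewrite -[nm y]nmN; apply: nmD. Qed.

Lemma nmZ (a : R) x : nm (a%:C *: x) = `|a| * nm x.
Proof.
by rewrite /nm ripZl ripZr mulrA -expr2 sqrtrM ?sqr_ge0 // sqrtr_sqr.
Qed.

Lemma nm_sum (J : Type) (r : seq J) (P : pred J) (F : J -> V) :
  nm (\sum_(j <- r | P j) F j) <= \sum_(j <- r | P j) nm (F j).
Proof.
elim/big_rec2: _ => [|j u v _ h]; first by rewrite nm0.
by apply: le_trans (nmD _ _) _; rewrite lerD2l.
Qed.

Lemma nm_le_sqr x (a : R) : 0 <= a -> (nm x <= a) = (rip x x <= a ^+ 2).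
Proof. by move=> a0; rewrite -sqr_nm ler_sqr ?nnegrE ?nm_ge0. Qed.


(** The matrix of the restriction of [H] in a basis of [U] has an eigenvalue because [C] is
    algebraically closed. *)
Lemma stable_eigenvector (H : 'End(V)) (U : {vspace V}) :
  U != 0%VS -> (forall x, x \in U -> H x \in U) ->
  exists v a, [/\ v \in U, v != 0 & H v = a *: v].
Proof.
move=> U0 HU; have n0 : (0 < \dim U)%N by rewrite lt0n dimv_eq0.
pose b := vbasis U.
pose A := \matrix_(i < \dim U, j < \dim U) coord b j (H b`_i).
have [a /eigenvalueP[c cA c0]] := eigenvalue_closed A n0.
have bU i : b`_i \in U.
  by case: (ltnP i (size b)) => hi; [exact/vbasis_mem/mem_nth | rewrite nth_default ?mem0v].
exists (\sum_i c 0 i *: b`_i), a; split.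
- by apply: memv_suml => i _; apply: memvZ.
- apply: contraNneq c0 => h; apply/eqP/rowP => i; rewrite mxE.
  by have /freeP/(_ (fun i => c 0 i) h) := basis_free (vbasisP U).
rewrite linear_sum /= scaler_sumr.
under eq_bigr do rewrite linearZ /= (coord_vbasis (HU _ (bU _))) scaler_sumr.
rewrite exchange_big /=; apply: eq_bigr => j _.
move/rowP/(_ j): cA; rewrite !mxE scalerA => <-; rewrite scaler_suml.
by apply: eq_bigr => i _; rewrite mxE scalerA.
Qed.

(** Induction on the dimension: an eigenvector [v] in [U] is split off, and its orthogonal
    complement in [U] is again stable by symmetry. The eigenvalue is real of absolute value at least
    [g]; its sign decides which of the two subspaces receives [v]. *)
Lemma spectral_split (H : 'End(V)) (U : {vspace V}) (g : R) :
    (forall x y, x \in U -> y \in U -> rip (H x) y = rip x (H y)) ->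
    (forall x, x \in U -> H x \in U) ->
    0 < g -> (forall x, x \in U -> g ^+ 2 * rip x x <= rip (H x) (H x)) ->
  exists Wp Wm : {vspace V},
    [/\ (Wp <= U)%VS, (Wm <= U)%VS, (\dim Wp + \dim Wm = \dim U)%N,
        forall x, x \in Wp -> g * rip x x <= rip (H x) x
      & forall x, x \in Wm -> rip (H x) x <= - (g * rip x x)].
Proof.
elim: {U}(\dim U) {-2}U (leqnn (\dim U)) => [|n IHn] U hn Hs HU g0 Hg.
  have U0 : U = 0%VS by apply/eqP; rewrite -dimv_eq0 -leqn0.
  exists 0%VS, 0%VS; rewrite U0 dimv0; split => // x; rewrite memv0 => /eqP ->.
    by rewrite linear0 rip0l mulr0.
  by rewrite linear0 rip0l mulr0 oppr0.
have [U0|Un0] := eqVneq U 0%VS.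
  by apply: IHn => //; rewrite U0 dimv0.
have [v [a [vU v0 Hv]]] := stable_eigenvector Un0 HU.
have vv := rip_gt0 v0.
have iv : rip v (ic *: v) = 0.
  have := ripJ ic v v; rewrite conj_ic.
  by rewrite scaleNr ripNr ripC; lra.
have aE : a *: v = (complex.Re a)%:C *: v + (complex.Im a)%:C *: (ic *: v).
  by rewrite scalerA -scalerDl -complex_ReIm.
(* Symmetry tested on [v] and [ic *: v] forces the eigenvalue to be real. *)
have a0 : complex.Im a = 0.
  have := Hs v (ic *: v) vU (memvZ _ vU); rewrite linearZ /= Hv.
  rewrite aE scalerDr !ripDl !ripDr !ripZl iv ripi mulr0 add0r.
  rewrite ![ ic *: (_%:C *: _)]scalerA ![ ic * _]mulrC -!scalerA !ripZr iv mulr0 add0r.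
  rewrite (_ : ic *: (ic *: v) = - v); last by rewrite scalerA ic_sqr scaleN1r.
  rewrite ripNr => h; apply/eqP.
  have : complex.Im a * rip v v = 0 by lra.
  by move/eqP; rewrite mulf_eq0 (gt_eqF vv) orbF.
set l := complex.Re a in aE; rewrite a0 scale0r addr0 in aE; rewrite aE in Hv.
(* The Hermitian product with [v], recovered from its real part; its kernel is the complex
   orthogonal complement of [v]. *)
pose hip x : C^o := Complex (rip x v) (rip x (ic *: v)).
have hip_lin : linear hip.
  move=> c x y; rewrite /hip !ripDl.
  have -> : c *: x = (complex.Re c)%:C *: x + (complex.Im c)%:C *: (ic *: x).
    by rewrite scalerA -scalerDl -complex_ReIm.
  rewrite !ripDl !ripZl ripi.
  have -> : rip (ic *: x) v = - rip x (ic *: v).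
    by rewrite ripJ conj_ic scaleNr ripNr.
  apply/eqP; rewrite /GRing.scale /= eq_complex; case: (c) => b d /=.
  by apply/andP; split; apply/eqP; ring.
pose hipL : {linear V -> C^o} := HB.pack hip (GRing.isLinear.Build _ _ _ _ hip hip_lin).
pose U' := (U :&: lker (linfun hipL))%VS.
have U'P x : x \in U' -> [/\ x \in U, rip x v = 0 & rip x (ic *: v) = 0].
  rewrite memv_cap memv_ker lfunE /= => /andP[xU]; rewrite /hip eq_complex /=.
  by case/andP=> /eqP h1 /eqP h2.
have U'I x : x \in U -> rip x v = 0 -> rip x (ic *: v) = 0 -> x \in U'.
  by move=> xU h1 h2; rewrite memv_cap xU memv_ker lfunE /= /hip h1 h2 eqxx.
have ripc (c : C) x : x \in U' -> rip (c *: v) x = 0.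
  case/U'P=> _ h1 h2; rewrite ripC.
  have -> : c *: v = (complex.Re c)%:C *: v + (complex.Im c)%:C *: (ic *: v).
    by rewrite scalerA -scalerDl -complex_ReIm.
  by rewrite ripDr !ripZr h1 h2 !mulr0 addr0.
have Hcv (c : C) : H (c *: v) = l%:C *: (c *: v).
  by rewrite linearZ /= Hv !scalerA mulrC.
have dv0 W : (W <= U')%VS -> (<[v]> :&: W)%VS = 0%VS.
  move=> /subvP WU; apply/eqP; rewrite -subv0; apply/subvP => x.
  rewrite memv_cap memv0 => /andP[/vlineP[c xc] /WU xU']; rewrite -rip_eq0.
  by rewrite {1}xc ripc.
have dU : (\dim U = 1 + \dim U')%N.
  have {1}-> : U = (<[v]> + U')%VS.
    apply/eqP; rewrite eqEsubv subv_add -memvE vU capvSl !andbT.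
    apply/subvP => x xU.
    have -> : x = (hip x / (rip v v)%:C) *: v + (x - (hip x / (rip v v)%:C) *: v).
      by rewrite addrC subrK.
    apply: memv_add; first exact/memvZ/memv_line.
    have hh : hip (x - (hip x / (rip v v)%:C) *: v) = 0.
      have hv : hip v = (rip v v)%:C by rewrite /hip iv.
      rewrite -[hip _]/(hipL _) linearB linearZ /= hv.
      by rewrite /GRing.scale /= divfK ?subrr // eq_complex /= gt_eqF.
    have /= h1 := congr1 (@complex.Re R) hh; have /= h2 := congr1 (@complex.Im R) hh.
    by apply: U'I => //; rewrite memvB // memvZ.
  rewrite dimv_disjoint_sum ?dim_vline ?v0 //; exact: dv0.
have [|||//||Wp [Wm [hp hm hd Pp Pm]]] := IHn U'.
- by move: hn; rewrite dU.
- by move=> x y /U'P[xU _ _] /U'P[yU _ _]; apply: Hs.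
- move=> x xU'; have [xU h1 h2] := U'P _ xU'.
  apply: U'I; first exact: HU.
    by rewrite Hs // Hv ripZr h1 mulr0.
  by rewrite Hs ?memvZ // Hcv ripZr h2 mulr0.
- by move=> x /U'P[xU _ _]; apply: Hg.
have key (c : C) x : x \in U' ->
    rip (c *: v + x) (c *: v + x) = rip (c *: v) (c *: v) + rip x x /\
    rip (H (c *: v + x)) (c *: v + x) = l * rip (c *: v) (c *: v) + rip (H x) x.
  move=> xU'; have [xU _ _] := U'P _ xU'.
  have h1 := ripc c _ xU'; have h2 : rip x (c *: v) = 0 by rewrite ripC.
  split; first by rewrite !ripDl !ripDr h1 h2 addr0 add0r.
  rewrite linearD /= !ripDl !ripDr Hcv !ripZl h1 mulr0 addr0.
  by rewrite (Hs x (c *: v)) ?memvZ // Hcv ripZr h2 mulr0 add0r.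
have hU W : (W <= U')%VS -> (<[v]> + W <= U)%VS.
  by move=> hW; rewrite subv_add -memvE vU (subv_trans hW) ?capvSl.
have dW W : (W <= U')%VS -> (\dim (<[v]> + W) = (\dim W).+1)%N.
  by move=> hW; rewrite dimv_disjoint_sum ?dim_vline ?v0 // dv0.
have gl : g ^+ 2 <= l ^+ 2.
  have := Hg _ vU; rewrite Hv ripZl ripZr mulrA -expr2.
  by rewrite ler_pM2r.
have [l0|l0] := leP 0 l.
- have gl' : g <= l by rewrite -ler_sqr ?nnegrE // ltW.
  exists (<[v]> + Wp)%VS, Wm; split=> //; first exact: hU.
  + exact: subv_trans hm (capvSl _ _).
  + by rewrite dW // addSn hd dU.
  + move=> _ /memv_addP[_ /vlineP[c ->] [x xW ->]].
    have [-> ->] := key c x (subvP hp _ xW); rewrite mulrDr lerD ?Pp //.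
    by rewrite ler_wpM2r ?rip_ge0.
- have gl' : g <= - l by rewrite -ler_sqr ?nnegrE ?sqrrN ?oppr_ge0 // ltW.
  exists Wp, (<[v]> + Wm)%VS; split=> //; last 1 first.
  + move=> _ /memv_addP[_ /vlineP[c ->] [x xW ->]].
    have [-> ->] := key c x (subvP hm _ xW).
    rewrite mulrDr opprD lerD ?Pm // -mulNr ler_wpM2r ?rip_ge0 //; lra.
  + exact: subv_trans hp (capvSl _ _).
  + exact: hU.
  + by rewrite dW // addnS hd dU.
Qed.

End Vectors.
End InnerProduct.

(** * Inertia *)

Section CoordinateSubspaces.
Variables (R : realType) (I : finType) (N : nat).
Local Notation C := R[i].
Local Notation V := {ffun I -> 'cV[C]_N}.
Implicit Types (x y : V) (A B : {set I}).

Definition restr A x : V := [ffun i => if i \in A then x i else 0].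

Lemma restr_linear A : linear (restr A).
Proof.
move=> c x y; apply/ffunP => i; rewrite !ffunE.
by case: ifP => _; rewrite ?scaler0 ?addr0.
Qed.
HB.instance Definition _ A := GRing.isLinear.Build C V V _ (restr A) (restr_linear A).

Definition coordv A : {vspace V} := lker (linfun (restr (~: A))).

Lemma coordvP A x : reflect (forall i, i \notin A -> x i = 0) (x \in coordv A).
Proof.
rewrite memv_ker lfunE; apply: (iffP eqP) => [/ffunP h i iA|h].
  by have := h i; rewrite !ffunE inE iA.
by apply/ffunP => i; rewrite !ffunE inE; case: ifPn => // /h.
Qed.

Lemma coordvE A x i : x \in coordv A -> i \notin A -> x i = 0.
Proof. by move/coordvP; apply. Qed.

Lemma coordvS A B : A \subset B -> (coordv A <= coordv B)%VS.
Proof.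
move=> /subsetP AB; apply/subvP => x /coordvP h; apply/coordvP => i iB.
by apply: h; apply: contraNN iB => /AB.
Qed.

Lemma dim_coordv A : \dim (coordv A) = (#|A| * N)%N.
Proof.
pose W := {ffun {i | i \in A} -> 'cV[C]_N}.
(* Extension by zero, an injection with image [coordv A]. *)
pose e (f : W) : V := [ffun i => if insub i is Some u then f u else 0].
have e_lin : linear e.
  move=> c f g; apply/ffunP => i; rewrite !ffunE.
  by case: insub => [u|]; rewrite ?ffunE // scaler0 addr0.
pose eL : {linear W -> V} := HB.pack e (GRing.isLinear.Build _ _ _ _ e e_lin).
have -> : coordv A = limg (linfun eL).
  apply/vspaceP => x; apply/coordvP/memv_imgP => [h|[f _ ->] i iA].
    exists [ffun u => x (val u)]; first exact: memvf.
    apply/ffunP => i; rewrite lfunE /= ffunE; case: insubP => [u _ <-|/h //].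
    by rewrite ffunE.
  by rewrite lfunE /= ffunE insubN.
rewrite limg_dim_eq; last first.
  apply/eqP; rewrite capfv; apply/lker0P => f g; rewrite !lfunE /= => /ffunP h.
  by apply/ffunP => u; have := h (val u); rewrite !ffunE valK.
rewrite dimvf; transitivity (#|{: {i | i \in A}}| * (N * 1))%N; first by [].
by rewrite card_sig muln1.
Qed.

Lemma rip_disjoint A B x y :
  [disjoint A & B] -> x \in coordv A -> y \in coordv B -> rip x y = 0.
Proof.
move=> dAB /coordvP hx /coordvP hy; rewrite /rip big1 // => i _.
have [iA|iA] := boolP (i \in A); last first.
  by rewrite big1 // => k _; rewrite hx // mxE rd0l.
rewrite big1 // => k _; rewrite rdC hy ?mxE ?rd0l //.
by rewrite (disjointFr dAB iA).
Qed.

(* For a symmetric [h] preserving [coordv A], [p] is its positive index of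
   inertia there; [g] quantifies the absence of spectrum in (-g, g). *)
Definition inertia (h : V -> V) A (g : R) (p : nat) :=
  exists Wp Wm : {vspace V},
  [/\ (Wp <= coordv A)%VS, (Wm <= coordv A)%VS,
      \dim Wp = p /\ (p + \dim Wm = #|A| * N)%N,
      forall x, x \in Wp -> g * rip x x <= rip (h x) x
    & forall x, x \in Wm -> rip (h x) x <= - (g * rip x x)].

Lemma inertia_exists (h : V -> V) A g : linear h ->
    (forall x y, rip (h x) y = rip x (h y)) ->
    (forall x, x \in coordv A -> h x \in coordv A) ->
    0 < g -> (forall x, x \in coordv A -> g ^+ 2 * rip x x <= rip (h x) (h x)) ->
  exists p, inertia h A g p.
Proof.
move=> h_lin hs hA g0 hg.
pose hL : {linear V -> V} := HB.pack h (GRing.isLinear.Build _ _ _ _ h h_lin).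
have hE x : linfun hL x = h x by rewrite lfunE.
have [||x xA|Wp [Wm [h1 h2 h3 h4 h5]]] := @spectral_split R I N (linfun hL) (coordv A) g _ _ g0.
- by move=> x y _ _; rewrite !hE.
- by move=> x; rewrite hE; apply: hA.
- by rewrite hE; apply: hg.
exists (\dim Wp), Wp, Wm; split=> //.
- by rewrite h3 dim_coordv.
- by move=> x /h4; rewrite hE.
- by move=> x /h5; rewrite hE.
Qed.

(** Vectors supported in [A] and in [B] are orthogonal and [h] does not mix them, so the quadratic
    form is an orthogonal sum. *)
Lemma inertia_setU (h : V -> V) A B g p q : linear h -> [disjoint A & B] ->
    (forall x, x \in coordv A -> h x \in coordv A) ->
    (forall x, x \in coordv B -> h x \in coordv B) ->
  inertia h A g p -> inertia h B g q -> inertia h (A :|: B) g (p + q).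
Proof.
move=> h_lin dAB hA hB [Ap [Am [Ap1 Am1 [<- dA] Ap2 Am2]]].
case=> [Bp [Bm [Bp1 Bm1 [<- dB] Bp2 Bm2]]].
have hD x y : h (x + y) = h x + h y by have := h_lin 1 x y; rewrite !scale1r.
have cap0 : (coordv A :&: coordv B = 0)%VS.
  apply/eqP; rewrite -subv0; apply/subvP => x; rewrite memv_cap memv0.
  by case/andP => xA xB; rewrite -rip_eq0 (rip_disjoint dAB xA xB).
have dsum (W1 W2 : {vspace V}) : (W1 <= coordv A)%VS -> (W2 <= coordv B)%VS ->
    \dim (W1 + W2) = (\dim W1 + \dim W2)%N.
  move=> h1 h2; rewrite dimv_disjoint_sum //; apply/eqP; rewrite -subv0 -cap0.
  exact: capvS.
have sub (W1 W2 : {vspace V}) : (W1 <= coordv A)%VS -> (W2 <= coordv B)%VS ->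
    (W1 + W2 <= coordv (A :|: B))%VS.
  move=> h1 h2; rewrite subv_add; apply/andP; split.
    exact: subv_trans h1 (coordvS (subsetUl _ _)).
  exact: subv_trans h2 (coordvS (subsetUr _ _)).
have key x y : x \in coordv A -> y \in coordv B ->
    rip (x + y) (x + y) = rip x x + rip y y /\
    rip (h (x + y)) (x + y) = rip (h x) x + rip (h y) y.
  move=> xA yB; have hxA := hA _ xA; have hyB := hB _ yB.
  rewrite hD !ripDl !ripDr.
  rewrite (rip_disjoint dAB xA yB) (rip_disjoint dAB hxA yB).
  rewrite (ripC y) (ripC (h y) x) (rip_disjoint dAB xA yB) (rip_disjoint dAB xA hyB).
  by rewrite !addr0 !add0r.
exists (Ap + Bp)%VS, (Am + Bm)%VS; split.
- exact: sub.
- exact: sub.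
- rewrite !dsum //; split=> //.
  by rewrite addnACA dA dB -mulnDl cardsU (disjoint_setI0 dAB) cards0 subn0.
- move=> _ /memv_addP[x xA [y yB ->]].
  have [-> ->] := key _ _ (subvP Ap1 _ xA) (subvP Bp1 _ yB).
  by rewrite mulrDr; apply: lerD; [apply: Ap2 | apply: Bp2].
- move=> _ /memv_addP[x xA [y yB ->]].
  have [-> ->] := key _ _ (subvP Am1 _ xA) (subvP Bm1 _ yB).
  by rewrite mulrDr opprD; apply: lerD; [apply: Am2 | apply: Bm2].
Qed.

Lemma inertia_pos (h : V -> V) A g :
  (forall x, x \in coordv A -> g * rip x x <= rip (h x) x) ->
  inertia h A g (#|A| * N).
Proof.
move=> hA; exists (coordv A), 0%VS; split=> //.
- exact: sub0v.
- by rewrite dim_coordv dimv0 addn0.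
- by move=> x; rewrite memv0 => /eqP ->; rewrite !rip0r mulr0 oppr0.
Qed.

Lemma inertia_neg (h : V -> V) A g :
  (forall x, x \in coordv A -> rip (h x) x <= - (g * rip x x)) ->
  inertia h A g 0.
Proof.
move=> hA; exists 0%VS, (coordv A); split=> //.
- exact: sub0v.
- by rewrite dim_coordv dimv0 add0n.
- by move=> x; rewrite memv0 => /eqP ->; rewrite !rip0r mulr0.
Qed.

End CoordinateSubspaces.
Arguments coordv {R I N} A.
Arguments restr {R I N} A x.

(** Sylvester's law of inertia: [k] is injective on the positive space of [h], and its image there
    is positive for [h'], hence meets the negative space of [h'] trivially; the two dimensions add
    up to at most that of [coordv A']. *)
Lemma inertia_le (R : realType) (I J : finType) (N : nat)
    (h : {ffun I -> 'cV[R[i]]_N} -> {ffun I -> 'cV[R[i]]_N})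
    (h' : {ffun J -> 'cV[R[i]]_N} -> {ffun J -> 'cV[R[i]]_N})
    (k : {ffun I -> 'cV[R[i]]_N} -> {ffun J -> 'cV[R[i]]_N})
    (A : {set I}) (A' : {set J}) (g g' : R) (p p' : nat) :
    linear k -> 0 <= g' ->
    (forall x, x \in coordv A -> k x \in coordv A') ->
    (forall x, x \in coordv A -> x != 0 -> g * rip x x <= rip (h x) x ->
       0 < rip (h' (k x)) (k x)) ->
  inertia h A g p -> inertia h' A' g' p' -> (p <= p')%N.
Proof.
move=> k_lin g'0 kA kpos [Wp [Wm [hp hm [<- d1] Pp Pm]]].
case=> [Wp' [Wm' [hp' hm' [<- d2] Pp' Pm']]].
pose kL : {linear {ffun I -> 'cV[R[i]]_N} -> {ffun J -> 'cV[R[i]]_N}} :=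
  HB.pack k (GRing.isLinear.Build _ _ _ _ k k_lin).
have kE x : linfun kL x = k x by rewrite lfunE.
have pos x : x \in Wp -> x != 0 -> 0 < rip (h' (k x)) (k x).
  by move=> xW x0; apply: kpos => //; [apply: (subvP hp) | apply: Pp].
have dk : \dim (linfun kL @: Wp) = \dim Wp.
  apply: limg_dim_eq; apply/eqP; rewrite -subv0; apply/subvP => x.
  rewrite memv_cap memv_ker memv0 kE => /andP[xW /eqP kx0].
  by apply: contraT => x0; have := pos _ xW x0; rewrite kx0 rip0r ltxx.
have cap0 : ((linfun kL @: Wp) :&: Wm' = 0)%VS.
  apply/eqP; rewrite -subv0; apply/subvP => y; rewrite memv_cap memv0.
  case/andP => /memv_imgP[x xW ->] yW; rewrite kE in yW *.
  have [->|x0] := eqVneq x 0.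
    by rewrite -kE linear0.
  have := pos _ xW x0; rewrite ltNge (le_trans (Pm' _ yW)) //.
  by rewrite oppr_le0 mulr_ge0 ?rip_ge0.
have : (\dim (linfun kL @: Wp + Wm') <= #|A'| * N)%N.
  rewrite -(dim_coordv R N A') dimvS // subv_add hm' andbT.
  by apply/subvP => _ /memv_imgP[x /(subvP hp) xA ->]; rewrite kE; apply: kA.
by rewrite dimv_disjoint_sum // dk -d2 leq_add2r.
Qed.

(** * Gaussian quadrature *)

Section ClosedFieldQuadrature.
Variable C : numClosedFieldType.

Lemma primitive_root_exists n : (0 < n)%N -> {z : C | n.-primitive_root z}.
Proof.
pose p : {poly C} := 'X^n - 1; have [r Dp] := closed_field_poly_normal p.
move=> n_gt0; apply/sigW; rewrite (monicP _) ?monicXnsubC // scale1r in Dp.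
have rn1 : all n.-unity_root r by apply/allP=> z; rewrite -root_prod_XsubC -Dp.
have sz_r : (n < (size r).+1)%N.
  by rewrite -(size_prod_XsubC r id) -Dp size_XnsubC.
have [|z] := hasP (has_prim_root n_gt0 rn1 _ sz_r); last by exists z.
by rewrite -separable_prod_XsubC -Dp separable_Xn_sub_1 // pnatr_eq0 -lt0n.
Qed.

(** The angular quadrature, with nodes at the roots of unity of order [n.+1]. For distinct a, b at
    most n, z^a / z^b is a root of unity other than 1, whose geometric sum vanishes. *)
Lemma phase_quadrature n : exists e : 'I_n.+1 -> C,
  forall a b : nat, (a <= n)%N -> (b <= n)%N ->
    \sum_t n.+1%:R^-1 * (e t ^+ a * (e t ^+ b)^*) = (a == b)%:R.
Proof.
have [z zp] := primitive_root_exists (ltn0Sn n).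
have z1 := prim_expr_order zp.
have nz : `|z| = 1.
  have /eqP := congr1 Num.norm z1; rewrite normrX normr1.
  by rewrite pexpr_eq1 ?normr_ge0 // => /eqP.
have zJ : z^* = z^-1 
  by rewrite -[z^-1]mul1r -[1](expr1n _ 2) -nz normCK mulrAC divff ?mul1r // -normr_gt0 nz.
exists (fun t => z ^+ t) => a b an bn; rewrite -mulr_sumr.
have zu : z \is a GRing.unit by rewrite unitfE -normr_gt0 nz.
have zE (t : 'I_n.+1) : z ^+ t ^+ a * (z ^+ t ^+ b)^* = (z ^+ a / z ^+ b) ^+ t.
  by rewrite !rmorphXn /= zJ exprMn !exprVn -!exprM [(t * a)%N]mulnC [(t * b)%N]mulnC.
under eq_bigr do rewrite zE.
have [->|ab] := eqVneq a b.
  under eq_bigr do rewrite divff ?expf_neq0 -?unitfE // expr1n.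
  by rewrite sumr_const card_ord mulVf // pnatr_eq0.
set x := z ^+ a / z ^+ b.
have x1 : x != 1.
  apply: contraNneq ab => /eqP; rewrite -subr_eq0 => /eqP h.
  have : z ^+ a = z ^+ b.
    by apply/eqP; rewrite -subr_eq0 -(divfK (expf_neq0 b (_ : z != 0)) (z ^+ a)) -/x
      -?unitfE // -{2}[z ^+ b]mul1r -mulrBl h mul0r.
  by move/eqP; rewrite (eq_prim_root_expr zp) !modn_small.
have /eqP : (x - 1) * \sum_(i < n.+1) x ^+ i = 0.
  rewrite -subrX1 /x expr_div_n -!exprM ![(_ * n.+1)%N]mulnC !exprM z1 !expr1n.
  by rewrite divff ?oner_eq0 // subrr.
by rewrite mulf_eq0 subr_eq0 (negPf x1) => /eqP ->; rewrite mulr0.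
Qed.

(* The matrix [laguerre *m laguerre^T] is the Jacobi matrix of the Laguerre
   polynomials, whose spectral measure at the first basis vector has the
   moments [a!] of the exponential distribution. *)
Definition laguerre K : 'M[C]_K.+1 :=
  \matrix_(k, m) (((k == m)%:R + (k == m.+1 :> nat)%:R) * sqrtC (m.+1)%:R).

(** The first row of the a-th power of the Jacobi matrix, for a at most K. Up to signs, these are
    the coefficients of x^a in the Laguerre polynomials. *)
Definition laguerre_row K a : 'rV[C]_K.+1 := \row_k (a`! * 'C(a, k))%:R.

(** Pascal's rule evaluates the product with [laguerre K]; the absorption identity (m+1) C(a+1, m+1)
    = (a+1) C(a, m) and Pascal's rule again evaluate the product with the transpose. *)
Lemma laguerre_rowS K a : (a < K)%N ->
  laguerre_row K a *m (laguerre K *m (laguerre K)^T) = laguerre_row K a.+1.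
Proof.
move=> aK; rewrite mulmxA.
have -> : laguerre_row K a *m laguerre K =
    \row_m (sqrtC m.+1%:R * (a`! * 'C(a.+1, m.+1))%:R).
  apply/rowP => m; rewrite !mxE.
  rewrite (eq_bigr (fun k : 'I_K.+1 => (k == m)%:R * (sqrtC m.+1%:R * (a`! * 'C(a, k))%:R) +
     (k == m.+1 :> nat)%:R * (sqrtC m.+1%:R * (a`! * 'C(a, k))%:R))); last first.
    by move=> k _; rewrite !mxE; ring.
  rewrite big_split /= (bigD1 m) //= eqxx mul1r big1 ?addr0; last first.
    by move=> k /negPf ->; rewrite mul0r.
  rewrite binS mulnDr natrD mulrDr [LHS]addrC; congr (_ + _).
  have [mK|mK] := ltnP m.+1 K.+1.
    rewrite (bigD1 (Ordinal mK)) //= eqxx mul1r big1 ?addr0 // => k km.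
    by rewrite (_ : (k == m.+1 :> nat) = false) ?mul0r //; apply/negbTE.
  (* In the last column, m = K, the entry with index K+1 is cut off; this is harmless because C(a,
     K+1) = 0. *)
  rewrite bin_small ?muln0 ?mulr0; last exact: leq_trans aK (ltnW mK).
  rewrite big1 // => k _; rewrite (_ : (k == m.+1 :> nat) = false) ?mul0r //.
  by apply/negbTE; rewrite neq_ltn (leq_trans (ltn_ord k) mK).
apply/rowP => l; rewrite !mxE.
rewrite (eq_bigr (fun m : 'I_K.+1 =>
    (m == l)%:R * (m.+1%:R * (a`! * 'C(a.+1, m.+1))%:R) +
    (l == m.+1 :> nat)%:R * (m.+1%:R * (a`! * 'C(a.+1, m.+1))%:R))); last first.
  move=> m _; rewrite !mxE (eq_sym l m).
  set s := sqrtC _; have -> : m.+1%:R = s * s by rewrite -expr2 sqrtCK.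
  by ring.
rewrite big_split /= (bigD1 l) //= eqxx mul1r big1 ?addr0; last first.
  by move=> k /negPf ->; rewrite mul0r.
have hb m : (m.+1%:R * (a`! * 'C(a.+1, m.+1))%:R : C) = (a.+1`! * 'C(a, m))%:R.
  by rewrite -natrM mulnCA -mul_bin_diag mulnCA mulnA -factS.
rewrite hb.
have [l0|l0] := posnP l.
  rewrite big1 ?addr0 ?l0 ?bin0 // => m _; by rewrite mul0r.
have lK : (l.-1 < K.+1)%N by rewrite prednK // ltnW // ltn_ord.
rewrite (bigD1 (Ordinal lK)) //= prednK // eqxx mul1r big1 ?addr0; last first.
  move=> k kl; rewrite (_ : (l == k.+1 :> nat) = false) ?mul0r //.
  by apply: contraNF kl => /eqP h; apply/eqP/val_inj; rewrite /= h.
have := hb l.-1; rewrite prednK // => ->; case: (l : nat) l0 => // l' _ /=.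
by rewrite -natrD -mulnDr -binS.
Qed.

(** Gauss quadrature for the exponential distribution, the law of |z|^2 under the Gaussian measure:
    the nodes are the eigenvalues of the Jacobi matrix [J], the weights the squared moduli of the
    first components of its eigenvectors. The nodes are nonnegative because [J] is a Gram matrix. *)
Lemma radial_quadrature K : exists r w : 'I_K.+1 -> C,
  [/\ forall k, 0 <= r k, forall k, 0 <= w k
    & forall a, (a <= K)%N -> \sum_k w k * r k ^+ a = (a`!)%:R].
Proof.
pose M := laguerre K; pose J := M *m M^T.
have MT : M^T = map_mx Num.conj M^T.
  apply/matrixP => i j; rewrite !mxE rmorphM /= rmorphD !rmorph_nat.
  by rewrite (conj_Creal _) // ger0_real // sqrtC_ge0 ler0n.
have Jh : J \is hermsymmx.
  apply/is_hermitianmxP; rewrite expr0 scale1r /J trmx_mul trmxK map_mxM -MT.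
  by congr (_ *m _); rewrite -[M in LHS]trmxK MT -map_trmx trmxK.
have /hermitian_normalmx/orthomx_spectralP := Jh.
set P := spectralmx J; set s := spectral_diag J => JE.
have Pu : P \is unitarymx := spectral_unitarymx J.
rewrite invmx_unitary // in JE.
have PP : P *m map_mx Num.conj P^T = 1%:M by apply/unitarymxP.
have PP' : map_mx Num.conj P^T *m P = 1%:M by apply: mulmx1C.
have sJ : P *m J *m map_mx Num.conj P^T = diag_mx s.
  by rewrite {1}JE !mulmxA PP mul1mx -mulmxA PP mulmx1.
have JP : J *m map_mx Num.conj P^T = map_mx Num.conj P^T *m diag_mx s.
  by rewrite {1}JE -!mulmxA PP mulmx1.
exists (fun k => s 0 k), (fun k => P k 0 * (P k 0)^*); split.
- move=> k; have : P *m J *m map_mx Num.conj P^T = (P *m M) *m map_mx Num.conj (P *m M)^T.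
    by rewrite trmx_mul map_mxM -MT !mulmxA.
  rewrite sJ => /matrixP/(_ k k); rewrite !mxE eqxx mulr1n => ->.
  by apply: sumr_ge0 => l _; rewrite !mxE mul_conjC_ge0.
- by move=> k; rewrite mul_conjC_ge0.
have key a : (a <= K)%N ->
    laguerre_row K a *m map_mx Num.conj P^T = \row_k ((P k 0)^* * s 0 k ^+ a).
  elim: a => [_|a IHa aK].
    apply/rowP => k; rewrite !mxE expr0 mulr1 (bigD1 0) //= !mxE fact0 bin0 mul1r.
    by rewrite big1 ?addr0 // => l; rewrite -lt0n !mxE => l0; rewrite bin_small // mul0r.
  rewrite -laguerre_rowS // -mulmxA JP mulmxA IHa 1?ltnW //.
  apply/rowP => k; rewrite mul_mx_diag !mxE exprS mulrA.
  by rewrite [RHS]mulrAC -mulrA [_ * s 0 k]mulrC mulrA -mulrA [s 0 k * _]mulrC mulrA.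
move=> a aK; have /rowP/(_ 0) : laguerre_row K a *m map_mx Num.conj P^T *m P = laguerre_row K a.
  by rewrite -mulmxA PP' mulmx1.
rewrite key // !mxE bin0 muln1 => <-; apply: eq_bigr => k _.
by rewrite !mxE; ring.
Qed.

End ClosedFieldQuadrature.

Section Quadrature.
Variable R : realType.
Local Notation C := R[i].

(** Orthonormal for the standard Gaussian measure on C, for which |z|^(2a) has mean a!. *)
Definition fock1 (a : nat) (z : C) : C := ((Num.sqrt (a`!%:R : R))^-1)%:C * z ^+ a.

(** Polar coordinates: the squared modulus of a node comes from the radial quadrature, its phase
    from the angular one. The phases kill the terms with a different from b, and the radii give a!
    on the diagonal. *)
Lemma quadrature1 n : exists (Q : finType) (w : Q -> R) (p : Q -> C),
  (forall q, 0 <= w q) /\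
  forall a b : nat, (a <= n)%N -> (b <= n)%N ->
    \sum_q (w q)%:C * (fock1 a (p q) * (fock1 b (p q))^*) = (a == b)%:R.
Proof.
have [e he] := phase_quadrature C n.
have [r [w [r0 w0 hr]]] := radial_quadrature C n.
have wR k : (complex.Re (w k))%:C = w k by rewrite RRe_real // ger0_real.
exists ('I_n.+1 * 'I_n.+1)%type.
exists (fun q => complex.Re (w q.1) / n.+1%:R), (fun q => sqrtC (r q.1) * e q.2).
split=> [q|a b an bn].
  by rewrite divr_ge0 ?ler0n // -ler0c wR.
have rJ k : (sqrtC (r k))^* = sqrtC (r k).
  by rewrite conj_Creal // ger0_real // sqrtC_ge0.
set ca := ((Num.sqrt (a`!%:R : R))^-1)%:C; set cb := ((Num.sqrt (b`!%:R : R))^-1)%:C.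
have cbJ : cb^* = cb by apply: conj_Creal; rewrite complex_real.
transitivity (\sum_k \sum_t ca * cb * (w k * sqrtC (r k) ^+ a * sqrtC (r k) ^+ b) *
   (n.+1%:R^-1 * (e t ^+ a * (e t ^+ b)^*))).
  rewrite pair_bigA; apply: eq_bigr => -[k t] _ /=.
  rewrite /fock1 -/ca -/cb rmorphM rmorphV ?unitfE ?pnatr_eq0 //= wR rmorph_nat.
  have cbM y : (cb * y)^* = cb * y^* by rewrite rmorphM /= cbJ.
  have sM y : (sqrtC (r k) ^+ b * y)^* = sqrtC (r k) ^+ b * y^*.
    by rewrite rmorphM rmorphXn /= rJ.
  by rewrite !exprMn cbM sM; ring.
under eq_bigr do rewrite -mulr_sumr he //.
have [ab|ab] := eqVneq a b; last by rewrite big1 // => k _; rewrite mulr0.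
subst b.
rewrite (eq_bigr (fun k => ca * cb * (w k * r k ^+ a))); last first.
  move=> k _; rewrite mulr1 -[in RHS](sqrtCK (r k)) -!mulrA; congr (_ * (_ * (_ * _))).
  by rewrite -exprD addnn -mul2n exprM.
have hs : (Num.sqrt (a`!%:R : R))^-1 * (Num.sqrt (a`!%:R : R))^-1 * a`!%:R = 1.
  by rewrite -invfM -expr2 sqr_sqrtr ?ler0n // mulVf // pnatr_eq0 -lt0n fact_gt0.
rewrite -mulr_sumr hr // (_ : a`!%:R = (a`!%:R)%:C :> C); last by rewrite rmorph_nat.
by have := congr1 (real_complex R) hs; rewrite !rmorphM rmorph1.
Qed.

Definition fock d (a : 'I_d -> nat) (z : 'I_d -> C) : C := \prod_j fock1 (a j) (z j).

Lemma quadrature d n : exists (Q : finType) (w : Q -> R) (p : Q -> 'I_d -> C),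
  (forall q, 0 <= w q) /\
  forall a b : {ffun 'I_d -> 'I_n.+1},
    \sum_q (w q)%:C * (fock (fun j => a j) (p q) * (fock (fun j => b j) (p q))^*) =
    (a == b)%:R.
Proof.
have [Q [w [p [w0 h]]]] := quadrature1 n.
exists {ffun 'I_d -> Q},
  (fun q : {ffun _ -> Q} => \prod_j w (q j)), (fun (q : {ffun _ -> Q}) j => p (q j)); split=> [q|a b].
  by apply: prodr_ge0 => j _; apply: w0.
transitivity (\prod_j \sum_x (w x)%:C * (fock1 (a j) (p x) * (fock1 (b j) (p x))^*)).
  rewrite bigA_distr_bigA /=; apply: eq_bigr => q _.
  by rewrite rmorph_prod rmorph_prod -!big_split.
under eq_bigr do rewrite h ?leq_ord //.
have [->|ab] := eqVneq a b; first by rewrite big1 // => j _; rewrite eqxx.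
have /existsP[j jP] : [exists j, a j != b j].
  by apply: contraNT ab => /existsPn hj; apply/eqP/ffunP => j; have := hj j; rewrite negbK => /eqP.
by rewrite (bigD1 j) //= (inj_eq val_inj) (negPf jP) mul0r.
Qed.

End Quadrature.

(** * Matrices and multiplication operators acting pointwise *)

Section PointwiseOperators.
Variables (R : realType) (I : finType) (N : nat).
Local Notation C := R[i].
Local Notation V := {ffun I -> 'cV[C]_N}.
Implicit Types (x y : V) (P : 'M[C]_N).

Definition mulV P x : V := [ffun i => P *m x i].
Definition dg (f : I -> C) x : V := [ffun i => f i *: x i].
Definition adj P : 'M[C]_N := map_mx Num.conj P^T.

Lemma mulVE P x i : mulV P x i = P *m x i. Proof. exact: ffunE. Qed.
Lemma dgE f x i : dg f x i = f i *: x i. Proof. exact: ffunE. Qed.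

Lemma adjK P : adj (adj P) = P.
Proof. by apply/matrixP => i j; rewrite !mxE conjCK. Qed.

Lemma mulV_linear P : linear (mulV P).
Proof. by move=> c x y; apply/ffunP => i; rewrite !ffunE mulmxDr scalemxAr. Qed.
HB.instance Definition _ P := GRing.isLinear.Build C V V _ (mulV P) (mulV_linear P).

Lemma dg_linear f : linear (dg f).
Proof.
by move=> c x y; apply/ffunP => i; rewrite !ffunE scalerDr !scalerA mulrC.
Qed.
HB.instance Definition _ f := GRing.isLinear.Build C V V _ (dg f) (dg_linear f).

Lemma mulV_dg P f x : mulV P (dg f x) = dg f (mulV P x).
Proof. by apply/ffunP => i; rewrite !ffunE scalemxAr. Qed.

Lemma dgM f g x : dg f (dg g x) = dg (fun i => f i * g i) x.
Proof. by apply/ffunP => i; rewrite !ffunE scalerA. Qed.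

Lemma eq_dg f g x : (forall i, x i != 0 -> f i = g i) -> dg f x = dg g x.
Proof.
move=> fg; apply/ffunP => i; rewrite !ffunE.
by have [->|/fg ->//] := eqVneq (x i) 0; rewrite !scaler0.
Qed.

Lemma rip_mulV P x y : rip (mulV P x) y = rip x (mulV (adj P) y).
Proof.
apply: eq_bigr => i _.
transitivity (\sum_k \sum_l rd (P k l * x i l 0) (y i k 0)).
  apply: eq_bigr => k _; rewrite ffunE mxE.
  by elim/big_rec2: _ => [|l u v _ <-]; rewrite ?rd0l ?rdDl.
rewrite exchange_big; apply: eq_bigr => l _; rewrite ffunE mxE rdC.
under eq_bigr do rewrite rdJ rdC.
by elim/big_rec2: _ => [|k u v _ ->]; rewrite ?rd0l // rdDl !mxE.
Qed.

Lemma rip_dg f x y : rip (dg f x) y = rip x (dg (fun i => (f i)^*) y).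
Proof.
by apply: eq_bigr => i _; apply: eq_bigr => k _; rewrite !ffunE !mxE rdJ.
Qed.

Lemma rip_dgr (f : I -> R) x y :
  rip (dg (fun i => (f i)%:C) x) y = rip x (dg (fun i => (f i)%:C) y).
Proof.
rewrite rip_dg; congr (rip _ _); apply: eq_dg => i _.
by rewrite conj_Creal ?complex_real.
Qed.

Lemma rip_dg_le (f g : I -> R) x : (forall i, x i != 0 -> f i <= g i) ->
  rip (dg (fun i => (f i)%:C) x) x <= rip (dg (fun i => (g i)%:C) x) x.
Proof.
move=> fg; apply: ler_sum => i _; have [x0|x0] := eqVneq (x i) 0.
  by rewrite ler_sum // => k _; rewrite !ffunE x0 !mxE !mulr0.
apply: ler_sum => k _; rewrite !ffunE !mxE !rdZ.
by rewrite ler_wpM2r ?rd_ge0 // fg.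
Qed.

Lemma rip_dg_cst (a : R) x : rip (dg (fun=> a%:C) x) x = a * rip x x.
Proof.
by rewrite -ripZl; congr (rip _ _); apply/ffunP => i; rewrite !ffunE.
Qed.

Lemma nm_dg (f : I -> R) (a : R) x : 0 <= a ->
  (forall i, x i != 0 -> `|f i| <= a) -> nm (dg (fun i => (f i)%:C) x) <= a * nm x.
Proof.
move=> a0 fa; rewrite nm_le_sqr ?mulr_ge0 ?nm_ge0 // exprMn sqr_nm.
rewrite -rip_dgr dgM -rip_dg_cst.
rewrite (@eq_dg _ (fun i => (f i * f i)%:C)); last by move=> i _; rewrite rmorphM.
apply: rip_dg_le => i /fa fi; rewrite -expr2 -[leLHS]ger0_norm ?sqr_ge0 // normrX.
by rewrite ler_sqr ?nnegrE ?normr_ge0.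
Qed.

Lemma nmZC (c : C) x : nm (c *: x) <= (`|complex.Re c| + `|complex.Im c|) * nm x.
Proof.
rewrite {1}[c]complex_ReIm scalerDl -scalerA.
apply: le_trans (nmD _ _) _; rewrite !nmZ mulrDl.
by rewrite [nm (_ *: x)](_ : _ = nm x) // /nm ripi.
Qed.

(** A crude bound for the operator norm. It depends on the matrix alone, so that later constants are
    uniform in the index set and the truncation. *)
Definition mxbound P : R :=
  \sum_k \sum_l (`|complex.Re (P k l)| + `|complex.Im (P k l)|).

Lemma mxbound_ge0 P : 0 <= mxbound P.
Proof. by apply: sumr_ge0 => k _; apply: sumr_ge0 => l _; rewrite addr_ge0. Qed.

Lemma nm_mulV P x : nm (mulV P x) <= mxbound P * nm x.
Proof.
(* Expansion of [P] in matrix units, each of norm at most 1. *)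
have -> : mulV P x = \sum_k \sum_l P k l *: mulV (delta_mx k l) x.
  apply/ffunP => i; rewrite ffunE sum_ffunE {1}[P]matrix_sum_delta mulmx_suml.
  apply: eq_bigr => k _; rewrite sum_ffunE mulmx_suml; apply: eq_bigr => l _.
  by rewrite !ffunE scalemxAl.
apply: le_trans (nm_sum _ _ _) _; rewrite /mxbound mulr_suml.
apply: ler_sum => k _; apply: le_trans (nm_sum _ _ _) _; rewrite mulr_suml.
apply: ler_sum => l _; apply: le_trans (nmZC _ _) _.
rewrite ler_wpM2l ?addr_ge0 // nm_le_sqr ?nm_ge0 // sqr_nm.
apply: ler_sum => i _; rewrite (bigD1 k) //= big1 ?addr0; last first.
  by move=> k' kk'; rewrite !ffunE mxE big1 ?rd0l // => l' _; rewrite mxE (negPf kk') mul0r.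
rewrite (bigD1 l) //= !ffunE mxE (bigD1 l) //= mxE !eqxx mul1r big1 ?addr0; last first.
  by move=> l' ll'; rewrite mxE (negPf ll') andbF mul0r.
by rewrite lerDl sumr_ge0 // => l' _; apply: rd_ge0.
Qed.

Lemma coordv_mulV P (A : {set I}) x : x \in coordv A -> mulV P x \in coordv A.
Proof. by move/coordvP => h; apply/coordvP => i /h hi; rewrite ffunE hi mulmx0. Qed.

Lemma coordv_dg f (A : {set I}) x : x \in coordv A -> dg f x \in coordv A.
Proof. by move/coordvP => h; apply/coordvP => i /h hi; rewrite ffunE hi scaler0. Qed.

End PointwiseOperators.

(** * Fock space *)

Section FockSpace.
Variables (R : realType) (S : finType) (d M N : nat).
Local Notation C := R[i].
Local Notation multi := {ffun 'I_d -> 'I_M.+1}.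
Local Notation V := {ffun S * multi -> 'cV[C]_N}.
Implicit Types (x y : V) (a : multi) (j : 'I_d).

Definition rt (n : nat) : R := Num.sqrt n%:R.

Lemma rt_sqr n : rt n * rt n = n%:R.
Proof. by rewrite -expr2 sqr_sqrtr ?ler0n. Qed.

Definition inc j a : multi := [ffun i => if i == j then inord (a i).+1 else a i].
Definition dec j a : multi := [ffun i => if i == j then inord (a i).-1 else a i].
Definition deg a : nat := \sum_j a j.

Lemma incE j a i : (a j < M)%N -> inc j a i = (a i + (i == j))%N :> nat.
Proof.
by move=> aM; rewrite ffunE; case: eqP => [->|_]; rewrite ?inordK ?addn1 ?addn0.
Qed.

Lemma decE j a i : dec j a i = (a i - (i == j))%N :> nat.
Proof.
rewrite ffunE; case: eqP => [->|_]; last by rewrite subn0.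
by rewrite inordK ?subn1 // (leq_ltn_trans (leq_pred _)).
Qed.

Lemma inc_max j a : (M <= a j)%N -> inc j a j = 0 :> nat.
Proof.
move=> aM; rewrite ffunE eqxx /inord /insubd insubN // -leqNgt ltnS //.
Qed.

Lemma incK j a : (a j < M)%N -> dec j (inc j a) = a.
Proof.
move=> aM; apply/ffunP => i; apply/val_inj; rewrite /= decE incE //.
by rewrite addnK.
Qed.

Lemma decK j a : (0 < a j)%N -> inc j (dec j a) = a.
Proof.
move=> a0; apply/ffunP => i; apply/val_inj; rewrite /= incE; last first.
  by rewrite decE eqxx subn1 prednK // -ltnS.
by rewrite decE subnK //; case: eqP => // ->.
Qed.

Lemma inc_dec i j a : i != j -> (a i < M)%N -> inc i (dec j a) = dec j (inc i a).
Proof.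
move=> ij aM; have aM' : (dec j a i < M)%N by rewrite decE (negPf ij) subn0.
apply/ffunP => k; apply/val_inj; rewrite /= incE // !decE incE //.
by have [->|ki] := eqVneq k i; rewrite ?(negPf ij) ?subn0 ?addn0.
Qed.

Lemma inc_inc i j a : (a i < M)%N -> (a j < M)%N -> i != j ->
  inc i (inc j a) = inc j (inc i a).
Proof.
move=> ai aj ij; have ji : j != i by rewrite eq_sym.
have h1 : (inc j a i < M)%N by rewrite incE // (negPf ij) addn0.
have h2 : (inc i a j < M)%N by rewrite incE // (negPf ji) addn0.
by apply/ffunP => k; apply/val_inj;
   rewrite /= (incE _ h1) (incE _ aj) (incE _ h2) (incE _ ai) addnAC.
Qed.

Lemma dec_dec i j a : dec i (dec j a) = dec j (dec i a).
Proof. by apply/ffunP => k; apply/val_inj; rewrite /= !decE subnAC. Qed.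

Lemma deg_inc j a : (a j < M)%N -> deg (inc j a) = (deg a).+1.
Proof.
move=> aM; rewrite /deg (eq_bigr _ (fun i _ => incE i aM)) big_split /= -[RHS]addn1.
by congr (_ + _)%N; rewrite (bigD1 j) //= eqxx big1 // => i /negPf ->.
Qed.

Lemma deg_dec j a : (0 < a j)%N -> (deg (dec j a)).+1 = deg a.
Proof.
move=> a0; rewrite -{2}(decK a0) deg_inc // decE eqxx subn1 prednK //.
by rewrite -ltnS.
Qed.

Lemma leq_deg j a : (a j <= deg a)%N.
Proof. by rewrite /deg (bigD1 j) //= leq_addr. Qed.

(* Multi-indices are truncated at [M] so as to stay in a finite type: [inc] wraps
   [M] around to 0, whence the test in [ann], while [dec] fixes 0, where the
   coefficient in [cre] vanishes.  The commutation relations hold on vectors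
   supported in degrees less than [M]. *)
Definition ann j x : V :=
  [ffun q : S * multi => if (q.2 j < M)%N then (rt (q.2 j).+1)%:C *: x (q.1, inc j q.2) else 0].
Definition cre j x : V := [ffun q : S * multi => (rt (q.2 j))%:C *: x (q.1, dec j q.2)].

Lemma annE j x s a :
  ann j x (s, a) = if (a j < M)%N then (rt (a j).+1)%:C *: x (s, inc j a) else 0.
Proof. by rewrite [LHS]ffunE. Qed.

Lemma creE j x s a : cre j x (s, a) = (rt (a j))%:C *: x (s, dec j a).
Proof. by rewrite [LHS]ffunE. Qed.

Lemma ann_linear j : linear (ann j).
Proof.
move=> c x y; apply/ffunP => q; rewrite !ffunE.
by case: ifP => _; rewrite ?scalerDr ?scalerA ?(mulrC c) // scaler0 addr0.
Qed.
HB.instance Definition _ j := GRing.isLinear.Build C V V _ (ann j) (ann_linear j).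

Lemma cre_linear j : linear (cre j).
Proof.
by move=> c x y; apply/ffunP => q; rewrite !ffunE scalerDr !scalerA (mulrC c).
Qed.
HB.instance Definition _ j := GRing.isLinear.Build C V V _ (cre j) (cre_linear j).

(** [inc j] is a bijection from the multi-indices with [a j < M] onto those with [0 < a j], with
    inverse [dec j]; the remaining terms on either side vanish. *)
Lemma rip_ann j x y : rip (ann j x) y = rip x (cre j y).
Proof.
pose F (q : S * multi) := \sum_k rd (x q k 0) (cre j y q k 0).
have LE (q : S * multi) : \sum_k rd (ann j x q k 0) (y q k 0) =
    if (q.2 j < M)%N then F (q.1, inc j q.2) else 0.
  case: q => s a; rewrite /F annE /=; case: ifP => aM; last first.
    by rewrite big1 // => k _; rewrite mxE rd0l.
  apply: eq_bigr => k _; rewrite creE /= incE // eqxx addn1 incK // !mxE.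
  by rewrite rdZ [in RHS]rdC rdZ rdC.
rewrite /rip (eq_bigr _ (fun q _ => LE q)) -[RHS]/(\sum_q F q).
transitivity (\sum_s \sum_(a : multi) if (a j < M)%N then F (s, inc j a) else 0).
  by rewrite pair_bigA; apply: eq_bigr => -[].
transitivity (\sum_s \sum_a F (s, a)); last first.
  by rewrite pair_bigA; apply: eq_bigr => -[].
apply: eq_bigr => s _; rewrite -big_mkcond /=.
rewrite [RHS](bigID (fun a : multi => (0 < a j)%N)) /= [X in _ = _ + X]big1 ?addr0; last first.
  move=> a; rewrite -eqn0Ngt => /eqP a0; rewrite /F big1 // => k _.
  by rewrite rdC creE a0 /rt sqrtr0 scale0r mxE rd0l.
rewrite [RHS](reindex_onto (inc j) (dec j)) /=; last by move=> a a0; rewrite decK.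
apply: eq_bigl => a; have [aM|aM] := ltnP (a j) M; last by rewrite inc_max.
by rewrite incK // incE // eqxx addn1 eqxx.
Qed.

Lemma rip_cre j x y : rip (cre j x) y = rip x (ann j y).
Proof. by rewrite ripC -rip_ann ripC. Qed.

Lemma cre_ann j x : cre j (ann j x) = dg (fun q : S * multi => ((q.2 j)%:R)%:C) x.
Proof.
apply/ffunP => -[s a]; rewrite creE annE [RHS]ffunE /=.
have [a0|a0] := posnP (a j); first by rewrite a0 /rt sqrtr0 !scale0r.
have h : (dec j a j).+1 = a j by rewrite decE eqxx subn1 prednK.
by rewrite h -ltnS (ltn_ord (a j)) decK // scalerA -rmorphM rt_sqr.
Qed.

Definition low D : {set S * multi} := [set q | (deg q.2 <= D)%N].

Lemma lowE D x s a : x \in coordv (low D) -> (D < deg a)%N -> x (s, a) = 0.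
Proof. by move=> /coordvP h hD; apply: h; rewrite inE -ltnNge. Qed.

Lemma lowP D x : (forall s a, (D < deg a)%N -> x (s, a) = 0) -> x \in coordv (low D).
Proof. by move=> h; apply/coordvP => -[s a]; rewrite inE -ltnNge; apply: h. Qed.

Lemma low_ann D j x : x \in coordv (low D) -> ann j x \in coordv (low D).
Proof.
move=> xD; apply: lowP => s a aD; rewrite annE; case: ifP => // aM.
by rewrite (lowE _ xD) ?scaler0 // deg_inc // ltnW.
Qed.

Lemma low_cre D j x : x \in coordv (low D) -> cre j x \in coordv (low D.+1).
Proof.
move=> xD; apply: lowP => s a aD; rewrite creE.
have [a0|a0] := posnP (a j); first by rewrite a0 /rt sqrtr0 scale0r.
by rewrite (lowE _ xD) ?scaler0 // -ltnS deg_dec.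
Qed.

Lemma coordv_lowS D D' x : (D <= D')%N -> x \in coordv (low D) -> x \in coordv (low D').
Proof.
move=> DD' /(subvP (coordvS _ _ _)); apply; apply/subsetP => q.
by rewrite !inE => /leq_trans; apply.
Qed.

Lemma ccr D i j x : (D < M)%N -> x \in coordv (low D) ->
  ann i (cre j x) = cre j (ann i x) + (i == j)%:R *: x.
Proof.
move=> DM xD; apply/ffunP => -[s a]; rewrite [RHS]ffunE [X in _ + X]ffunE !annE !creE !annE.
have [<-|ij] := eqVneq i j; last first.
  rewrite scale0r addr0 decE (negPf ij) subn0.
  have [aM|aM] := ltnP (a i) M; last by rewrite scaler0.
  rewrite (incE j aM) eq_sym (negPf ij) addn0 (inc_dec ij aM) !scalerA.
  by congr (_ *: _); apply: mulrC.
(* If [a i = M], the left side is cut to 0; so is the right side, because [x] lives in degrees at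
   most [D < M]. *)
rewrite scale1r; have [aM|aM] := ltnP (a i) M; last first.
  have x0 : x (s, a) = 0.
    exact: lowE xD (leq_trans DM (leq_trans aM (leq_deg i a))).
  have a0 : (0 < a i)%N by apply: leq_trans aM; apply: leq_ltn_trans DM.
  by rewrite (decK a0) x0 scaler0 if_same scaler0 addr0.
rewrite incE // eqxx addn1 incK // scalerA -rmorphM rt_sqr.
have [a0|a0] := posnP (a i).
  by rewrite a0 /rt sqrtr0 scale0r add0r scale1r.
have h : (dec i a i).+1 = a i by rewrite decE eqxx subn1 prednK.
rewrite h (ltnW aM) decK // scalerA -rmorphM rt_sqr -natr1 rmorphD rmorph1.
by rewrite scalerDl !scale1r.
Qed.

Lemma cre_cre i j x : cre i (cre j x) = cre j (cre i x).
Proof.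
have [->//|ij] := eqVneq i j; apply/ffunP => -[s a]; rewrite !creE.
rewrite !decE (negPf ij) eq_sym (negPf ij) !subn0 dec_dec !scalerA; congr (_ *: _); apply: mulrC.
Qed.

Lemma ann_ann i j x : ann i (ann j x) = ann j (ann i x).
Proof.
have [->//|ij] := eqVneq i j; have ji : j != i by rewrite eq_sym.
apply/ffunP => -[s a]; rewrite !annE.
have [ai|ai] := ltnP (a i) M; have [aj|aj] := ltnP (a j) M => //.
- rewrite (incE j ai) (incE i aj) (negPf ij) (negPf ji) !addn0 ai aj.
  by rewrite (inc_inc ai aj ij) !scalerA; congr (_ *: _); apply: mulrC.
- by rewrite (incE j ai) (negPf ji) addn0 ltnNge aj /= scaler0.
- by rewrite (incE i aj) (negPf ij) addn0 ltnNge ai /= scaler0.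
Qed.

Lemma mulV_ann P j x : mulV P (ann j x) = ann j (mulV P x).
Proof.
apply/ffunP => -[s a]; rewrite !ffunE /=.
by case: ifP => _; rewrite ?mulmx0 // scalemxAr.
Qed.

Lemma mulV_cre P j x : mulV P (cre j x) = cre j (mulV P x).
Proof. by apply/ffunP => q; rewrite !ffunE scalemxAr. Qed.

Lemma nm_ann D j x : x \in coordv (low D) -> nm (ann j x) <= rt D * nm x.
Proof.
move=> xD; rewrite nm_le_sqr ?mulr_ge0 ?nm_ge0 ?sqrtr_ge0 // exprMn sqr_nm.
rewrite [rt D ^+ 2]expr2 rt_sqr rip_ann cre_ann ripC -rip_dg_cst.
apply: rip_dg_le => -[s a] /= xa; rewrite ler_nat (leq_trans (leq_deg j a)) //.
by apply: contraNT xa; rewrite -ltnNge => /(lowE _ xD) ->.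
Qed.

Lemma nm_cre D j x : (D < M)%N -> x \in coordv (low D) ->
  nm (cre j x) <= rt D.+1 * nm x.
Proof.
move=> DM xD; rewrite nm_le_sqr ?mulr_ge0 ?nm_ge0 ?sqrtr_ge0 // exprMn sqr_nm.
rewrite [rt D.+1 ^+ 2]expr2 rt_sqr rip_cre (ccr j j DM xD) eqxx scale1r ripDr.
rewrite -rip_ann -sqr_nm -natr1 mulrDl mul1r lerD2r.
rewrite -[D%:R]rt_sqr -expr2 -(sqr_nm x) -exprMn ler_sqr ?nnegrE ?mulr_ge0 ?nm_ge0 ?sqrtr_ge0 //.
exact: nm_ann.
Qed.

(** By the commutation relations, the sum of the [ann j (cre j x)] is the number operator plus [d].
    This turns the bound of [garding] into one that grows with the degree. *)
Lemma sum_rip_cre D x : (D < M)%N -> x \in coordv (low D) ->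
  \sum_j rip (cre j x) (cre j x) = rip (dg (fun q : S * multi => ((deg q.2 + d)%:R)%:C) x) x.
Proof.
move=> DM xD; under eq_bigr => j _ do
  rewrite rip_cre (ccr j j DM xD) eqxx scale1r ripDr cre_ann.
rewrite big_split /= sumr_const card_ord -rip_sumr -mulr_natl -ripZr -ripDr ripC.
congr (rip _ _); apply/ffunP => q; rewrite !ffunE sum_ffunE natrD.
under eq_bigr do rewrite ffunE.
by rewrite -scaler_suml -!scalerDl -rmorph_sum -rmorphD natr_sum.
Qed.

End FockSpace.

(** * The Garding inequality *)

Section Garding.
Variables (R : realType) (d N : nat).
Local Notation C := R[i].

Definition vn (v : 'cV[C]_N) : R := \sum_k rd (v k 0) (v k 0).

(* [|L(z) w| >= c |z| |w|] for [L(z) = sum_j z_j P_j + conj(z_j) Q_j]. *)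
Definition elliptic (P Q : 'I_d -> 'M[C]_N) (c : R) :=
  forall (z : 'I_d -> C) (w : 'cV[C]_N),
    c ^+ 2 * \sum_j vn (z j *: w) <=
    vn (\sum_j (P j *m (z j *: w) + Q j *m ((z j)^* *: w))).

Variables (S : finType) (M : nat).
Local Notation multi := {ffun 'I_d -> 'I_M.+1}.
Local Notation V := {ffun S * multi -> 'cV[C]_N}.
Implicit Types (x y : V) (P Q : 'I_d -> 'M[C]_N).

Definition Dop P Q x : V :=
  \sum_j (mulV (P j) (cre j x) + mulV (Q j) (ann j x)).

Lemma Dop_linear P Q : linear (Dop P Q).
Proof.
move=> c x y; rewrite /Dop scaler_sumr -big_split; apply: eq_bigr => j _.
by rewrite cre_linear ann_linear !mulV_linear scalerDr addrACA.
Qed.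
HB.instance Definition _ P Q := GRing.isLinear.Build C V V _ (Dop P Q) (Dop_linear P Q).

Lemma rip_Dop P Q x y :
  rip (Dop P Q x) y = rip x (Dop (fun j => adj (Q j)) (fun j => adj (P j)) y).
Proof.
rewrite rip_suml rip_sumr; apply: eq_bigr => j _.
rewrite ripDl ripDr addrC !rip_mulV rip_ann rip_cre.
by rewrite mulV_cre mulV_ann.
Qed.

Lemma fock1S n (z : C) : (rt R n.+1)%:C * fock1 n.+1 z = z * fock1 n z.
Proof.
have e : rt R n.+1 * (Num.sqrt (n.+1`!)%:R)^-1 = (Num.sqrt (n`!)%:R)^-1 :> R.
  rewrite factS natrM sqrtrM ?ler0n // invfM mulrA divff ?mul1r //.
  by rewrite gt_eqF // sqrtr_gt0 ltr0n.
by rewrite /fock1 exprS mulrA -rmorphM e mulrCA.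
Qed.

Lemma fock_inc j (a : multi) (z : 'I_d -> C) : (a j < M)%N ->
  (rt R (a j).+1)%:C * fock (fun i => inc j a i) z = z j * fock (fun i => a i) z.
Proof.
move=> aM; rewrite /fock (bigD1 j) //= [in RHS](bigD1 j) //=.
rewrite (mulrA (rt _ _)%:C (fock1 _ _)) (mulrA (z j) (fock1 _ _)).
rewrite (incE j aM) eqxx addn1 fock1S; congr (_ * _); apply: eq_bigr => i ij.
by rewrite (incE i aM) (negPf ij) addn0.
Qed.

Section Isometry.
Variables (K : finType) (w : K -> R) (p : K -> 'I_d -> C).
Hypothesis w0 : forall q, 0 <= w q.
Hypothesis wp : forall a b : multi,
    \sum_q (w q)%:C * (fock (fun j => a j) (p q) * (fock (fun j => b j) (p q))^*) =
    (a == b)%:R.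
Local Notation U := {ffun S * K -> 'cV[C]_N}.

(* [wave] evaluates a Fock vector at the nodes of the quadrature; it is an isometry
   which intertwines [cre j] with multiplication by [z_j]. *)
Let wave x : U :=
  [ffun q => (Num.sqrt (w q.2))%:C *: \sum_(a : multi) fock (fun i => a i) (p q.2) *: x (q.1, a)].

Lemma wave_linear : linear wave.
Proof.
move=> c x y; apply/ffunP => q; rewrite !ffunE scalerA [c * _]mulrC -scalerA -scalerDr.
congr (_ *: _); rewrite scaler_sumr -big_split; apply: eq_bigr => a _ /=.
by rewrite !ffunE scalerDr !scalerA [c * _]mulrC.
Qed.
HB.instance Definition _ := GRing.isLinear.Build C V U _ wave wave_linear.

Lemma rip_wave x y : rip (wave x) (wave y) = rip x y.
Proof.
rewrite /rip; transitivity (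
  \sum_s \sum_k \sum_(a : multi) rd (x (s, a) k 0) (y (s, a) k 0)); last first.
  transitivity (\sum_s \sum_(a : multi) \sum_k rd (x (s, a) k 0) (y (s, a) k 0)).
    by apply: eq_bigr => s _; rewrite exchange_big.
  rewrite (pair_bigA _ (fun s a => \sum_k rd (x (s, a) k 0) (y (s, a) k 0))).
  by apply: eq_bigr => -[].
transitivity (\sum_s \sum_q \sum_k rd (wave x (s, q) k 0) (wave y (s, q) k 0)).
  rewrite (pair_bigA _ (fun s q => \sum_k rd (wave x (s, q) k 0) (wave y (s, q) k 0))).
  by apply: eq_bigr => -[].
apply: eq_bigr => s _; rewrite exchange_big; apply: eq_bigr => k _.
have rdE (z z' : C) : rd z z' = complex.Re (z * z'^*).
  by case: z => u v; case: z' => u' v'; rewrite /rd /=; ring.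
pose RE : C -> R := @complex.Re R.
have REsum (J : finType) (F : J -> C) : RE (\sum_j F j) = \sum_j RE (F j).
  by apply: (big_morph RE) => // -[? ?] [? ?].
transitivity (RE (\sum_q \sum_(a : multi) \sum_(b : multi)
    ((w q)%:C * (fock (fun j => a j) (p q) * (fock (fun j => b j) (p q))^*)) *
    (x (s, a) k 0 * (y (s, b) k 0)^*))).
  rewrite REsum; apply: eq_bigr => q _; rewrite rdE -/(RE _); congr (RE _).
  rewrite !ffunE !mxE !summxE rmorphM rmorph_sum /= conj_Creal ?complex_real //.
  rewrite mulrACA -rmorphM -expr2 sqr_sqrtr // mulr_suml mulr_sumr.
  apply: eq_bigr => a _; rewrite !mulr_sumr; apply: eq_bigr => b _.
  by rewrite !mxE rmorphM /=; ring.
rewrite exchange_big /= REsum; apply: eq_bigr => a _; rewrite exchange_big /=.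
under eq_bigr do rewrite -mulr_suml wp.
rewrite (bigD1 a) //= eqxx mul1r big1 ?addr0 -?rdE // => b ba.
by rewrite eq_sym (negPf ba) mul0r.
Qed.

Let mz j (u : U) : U := dg (fun q => p q.2 j) u.
Let mzc j (u : U) : U := dg (fun q => (p q.2 j)^*) u.

(** Term by term this is [fock_inc]; the terms with [a j = M], where [inc j] wraps around, vanish
    since [D < M]. *)
Lemma wave_cre D j x : (D < M)%N -> x \in coordv (low S d M D) ->
  mz j (wave x) = wave (cre j x).
Proof.
move=> DM xD; apply/ffunP => -[s q]; rewrite !ffunE /= scalerA [p q j * _]mulrC -scalerA.
congr (_ *: _); rewrite scaler_sumr.
rewrite [RHS](bigID (fun a : multi => (0 < a j)%N)) /= [X in _ = _ + X]big1 ?addr0; last first.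
  by move=> a; rewrite -eqn0Ngt => /eqP a0; rewrite creE a0 /rt sqrtr0 scale0r scaler0.
rewrite [RHS](reindex_onto (inc j) (dec j)) /=; last by move=> a a0; rewrite decK.
rewrite (bigID (fun a : multi => (a j < M)%N)) /= [X in _ + X]big1 ?addr0; last first.
  move=> a; rewrite -leqNgt => aM; rewrite (lowE s xD) ?scaler0 //.
  exact: leq_trans DM (leq_trans aM (leq_deg j a)).
apply: eq_big => a; last first.
  by move=> aM; rewrite creE (incK aM) (incE j aM) eqxx addn1 !scalerA [_ * (rt _ _)%:C]mulrC fock_inc.
have [aM|aM] := ltnP (a j) M; last by rewrite inc_max.
by rewrite (incK aM) (incE j aM) eqxx addn1 eqxx.
Qed.

Lemma wave_mulV (T : 'M[C]_N) x : wave (mulV T x) = mulV T (wave x).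
Proof.
apply/ffunP => q; rewrite !ffunE -scalemxAr mulmx_sumr; congr (_ *: _).
by apply: eq_bigr => a _; rewrite ffunE scalemxAr.
Qed.

Lemma rip_mz j u v : rip (mz j u) v = rip u (mzc j v).
Proof. exact: rip_dg. Qed.

Lemma rip_mzc j u v : rip (mzc j u) v = rip u (mz j v).
Proof. by rewrite ripC -rip_mz ripC. Qed.

Lemma mz_mzc i j u : mz i (mzc j u) = mzc j (mz i u).
Proof. by rewrite /mz /mzc !dgM; apply: eq_dg => q _; rewrite mulrC. Qed.

Lemma mulV_mz (T : 'M[C]_N) j u : mulV T (mz j u) = mz j (mulV T u).
Proof. exact: mulV_dg. Qed.

Lemma mulV_mzc (T : 'M[C]_N) j u : mulV T (mzc j u) = mzc j (mulV T u).
Proof. exact: mulV_dg. Qed.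

(** Ellipticity at each node bounds |A + B|^2 from below, where A and B are the classical parts
    applied to [wave x]. Their quantum versions A' and B' have |A| = |A'| and the same product, but
    |B|^2 exceeds |B'|^2 by a commutator, the sum of the |Q_j x|^2. *)
Lemma garding_aux P Q c D x : elliptic P Q c -> (D.+1 < M)%N ->
    x \in coordv (low S d M D) ->
  c ^+ 2 * \sum_j rip (cre j x) (cre j x) <=
  rip (Dop P Q x) (Dop P Q x) + \sum_j rip (mulV (Q j) x) (mulV (Q j) x).
Proof.
move=> ell DM xD; have DM' : (D < M)%N := ltnW DM.
have lowx T : mulV T x \in coordv (low S d M D) by apply: coordv_mulV.
have lowcx T j : cre j (mulV T x) \in coordv (low S d M D.+1) by apply: low_cre.
pose A := \sum_j mulV (P j) (mz j (wave x)).
pose B := \sum_j mulV (Q j) (mzc j (wave x)).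
have h1 : c ^+ 2 * \sum_j rip (cre j x) (cre j x) <= rip (A + B) (A + B).
  under eq_bigr do rewrite -rip_wave -(wave_cre _ DM' xD).
  rewrite /rip exchange_big mulr_sumr; apply: ler_sum => q _ /=.
  apply: le_trans (le_trans (ell (fun j => p q.2 j) (wave x q)) _).
    rewrite ler_wpM2l ?sqr_ge0 // ler_sum // => j _.
    by rewrite /vn ler_sum // => k _; rewrite ffunE.
  rewrite /vn ler_sum // => k _; rewrite /A /B -big_split /= sum_ffunE.
  rewrite (eq_bigr (fun j => (mulV (P j) (mz j (wave x)) + mulV (Q j) (mzc j (wave x))) q)) //.
  by move=> j _; rewrite [RHS]ffunE !mulVE !dgE.
apply: le_trans h1 _.
pose A' := \sum_j cre j (mulV (P j) x); pose B' := \sum_j ann j (mulV (Q j) x).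
have DE : Dop P Q x = A' + B'.
  by rewrite /Dop big_split /=; congr (_ + _); apply: eq_bigr => j _; rewrite ?mulV_cre ?mulV_ann.
have AA : A = wave A'.
  rewrite /A' linear_sum; apply: eq_bigr => j _ /=.
  by rewrite mulV_mz -wave_mulV (wave_cre _ DM' (lowx _)).
(* The factor conj(z_j) is moved to the other side as z_j, where it meets a vector of degree up to
   [D.+1]; hence the bound [D.+1 < M]. *)
have hAB : rip A B = rip A' B'.
  rewrite AA /A' /B' /B linear_sum !rip_suml; apply: eq_bigr => i _.
  rewrite !rip_sumr; apply: eq_bigr => j _ /=.
  by rewrite mulV_mzc -rip_mz -wave_mulV (wave_cre _ DM (lowcx _ _)) rip_wave rip_cre.
(* Multiplications by z_i and conj(z_j) commute, but their quantum versions do not: the reordering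
   by [ccr] produces the diagonal terms. *)
have hBB : rip B B = rip B' B' + \sum_j rip (mulV (Q j) x) (mulV (Q j) x).
  rewrite /B /B' !rip_suml -big_split; apply: eq_bigr => i _ /=.
  rewrite !rip_sumr [X in _ = _ + X](_ : _ =
     \sum_j (i == j)%:R * rip (mulV (Q i) x) (mulV (Q j) x)); last first.
    rewrite (bigD1 i) //= eqxx mul1r big1 ?addr0 // => j ji.
    by rewrite eq_sym (negPf ji) mul0r.
  rewrite -big_split; apply: eq_bigr => j _ /=.
  rewrite !mulV_mzc -!wave_mulV rip_mzc mz_mzc -rip_mz.
  rewrite !(wave_cre _ DM' (lowx _)) rip_wave rip_cre (ccr j i DM' (lowx _)) ripDr.
  rewrite -rip_ann eq_sym.
  have -> : rip (mulV (Q i) x) ((i == j)%:R *: mulV (Q j) x) =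
      (i == j)%:R * rip (mulV (Q i) x) (mulV (Q j) x).
    by case: (i == j); rewrite ?scale1r ?mul1r // scale0r rip0r mul0r.
  by [].
rewrite DE !ripDl !ripDr hBB (ripC B A) hAB AA rip_wave (ripC B' A'); lra.
Qed.

End Isometry.

Lemma garding P Q c D x : elliptic P Q c -> (D.+1 < M)%N ->
    x \in coordv (low S d M D) ->
  c ^+ 2 * \sum_j rip (cre j x) (cre j x) <=
  rip (Dop P Q x) (Dop P Q x) + \sum_j rip (mulV (Q j) x) (mulV (Q j) x).
Proof.
move=> ell DM xD; have [K [w [p [w0 wp]]]] := quadrature R d M.
exact: (@garding_aux _ w p w0 wp P Q c D x ell DM xD).
Qed.

Lemma nm_Dop P Q D x : (D < M)%N -> x \in coordv (low S d M D) ->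
  nm (Dop P Q x) <= (\sum_j (mxbound (P j) + mxbound (Q j))) * rt R D.+1 * nm x.
Proof.
move=> DM xD; apply: le_trans (nm_sum _ _ _) _; rewrite -mulrA mulr_suml.
apply: ler_sum => j _; apply: le_trans (nmD _ _) _; rewrite mulrDl.
apply: lerD; apply: le_trans (nm_mulV _ _) _; rewrite ler_wpM2l ?mxbound_ge0 //.
  exact: nm_cre.
apply: le_trans (nm_ann _ xD) _; rewrite ler_wpM2r ?nm_ge0 //.
by rewrite ler_sqrt ?ler0n // ler_nat.
Qed.

End Garding.

(** * The symmetrised operator and its commutators with functions of the degree *)

Section CutoffOperator.
Variables (R : realType) (d N : nat) (S : finType) (M : nat).
Local Notation C := R[i].
Local Notation multi := {ffun 'I_d -> 'I_M.+1}.
Local Notation V := {ffun S * multi -> 'cV[C]_N}.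
Implicit Types (x y : V).

Definition dgr (f : S * multi -> R) x : V := dg (fun q => (f q)%:C) x.

Lemma dgr_linear f : linear (dgr f). Proof. exact: dg_linear. Qed.
HB.instance Definition _ f := GRing.isLinear.Build C V V _ (dgr f) (dgr_linear f).

Lemma dgrE f x q : dgr f x q = (f q)%:C *: x q. Proof. exact: dgE. Qed.

Lemma dgrM f g x : dgr f (dgr g x) = dgr (fun q => f q * g q) x.
Proof. by apply/ffunP => q; rewrite !dgrE scalerA rmorphM. Qed.

Lemma rip_dgr_sym f x y : rip (dgr f x) y = rip x (dgr f y).
Proof. exact: rip_dgr. Qed.

Lemma dgr_comm f g x : dgr f (dgr g x) = dgr g (dgr f x).
Proof. by rewrite !dgrM; apply: eq_dg => q _; rewrite mulrC. Qed.

Lemma eq_dgr f g x : (forall q, x q != 0 -> f q = g q) -> dgr f x = dgr g x.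
Proof. by move=> h; apply: eq_dg => q /h ->. Qed.

Lemma coordv_dgr f A x : x \in coordv A -> dgr f x \in coordv A.
Proof. exact: coordv_dg. Qed.

Lemma nm_dgr f a x : 0 <= a -> (forall q, x q != 0 -> `|f q| <= a) ->
  nm (dgr f x) <= a * nm x.
Proof. exact: nm_dg. Qed.

Lemma subVE x y q : (x - y) q = x q - y q. Proof. by rewrite 2!ffunE. Qed.

Lemma rip_orthD x y : rip x y = 0 -> rip (x + y) (x + y) = rip x x + rip y y.
Proof. by move=> xy; rewrite !ripDl !ripDr (ripC y x) xy addr0 add0r. Qed.

Section Commutators.
Variables (F : S -> nat -> R) (D : nat) (de : R).
Hypothesis de0 : 0 <= de.
Hypothesis Fde : forall s t, (t <= D)%N -> `|F s t - F s t.+1| <= de.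
Local Notation f := (fun q : S * multi => F q.1 (deg q.2)).

(** [cre j] raises the degree by one, so the commutator is [cre j] applied after multiplication by
    the differences of consecutive values of [F]. *)
Lemma nm_cre_comm j x : (D < M)%N -> x \in coordv (low S d M D) ->
  nm (cre j (dgr f x) - dgr f (cre j x)) <= rt R D.+1 * (de * nm x).
Proof.
move=> DM xD; pose g (q : S * multi) := F q.1 (deg q.2) - F q.1 (deg q.2).+1.
have -> : cre j (dgr f x) - dgr f (cre j x) = cre j (dgr g x).
  apply/ffunP => -[s a]; rewrite subVE dgrE !creE !dgrE /g /=.
  have [a0|a0] := posnP (a j); first by rewrite a0 /rt sqrtr0 !scale0r scaler0 subrr.
  by rewrite deg_dec // rmorphB scalerBl scalerBr !scalerA [in X in _ - X]mulrC.
apply: le_trans (nm_cre _ DM (coordv_dgr _ xD)) _; rewrite ler_wpM2l ?sqrtr_ge0 //.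
apply: nm_dgr => // -[s a] xa; apply: Fde; rewrite leqNgt; apply: contraNN xa => aD.
by rewrite (lowE s xD).
Qed.

Lemma nm_ann_comm j x : x \in coordv (low S d M D) ->
  nm (ann j (dgr f x) - dgr f (ann j x)) <= rt R D * (de * nm x).
Proof.
move=> xD; pose g (q : S * multi) := F q.1 (deg q.2) - F q.1 (deg q.2).-1.
have -> : ann j (dgr f x) - dgr f (ann j x) = ann j (dgr g x).
  apply/ffunP => -[s a]; rewrite subVE dgrE !annE !dgrE /g /=.
  have [aM|aM] := ltnP (a j) M; last by rewrite scaler0 subr0.
  by rewrite deg_inc // rmorphB scalerBl scalerBr !scalerA [in X in _ - X]mulrC.
apply: le_trans (nm_ann _ (coordv_dgr _ xD)) _; rewrite ler_wpM2l ?sqrtr_ge0 //.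
apply: nm_dgr => // -[s a] xa; rewrite /g /=.
have aD : (deg a <= D)%N by rewrite leqNgt; apply: contraNN xa => aD; rewrite (lowE s xD).
(* In degree 0, [.-1] is the identity and [g] is 0; [ann j] kills that degree anyway. *)
by case: (deg a) aD => [|t] tD; rewrite ?subrr ?normr0 // distrC Fde // ltnW.
Qed.

Lemma nm_Dop_comm (P Q : 'I_d -> 'M[C]_N) x : (D < M)%N -> x \in coordv (low S d M D) ->
  nm (Dop P Q (dgr f x) - dgr f (Dop P Q x)) <=
  (\sum_j (mxbound (P j) + mxbound (Q j))) * rt R D.+1 * (de * nm x).
Proof.
move=> DM xD.
have -> : Dop P Q (dgr f x) - dgr f (Dop P Q x) =
    \sum_j (mulV (P j) (cre j (dgr f x) - dgr f (cre j x)) +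
            mulV (Q j) (ann j (dgr f x) - dgr f (ann j x))).
  rewrite /Dop (raddf_sum (dgr f)) /= -sumrB; apply: eq_bigr => j _.
  rewrite (raddfD (dgr f)) /= (raddfB (mulV (P j))) (raddfB (mulV (Q j))) /=.
  by rewrite /dgr !mulV_dg opprD addrACA.
apply: le_trans (nm_sum _ _ _) _; rewrite -mulrA mulr_suml.
apply: ler_sum => j _; apply: le_trans (nmD _ _) _; rewrite mulrDl.
apply: lerD; apply: le_trans (nm_mulV _ _) _; rewrite ler_wpM2l ?mxbound_ge0 //.
  exact: nm_cre_comm.
apply: le_trans (nm_ann_comm _ xD) _; rewrite ler_wpM2r ?mulr_ge0 ?nm_ge0 //.
by rewrite ler_sqrt ?ler0n // ler_nat.
Qed.

End Commutators.

Variables (P Q : 'I_d -> 'M[C]_N).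
Local Notation Pa := (fun j => adj (Q j)).
Local Notation Qa := (fun j => adj (P j)).

Definition opbound : R :=
  \sum_j (mxbound (P j) + mxbound (Q j)) + \sum_j (mxbound (adj (Q j)) + mxbound (adj (P j))).

Lemma opbound_ge0 : 0 <= opbound.
Proof. by rewrite addr_ge0 // sumr_ge0 // => j _; rewrite addr_ge0 ?mxbound_ge0. Qed.

Variable sh : S -> nat.
(** The sum has the parity of the difference [deg - sh], without truncated subtraction. *)
Definition par (q : S * multi) : bool := odd (deg q.2 + sh q.1).
Definition pr (b : bool) x : V := dgr (fun q => (par q == b)%:R) x.

Lemma prE b x q : pr b x q = if par q == b then x q else 0.
Proof. by rewrite dgrE; case: eqP => _; rewrite ?scale1r ?scale0r. Qed.

Lemma pr_linear b : linear (pr b). Proof. exact: dg_linear. Qed.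
HB.instance Definition _ b := GRing.isLinear.Build C V V _ (pr b) (pr_linear b).

Lemma pr_sum x : pr false x + pr true x = x.
Proof.
by apply/ffunP => q; rewrite ffunE !prE; case: (par q); rewrite ?addr0 ?add0r.
Qed.

Lemma pr_pr b b' x : pr b (pr b' x) = if b == b' then pr b x else 0.
Proof.
apply/ffunP => q; rewrite !prE; have [<-|bb'] := eqVneq b b'.
  by rewrite prE; case: eqP.
by rewrite ffunE; case: eqP => // ->; rewrite (negPf bb').
Qed.

Lemma rip_pr b x y : rip (pr b x) y = rip x (pr b y).
Proof. exact: rip_dgr_sym. Qed.

Lemma rip_pr_pr b b' x y : rip (pr b x) (pr b' y) = if b == b' then rip (pr b x) y else 0.
Proof.
by rewrite -rip_pr pr_pr eq_sym; case: eqP => [->//|_]; rewrite rip0l.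
Qed.

Lemma par_inc s (a : multi) j : (a j < M)%N -> par (s, inc j a) = ~~ par (s, a).
Proof. by move=> aM; rewrite /par /= deg_inc. Qed.

Lemma par_dec s (a : multi) j : (0 < a j)%N -> par (s, dec j a) = ~~ par (s, a).
Proof. by move=> a0; rewrite /par /= -(deg_dec a0) /= negbK. Qed.

Lemma pr_mulV b (T : 'M[C]_N) x : pr b (mulV T x) = mulV T (pr b x).
Proof. by rewrite /pr /dgr mulV_dg. Qed.

(** Each [cre j] and [ann j] changes the degree by one, hence flips the parity. *)
Lemma pr_Dop (P' Q' : 'I_d -> 'M[C]_N) b x : pr (~~ b) (Dop P' Q' (pr b x)) = Dop P' Q' (pr b x).
Proof.
rewrite /Dop (raddf_sum (pr (~~ b))); apply: eq_bigr => j _ /=.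
rewrite (raddfD (pr _)) /= !pr_mulV; congr (mulV _ _ + mulV _ _).
  apply/ffunP => -[s a]; rewrite prE creE prE.
  have [a0|a0] := posnP (a j); first by rewrite a0 /rt sqrtr0 scale0r if_same.
  by rewrite par_dec //; case: (par _) b => -[] /=; rewrite ?scaler0.
apply/ffunP => -[s a]; rewrite prE annE prE.
have [aM|aM] := ltnP (a j) M; last by rewrite if_same.
by rewrite par_inc //; case: (par _) b => -[] /=; rewrite ?scaler0.
Qed.

(* Taking the adjoint of [Dop P Q] on the odd part makes the operator symmetric. *)
Definition dirac x : V := Dop P Q (pr false x) + Dop Pa Qa (pr true x).

Lemma dirac_linear : linear dirac.
Proof.
move=> c x y; rewrite /dirac !pr_linear !Dop_linear scalerDr addrACA //.
Qed.
HB.instance Definition _ := GRing.isLinear.Build C V V _ dirac dirac_linear.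

Lemma dirac_dg (f : S * multi -> R) x : 
  dirac (dgr f x) - dgr f (dirac x) =
  (Dop P Q (dgr f (pr false x)) - dgr f (Dop P Q (pr false x))) +
  (Dop Pa Qa (dgr f (pr true x)) - dgr f (Dop Pa Qa (pr true x))).
Proof.
rewrite /dirac /pr !(dgr_comm _ f) (raddfD (dgr f)) /= opprD addrACA //.
Qed.

Lemma Dop_adj_adj x : Dop (fun j => adj (Qa j)) (fun j => adj (Pa j)) x = Dop P Q x.
Proof. by apply: eq_bigr => j _; rewrite !adjK. Qed.

Lemma rip_dirac x y : rip (dirac x) y = rip x (dirac y).
Proof.
have key P' Q' b u v : rip (Dop P' Q' (pr b u)) v = rip (Dop P' Q' (pr b u)) (pr (~~ b) v).
  by rewrite -rip_pr pr_Dop.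
rewrite /dirac ripDl ripDr addrC; congr (_ + _).
  by rewrite key rip_Dop Dop_adj_adj [RHS]ripC key [RHS]ripC /=.
by rewrite key rip_Dop [RHS]ripC key [RHS]ripC /=.
Qed.

Lemma nm_pr b x : nm (pr b x) <= nm x.
Proof.
rewrite -[leRHS]mul1r; apply: nm_dgr => // q _.
by case: eqP; rewrite ?normr1 ?normr0 ?ler01.
Qed.

Lemma nm_dirac D x : (D < M)%N -> x \in coordv (low S d M D) ->
  nm (dirac x) <= opbound * rt R D.+1 * nm x.
Proof.
move=> DM xD; apply: le_trans (nmD _ _) _; rewrite /opbound !mulrDl.
have h b : pr b x \in coordv (low S d M D) by apply: coordv_dgr.
apply: lerD; apply: le_trans (nm_Dop _ _ DM (h _)) _;
by rewrite ler_wpM2l ?nm_pr // mulr_ge0 ?sqrtr_ge0 // sumr_ge0 // => j _; rewrite addr_ge0 ?mxbound_ge0.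
Qed.

Lemma nm_dirac_comm F D de x : 0 <= de ->
    (forall s t, (t <= D)%N -> `|F s t - F s t.+1| <= de) ->
    (D < M)%N -> x \in coordv (low S d M D) ->
  nm (dirac (dgr (fun q => F q.1 (deg q.2)) x) - dgr (fun q => F q.1 (deg q.2)) (dirac x)) <=
  opbound * rt R D.+1 * (de * nm x).
Proof.
move=> de0 Fde DM xD; rewrite dirac_dg; apply: le_trans (nmD _ _) _.
have h b : pr b x \in coordv (low S d M D) by apply: coordv_dgr.
rewrite /opbound !mulrDl.
apply: lerD; apply: le_trans (nm_Dop_comm de0 Fde _ _ DM (h _)) _;
(rewrite ler_wpM2l // ?ler_wpM2l ?nm_pr // mulr_ge0 ?sqrtr_ge0 // sumr_ge0 // => j _;
by rewrite addr_ge0 ?mxbound_ge0).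
Qed.

(** The error terms of [garding] for [Dop P Q] and for its adjoint, added up. *)
Definition garding_cst : R :=
  \sum_j mxbound (Q j) ^+ 2 + \sum_j mxbound (adj (P j)) ^+ 2.

(** The images of the even and the odd part are orthogonal, so [garding] applies to each separately;
    by [sum_rip_cre] its left side is at least [c ^+ 2 * lo%:R] times the squared norm. *)
Lemma dirac_lower c D lo x : elliptic P Q c -> elliptic Pa Qa c -> (D.+1 < M)%N ->
    x \in coordv (low S d M D) -> (forall q, x q != 0 -> (lo <= deg q.2)%N) ->
  (c ^+ 2 * lo%:R - garding_cst) * rip x x <= rip (dirac x) (dirac x).
Proof.
move=> e1 e2 DM xD xlo.
have prD b : pr b x \in coordv (low S d M D) by apply: coordv_dgr.
have -> : rip (dirac x) (dirac x) = rip (Dop P Q (pr false x)) (Dop P Q (pr false x)) +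
   rip (Dop Pa Qa (pr true x)) (Dop Pa Qa (pr true x)).
  apply: rip_orthD.
  by rewrite -(pr_Dop P Q false) -(pr_Dop Pa Qa true) rip_pr_pr.
have hx : rip x x = rip (pr false x) (pr false x) + rip (pr true x) (pr true x).
  by rewrite -{1 2}(pr_sum x) rip_orthD // rip_pr_pr.
have key P' Q' b G : elliptic P' Q' c -> \sum_j mxbound (Q' j) ^+ 2 <= G ->
    (c ^+ 2 * lo%:R - G) * rip (pr b x) (pr b x) <=
    rip (Dop P' Q' (pr b x)) (Dop P' Q' (pr b x)).
  move=> e hG; have := garding e DM (prD b); rewrite (sum_rip_cre (ltnW DM) (prD b)) => h.
  have h1 : lo%:R * rip (pr b x) (pr b x) <=
      rip (dg (fun q : S * multi => ((deg q.2 + d)%:R)%:C) (pr b x)) (pr b x).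
    rewrite -rip_dg_cst; apply: rip_dg_le => q; rewrite prE.
    case: ifP => [_ /xlo h'|_]; last by rewrite eqxx.
    by rewrite ler_nat (leq_trans h') // leq_addr.
  have h2 : \sum_j rip (mulV (Q' j) (pr b x)) (mulV (Q' j) (pr b x)) <= G * rip (pr b x) (pr b x).
    apply: (@le_trans _ _ ((\sum_j mxbound (Q' j) ^+ 2) * rip (pr b x) (pr b x))).
      rewrite mulr_suml; apply: ler_sum => j _.
      by rewrite -!sqr_nm -exprMn ler_sqr ?nnegrE ?mulr_ge0 ?nm_ge0 ?mxbound_ge0 // nm_mulV.
    by rewrite ler_wpM2r ?rip_ge0.
  have := ler_wpM2l (sqr_ge0 c) h1; rewrite mulrA; lra.
rewrite hx mulrDr; apply: lerD; apply: key => //; rewrite /garding_cst.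
  by rewrite lerDl sumr_ge0 // => j _; rewrite sqr_ge0.
by rewrite lerDr sumr_ge0 // => j _; rewrite sqr_ge0.
Qed.

End CutoffOperator.

(** * The cut-off Hamiltonian *)

Section Cutoff.
Variables (R : realType) (B : R).
Hypothesis B0 : 0 < B.

(** A trapezoid: 1 on [-B, B], 0 outside (-2B, 2B), with slopes 1/B. *)
Definition cutoff (t : R) : R := Num.max 0 (Num.min 1 (2 - `|t| / B)).

Lemma cutoff_ge0 t : 0 <= cutoff t.
Proof. by rewrite /cutoff le_max lexx. Qed.

Lemma cutoff_le1 t : cutoff t <= 1.
Proof. by rewrite /cutoff ge_max ler01 ge_min lexx. Qed.

Lemma cutoff1 t : `|t| <= B -> cutoff t = 1.
Proof.
move=> tB; have h : `|t| / B <= 1 by rewrite ler_pdivrMr // mul1r.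
by rewrite /cutoff min_l ?max_r ?ler01 //; lra.
Qed.

Lemma cutoff0 t : 2 * B <= `|t| -> cutoff t = 0.
Proof.
move=> tB; have h : 2 <= `|t| / B by rewrite ler_pdivlMr.
rewrite /cutoff max_l //; apply: le_trans (_ : 2 - `|t| / B <= 0); last by lra.
by rewrite ge_min lexx orbT.
Qed.

Lemma cutoff_lipschitz t t' : `|cutoff t - cutoff t'| <= `|t - t'| / B.
Proof.
have h : `| `|t| / B - `|t'| / B| <= `|t - t'| / B.
  rewrite -mulrBl normrM [`|B^-1|]gtr0_norm ?invr_gt0 //.
  by rewrite ler_wpM2r ?invr_ge0 ?(ltW B0) // ler_dist_dist.
have hmax (a b : R) : `|Num.max 0 a - Num.max 0 b| <= `|a - b|.
  have h1 := ler_norm (a - b); have h2 : - (a - b) <= `|a - b| by rewrite -normrN ler_norm.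
  by rewrite ler_norml; case: (leP 0 a) => ?; case: (leP 0 b) => ?; apply/andP; split; lra.
have hmin (a b : R) : `|Num.min 1 a - Num.min 1 b| <= `|a - b|.
  have h1 := ler_norm (a - b); have h2 : - (a - b) <= `|a - b| by rewrite -normrN ler_norm.
  by rewrite ler_norml; case: (leP 1 a) => ?; case: (leP 1 b) => ?; apply/andP; split; lra.
apply: le_trans (hmax _ _) (le_trans (hmin _ _) _).
apply: le_trans h; rewrite (_ : 2 - _ - _ = `|t'| / B - `|t| / B); last by ring.
by rewrite distrC.
Qed.

End Cutoff.

Section CutoffHamiltonian.
Variables (R : realType) (d N : nat) (S : finType) (M : nat).
Local Notation C := R[i].
Local Notation multi := {ffun 'I_d -> 'I_M.+1}.
Local Notation V := {ffun S * multi -> 'cV[C]_N}.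
Implicit Types (x y : V) (sh : S -> nat).
Variables (P Q : 'I_d -> 'M[C]_N) (k B : R).
Hypotheses (B0 : 0 < B) (k0 : 0 <= k).
Local Notation DD := (dirac P Q).
Local Notation L D := (opbound P Q * rt R D.+1).

Definition excess sh (q : S * multi) : R := (deg q.2)%:R - (sh q.1)%:R.
Definition window sh (q : S * multi) : R := cutoff B (excess sh q).
(** The sign anticommutes with the Dirac operator, so that the two summands of the Hamiltonian
    almost anticommute; the linear growth in [excess] supplies the gap away from the window. *)
Definition mass sh (q : S * multi) : R := (-1) ^+ par sh q * (k * excess sh q).

(** The window stands on both sides of the Dirac operator to keep the sum symmetric. *)
Definition hamiltonian sh x : V := dgr (mass sh) x + dgr (window sh) (DD sh (dgr (window sh) x)).

Local Notation HH := hamiltonian.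

Lemma hamiltonian_linear sh : linear (HH sh).
Proof.
move=> c x y; rewrite /HH !dgr_linear (dirac_linear P Q sh) dgr_linear.
by rewrite scalerDr addrACA.
Qed.
HB.instance Definition _ sh := GRing.isLinear.Build C V V _ (HH sh) (hamiltonian_linear sh).

Lemma rip_hamiltonian sh x y : rip (HH sh x) y = rip x (HH sh y).
Proof.
by rewrite /HH ripDl ripDr !rip_dgr_sym rip_dirac rip_dgr_sym.
Qed.

Lemma hamiltonian_off sh (A : {set S * multi}) x :
  (forall q, q \in A -> window sh q = 0) -> x \in coordv A -> HH sh x = dgr (mass sh) x.
Proof.
move=> hA xA; rewrite /HH [dgr (window sh) x](_ : _ = 0) ?raddf0 ?addr0 //.
apply/ffunP => q; rewrite dgrE ffunE; have [/hA ->|qA] := boolP (q \in A).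
  by rewrite scale0r.
by rewrite (coordvE xA qA) scaler0.
Qed.

Lemma window_step sh (s : S) t :
  `|cutoff B (t%:R - (sh s)%:R) - cutoff B (t.+1%:R - (sh s)%:R)| <= B^-1.
Proof.
apply: le_trans (cutoff_lipschitz B0 _ _) _.
rewrite (_ : _ - _ = -1); first by rewrite normrN1 mul1r.
by rewrite -natr1; ring.
Qed.

Lemma window_norm sh q : `|window sh q| <= 1.
Proof. by rewrite ger0_norm ?cutoff_ge0 ?cutoff_le1. Qed.

Lemma nm_window sh x : nm (dgr (window sh) x) <= nm x.
Proof. by rewrite -[leRHS]mul1r; apply: nm_dgr => // q _; apply: window_norm. Qed.

Lemma rip_sqD x y : rip (x + y) (x + y) = rip x x + 2 * rip x y + rip y y.
Proof. by rewrite !ripDl !ripDr (ripC y x) mulr2n mulrDl mul1r !addrA. Qed.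

Lemma rip_sqD_le x y : rip (x + y) (x + y) <= 2 * rip x x + 2 * rip y y.
Proof.
by have := rip_ge0 (x - y); rewrite !ripBl !ripBr !ripDl !ripDr (ripC y x); lra.
Qed.

Lemma mass_anti sh x : DD sh (dgr (fun q => (-1) ^+ par sh q) x) =
  - dgr (fun q => (-1) ^+ par sh q) (DD sh x).
Proof.
have hpr b y : dgr (fun q => (-1) ^+ par sh q) (pr sh b y) = (-1) ^+ b *: pr sh b y.
  apply/ffunP => q; rewrite dgrE [RHS]ffunE !prE; case: eqP => [->|_]; last by rewrite !scaler0.
  by case: b; rewrite ?expr0 ?expr1 ?rmorphN ?rmorph1.
have hE b : pr sh b (dgr (fun q => (-1) ^+ par sh q) x) = (-1) ^+ b *: pr sh b x.
  by rewrite -hpr; apply: dgr_comm.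
have h0 P' Q' : Dop P' Q' (pr sh false (dgr (fun q => (-1) ^+ par sh q) x)) =
    - dgr (fun q => (-1) ^+ par sh q) (Dop P' Q' (pr sh false x)).
  by rewrite hE expr0 scale1r -(pr_Dop sh P' Q' false) hpr expr1 scaleN1r opprK.
have h1 P' Q' : Dop P' Q' (pr sh true (dgr (fun q => (-1) ^+ par sh q) x)) =
    - dgr (fun q => (-1) ^+ par sh q) (Dop P' Q' (pr sh true x)).
  rewrite hE expr1 scaleN1r (raddfN (Dop P' Q')) -(pr_Dop sh P' Q' true) hpr.
  by rewrite (pr_Dop sh P' Q' true) /= expr0 scale1r.
by rewrite /dirac h0 h1 -opprD -(raddfD (dgr _)).
Qed.

(** The square |Hx|^2 splits into a mass part, a Dirac part and a cross term. Up to commutators of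
    size [L D / B] and [k * L D], the cross term vanishes and the Dirac part obeys [dirac_lower]; a
    pointwise inequality shows that mass and Dirac part together are at least G. The factor 2 in
    [2 * G] pays for the factor 2 in [hM]. *)
Lemma hamiltonian_gap sh (c : R) D lo (G : R) x :
    elliptic P Q c -> elliptic (fun j => adj (Q j)) (fun j => adj (P j)) c ->
    (D.+1 < M)%N -> x \in coordv (low S d M D) ->
    (forall q, window sh q != 0 -> (lo <= deg q.2)%N) ->
    2 * G <= c ^+ 2 * lo%:R - garding_cst P Q -> 0 <= G -> G <= (k * B) ^+ 2 ->
  (G - (L D / B) ^+ 2 - k * L D) * rip x x <= rip (HH sh x) (HH sh x).
Proof.
move=> e1 e2 DM xD hlo hG G0 hk; have DM' := ltnW DM.
have L0 : 0 <= L D by rewrite mulr_ge0 ?opbound_ge0 ?sqrtr_ge0.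
pose W : V -> V := dgr (window sh); pose Mx := W (DD sh (W x)).
pose ph : V -> V := dgr (fun q => k * excess sh q).
pose ep : V -> V := dgr (fun q => (-1) ^+ par sh q).
have lowW y : y \in coordv (low S d M D) -> W y \in coordv (low S d M D).
  exact: coordv_dgr.
have massE y : dgr (mass sh) y = ep (ph y) by rewrite /ep /ph dgrM.
have epep y z : rip (ep y) (ep z) = rip y z.
  rewrite rip_dgr_sym /ep dgrM; congr (rip _ _); apply/ffunP => q.
  by rewrite dgrE -expr2 sqrr_sign scale1r.
have WS y z : rip (W y) z = rip y (W z) by apply: rip_dgr_sym.
have phS y z : rip (ph y) z = rip y (ph z) by apply: rip_dgr_sym.
have epS y z : rip (ep y) z = rip y (ep z) by apply: rip_dgr_sym.
(* Anticommutation with the sign [ep] reduces the cross term to the commutator of the Dirac operator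
   with [ph], whose values change by [k] per degree. *)
have hcross : - (k * L D * rip x x) <= 2 * rip (ep (ph x)) Mx.
  pose com := DD sh (ph (W x)) - ph (DD sh (W x)).
  have -> : 2 * rip (ep (ph x)) Mx = - rip (ep x) (W com).
    have h1 : rip (ep (ph x)) Mx = rip (ep x) (ph Mx).
      by rewrite [ep (ph x)]dgr_comm -[dgr _ (dgr _ x)]/(ph (ep x)) phS.
    have h2 : rip (ep (ph x)) Mx = - rip (ep x) (W (DD sh (ph (W x)))).
      rewrite /Mx -WS -rip_dirac.
      have -> : W (ep (ph x)) = ep (ph (W x)).
        by rewrite /W dgr_comm -[dgr _ (dgr _ (ph x))]/(ep (W (ph x))) /W [dgr _ (ph x)]dgr_comm.
      rewrite mass_anti ripNl; congr (- _).
      rewrite [LHS]epS; have -> : ep (W x) = W (ep x) by apply: dgr_comm.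
      by rewrite ripC WS.
    rewrite /com (raddfB (dgr _) : forall y z, W (y - z) = W y - W z) ripBr.
    have -> : W (ph (DD sh (W x))) = ph Mx by apply: dgr_comm.
    move: h1 h2; move: (rip _ Mx) (rip _ (ph Mx)) (rip _ (W _)) => a b e; lra.
  rewrite lerN2; apply: le_trans (rip_CS _ _) _.
  have hep : nm (ep x) = nm x by rewrite /nm epep.
  rewrite hep (_ : k * L D * rip x x = nm x * (L D * (k * nm x))); last first.
    by rewrite -sqr_nm; ring.
  rewrite ler_wpM2l ?nm_ge0 //.
  apply: le_trans (nm_window _ _) _.
  have := @nm_dirac_comm R d N S M P Q sh (fun s t => k * (t%:R - (sh s)%:R)) D k (W x) k0 _ DM' (lowW _ xD).
  rewrite -/ph => h; apply: le_trans (h _) _.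
    move=> s t _; rewrite -mulrBr (_ : _ - _ = -1) ?mulrN1 ?normrN ?ger0_norm //.
    by rewrite -natr1; ring.
  by rewrite ler_wpM2l // ler_wpM2l // nm_window.
(* Moving one window past the Dirac operator costs [L D / B]. *)
have hM : rip (DD sh (W (W x))) (DD sh (W (W x))) <=
    2 * rip Mx Mx + 2 * (L D / B) ^+ 2 * rip x x.
  pose com := DD sh (W (W x)) - W (DD sh (W x)).
  have hcom : nm com <= L D / B * nm x.
    have := @nm_dirac_comm R d N S M P Q sh (fun s t => cutoff B (t%:R - (sh s)%:R)) D B^-1 (W x) _ _ DM' (lowW _ xD).
    move=> h; apply: le_trans (h _ _) _.
    - by rewrite invr_ge0 ltW.
    - by move=> s t _; apply: window_step.
    - by rewrite mulrA ler_wpM2l ?divr_ge0 ?(ltW B0) // nm_window.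
  have -> : DD sh (W (W x)) = Mx + com by rewrite /com addrC subrK.
  have h2 : rip com com <= (L D / B) ^+ 2 * rip x x.
    have h0 : 0 <= L D / B * nm x := mulr_ge0 (divr_ge0 L0 (ltW B0)) (nm_ge0 _).
    by rewrite -!sqr_nm -exprMn ler_sqr ?nnegrE ?nm_ge0.
  apply: le_trans (rip_sqD_le _ _) _; rewrite lerD2l -mulrA.
  by rewrite ler_wpM2l.
have hlow : 2 * G * rip (W (W x)) (W (W x)) <= rip (DD sh (W (W x))) (DD sh (W (W x))).
  apply: le_trans (dirac_lower sh e1 e2 DM (lowW _ (lowW _ xD)) (lo := lo) _).
    by rewrite ler_wpM2r ?rip_ge0.
  move=> q; rewrite dgrE => h; apply: hlo; apply: contraNneq h => ->.
  by rewrite scale0r.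
(* Where |excess| is at most B the window is 1; elsewhere the mass term alone is at least
   [(k * B) ^+ 2], hence at least G. *)
have hpt : G * rip x x <= rip (ph x) (ph x) + G * rip (W (W x)) (W (W x)).
  have -> : rip (ph x) (ph x) = rip (dgr (fun q => (k * excess sh q) ^+ 2) x) x.
    by rewrite phS ripC [ph (ph x)]dgrM.
  have -> : G * rip (W (W x)) (W (W x)) = rip (dgr (fun q => G * window sh q ^+ 4) x) x.
    rewrite !WS ripC /W !dgrM -ripZl; congr (rip _ _); apply/ffunP => q.
    by rewrite ffunE !dgrE scalerA -rmorphM; congr (_%:C *: _); ring.
  have -> : rip (dgr (fun q => (k * excess sh q) ^+ 2) x) x +
      rip (dgr (fun q => G * window sh q ^+ 4) x) x =
      rip (dgr (fun q => (k * excess sh q) ^+ 2 + G * window sh q ^+ 4) x) x.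
    rewrite -ripDl; congr (rip _ _); apply/ffunP => q.
    by rewrite ffunE !dgrE -scalerDl -rmorphD.
  rewrite -rip_dg_cst.
  apply: rip_dg_le => q _; have [uB|uB] := leP `|excess sh q| B.
    by rewrite /window cutoff1 // expr1n mulr1 lerDr sqr_ge0.
  rewrite exprMn -[excess sh q ^+ 2]ger0_norm ?sqr_ge0 // normrX; apply: ler_wpDr.
    by rewrite mulr_ge0 // exprn_ge0 // cutoff_ge0.
  apply: le_trans hk _; rewrite exprMn ler_wpM2l ?sqr_ge0 //.
  by rewrite ler_sqr ?nnegrE ?normr_ge0 ?ltW.
have -> : rip (HH sh x) (HH sh x) = rip (ph x) (ph x) + 2 * rip (ep (ph x)) Mx + rip Mx Mx.
  by rewrite -(epep (ph x) (ph x)) -rip_sqD -massE.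
have aux (b1 b2 r a1 a2 a3 a4 a5 : R) : - (b1 * r) <= a2 -> a4 <= 2 * a3 + 2 * b2 * r ->
    2 * G * a5 <= a4 -> G * r <= a1 + G * a5 -> (G - b2 - b1) * r <= a1 + a2 + a3.
  by rewrite -!mulrA !mulrBl; lra.
exact: aux hcross hM hlow hpt.
Qed.

Lemma dirac_shift sh x : DD (fun s => (sh s).+2) x = DD sh x.
Proof.
have h b : pr (fun s => (sh s).+2) b x = pr sh b x.
  by apply/ffunP => q; rewrite !prE /par !addnS /= negbK.
by rewrite /dirac !h.
Qed.

(** A shift by 2 preserves parities, hence the Dirac operator and the signs. The mass changes by
    [2 * k], and each of the two windows by at most 2/B. *)
Lemma hamiltonian_shift sh D x : (D < M)%N -> x \in coordv (low S d M D) ->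
  nm (HH (fun s => (sh s).+2) x - HH sh x) <= (2 * k + 4 * (L D / B)) * nm x.
Proof.
move=> DM xD; pose sh' s := (sh s).+2; rewrite -/sh'.
have exE q : excess sh' q = excess sh q - 2.
  by rewrite /excess /sh' -addn2 natrD; ring.
have L0 : 0 <= L D by rewrite mulr_ge0 ?opbound_ge0 ?sqrtr_ge0.
have -> : HH sh' x - HH sh x = dgr (fun q => mass sh' q - mass sh q) x +
    (dgr (fun q => window sh' q - window sh q) (DD sh (dgr (window sh') x)) +
     dgr (window sh) (DD sh (dgr (fun q => window sh' q - window sh q) x))).
  have dB f g y : dgr (fun q => f q - g q) y = dgr f y - dgr g y :> V.
    by apply/ffunP => q; rewrite subVE !dgrE rmorphB scalerBl.
  rewrite /HH dirac_shift !dB (raddfB (DD sh)) /= (raddfB (dgr (window sh))) /=.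
  by rewrite opprD addrACA; congr (_ + _); rewrite addrA subrK.
have hw q : `|window sh' q - window sh q| <= 2 / B.
  apply: le_trans (cutoff_lipschitz B0 _ _) _; rewrite exE.
  by rewrite (_ : _ - _ = - 2%:R) ?normrN ?normr_nat //; ring.
have B2 : 0 <= 2 / B by rewrite divr_ge0 ?(ltW B0).
apply: le_trans (nmD _ _) _; rewrite mulrDl; apply: lerD.
  apply: nm_dgr => [|q _]; first by rewrite mulr_ge0.
  rewrite /mass (_ : par sh' q = par sh q); last by rewrite /par /sh' !addnS /= negbK.
  rewrite -mulrBr normrM normrX normrN1 expr1n mul1r exE.
  by rewrite (_ : _ - _ = - (2 * k)) ?normrN ?ger0_norm ?mulr_ge0 //; ring.
apply: le_trans (nmD _ _) _.
have -> : 4 * (L D / B) * nm x = 2 / B * (L D * nm x) + L D * (2 / B * nm x) by ring.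
apply: lerD.
  apply: le_trans (nm_dgr B2 (fun q _ => hw q)) _; rewrite ler_wpM2l //.
  apply: le_trans (nm_dirac P Q sh DM (coordv_dgr _ xD)) _.
  by rewrite ler_wpM2l // nm_window.
apply: le_trans (nm_window _ _) _.
apply: le_trans (nm_dirac P Q sh DM (coordv_dgr _ xD)) _; rewrite ler_wpM2l //.
exact: nm_dgr B2 (fun q _ => hw q).
Qed.

End CutoffHamiltonian.

(** * The Koszul operator *)

Section Koszul.
Variables (R : realType) (d N M : nat).
Local Notation C := R[i].
Local Notation S := {set 'I_d}.
Local Notation multi := {ffun 'I_d -> 'I_M.+1}.
Local Notation V := {ffun S * multi -> 'cV[C]_N}.
Implicit Types (x y : V) (X : S) (i j : 'I_d).

(* Jordan-Wigner sign of the fermionic operators [cdn] and [cup]. *)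
Definition fsign j X : C := \prod_(i in X) (-1) ^+ (i < j)%N.

Lemma fsignU i j X : i \notin X -> fsign j (i |: X) = (-1) ^+ (i < j)%N * fsign j X.
Proof. by move=> iX; rewrite /fsign big_setU1. Qed.

Lemma fsignD i j X : i \in X -> fsign j X = (-1) ^+ (i < j)%N * fsign j (X :\ i).
Proof. by move=> iX; rewrite /fsign (big_setD1 i). Qed.

Lemma fsignUj j X : fsign j (j |: X) = fsign j X.
Proof.
have [jX|jX] := boolP (j \in X); first by rewrite (setUidPr _) // sub1set.
by rewrite fsignU // ltnn mul1r.
Qed.

Lemma fsign_sqr j X : fsign j X * fsign j X = 1.
Proof. by rewrite /fsign -big_split big1 //= => i _; rewrite -expr2 sqrr_sign. Qed.

Lemma fsignJ j X : (fsign j X)^* = fsign j X.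
Proof. by rewrite /fsign rmorph_prod; apply: eq_bigr => i _; rewrite rmorph_sign. Qed.

Definition cdn j x : V :=
  [ffun q : S * multi => if j \in q.1 then 0 else fsign j q.1 *: x (j |: q.1, q.2)].
Definition cup j x : V :=
  [ffun q : S * multi => if j \in q.1 then fsign j q.1 *: x (q.1 :\ j, q.2) else 0].

Lemma cdnE j x X a : cdn j x (X, a) = if j \in X then 0 else fsign j X *: x (j |: X, a).
Proof. by rewrite [LHS]ffunE. Qed.

Lemma cupE j x X a : cup j x (X, a) = if j \in X then fsign j X *: x (X :\ j, a) else 0.
Proof. by rewrite [LHS]ffunE. Qed.

Lemma cdn_linear j : linear (cdn j).
Proof.
move=> c x y; apply/ffunP => -[X a]; rewrite [RHS]ffunE [X in _ = X + _]ffunE !cdnE !ffunE.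
by case: ifP => _; rewrite ?scalerDr ?scalerA ?(mulrC c) // scaler0 addr0.
Qed.
HB.instance Definition _ j := GRing.isLinear.Build C V V _ (cdn j) (cdn_linear j).

Lemma cup_linear j : linear (cup j).
Proof.
move=> c x y; apply/ffunP => -[X a]; rewrite [RHS]ffunE [X in _ = X + _]ffunE !cupE !ffunE.
by case: ifP => _; rewrite ?scalerDr ?scalerA ?(mulrC c) // scaler0 addr0.
Qed.
HB.instance Definition _ j := GRing.isLinear.Build C V V _ (cup j) (cup_linear j).

Lemma rip_sets (x y : V) :
  rip x y = \sum_(X : S) \sum_(a : multi) \sum_k rd (x (X, a) k 0) (y (X, a) k 0).
Proof.
rewrite (pair_bigA _ (fun X a => \sum_k rd (x (X, a) k 0) (y (X, a) k 0))).
by apply: eq_bigr => -[].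
Qed.

Lemma rip_cdn j x y : rip (cdn j x) y = rip x (cup j y).
Proof.
rewrite !rip_sets [LHS](bigID (fun X : S => j \in X)) /= big1 ?add0r; last first.
  by move=> X jX; rewrite big1 // => a _; rewrite big1 // => k _; rewrite cdnE jX mxE rd0l.
rewrite [RHS](bigID (fun X : S => j \in X)) /= [X in _ = _ + X]big1 ?addr0; last first.
  move=> X /negPf jX; rewrite big1 // => a _; rewrite big1 // => k _.
  by rewrite cupE jX rdC mxE rd0l.
rewrite [RHS](reindex_onto (fun X => j |: X) (fun X => X :\ j)) /=; last first.
  by move=> X jX; rewrite setD1K.
apply: eq_big => [X|X jX].
  rewrite setU11 /=; have [jX|jX] := boolP (j \in X); last by rewrite setU1K // eqxx.
  by apply/esym/negbTE; apply: contraTneq jX => <-; rewrite setD11.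
apply: eq_bigr => a _; apply: eq_bigr => k _.
rewrite cdnE (negPf jX) cupE setU11 setU1K // fsignUj !mxE.
by rewrite rdJ fsignJ.
Qed.

Lemma rip_cup j x y : rip (cup j x) y = rip x (cdn j y).
Proof. by rewrite ripC -rip_cdn ripC. Qed.

Lemma car i j x : cdn i (cup j x) = (i == j)%:R *: x - cup j (cdn i x).
Proof.
apply/ffunP => -[X a]; rewrite subVE [X in _ = X - _]ffunE !cdnE !cupE !cdnE.
have [<-|ij] := eqVneq i j.
  rewrite scale1r; case: ifPn => iX.
    by rewrite setD11 setD1K // scalerA [X in fsign i X * _](esym (setD1K iX)) fsignUj fsign_sqr scale1r subrr.
  by rewrite setU11 setU1K // scalerA fsignUj fsign_sqr scale1r subr0.
rewrite scale0r sub0r !in_setU1 !in_setD1 (negPf ij) eq_sym (negPf ij) /=.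
have [iX|iX] := boolP (i \in X); first by rewrite scaler0 if_same oppr0.
have [jX|jX] := boolP (j \in X); last by rewrite scaler0 oppr0.
have -> : (i |: X) :\ j = i |: (X :\ j).
  by apply/setP => l; rewrite !inE; case: (eqVneq l j) => // ->; rewrite eq_sym (negPf ij).
rewrite !scalerA -scaleNr (fsignU _ iX) (fsignD i jX); congr (_ *: _).
have -> : (i < j)%N = ~~ (j < i)%N by rewrite -leqNgt ltn_neqAle (inj_eq val_inj) ij.
by case: (j < i)%N => /=; rewrite ?expr0 ?expr1; ring.
Qed.

Lemma cdn_cdn i j x : cdn i (cdn j x) = - cdn j (cdn i x).
Proof.
apply/ffunP => -[X a]; rewrite [RHS]ffunE !cdnE.
have [<-|ij] := eqVneq i j; first by rewrite setU11 scaler0 if_same oppr0.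
rewrite !in_setU1 (negPf ij) eq_sym (negPf ij) /=.
have [iX|iX] := boolP (i \in X); first by rewrite scaler0 if_same oppr0.
have [jX|jX] := boolP (j \in X); first by rewrite scaler0 oppr0.
rewrite setUCA !scalerA -scaleNr (fsignU _ iX) (fsignU _ jX); congr (_ *: _).
have -> : (i < j)%N = ~~ (j < i)%N by rewrite -leqNgt ltn_neqAle (inj_eq val_inj) ij.
by case: (j < i)%N => /=; rewrite ?expr0 ?expr1; ring.
Qed.

Lemma cup_cup i j x : cup i (cup j x) = - cup j (cup i x).
Proof.
(* The sum of both sides has norm zero, since its adjoint is the anticommutator of [cdn j] and
   [cdn i]. *)
apply/eqP; rewrite -subr_eq0 opprK -rip_eq0; apply/eqP.
set y := _ + _; rewrite {1}/y ripDl !rip_cup (cdn_cdn j i) ripNr addrC subrr //.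
Qed.

Lemma cup_cdn i x X a : cup i (cdn i x) (X, a) = if i \in X then x (X, a) else 0.
Proof.
rewrite cupE cdnE setD11; case: ifP => // iX.
rewrite setD1K // scalerA (_ : fsign i (X :\ i) = fsign i X) ?fsign_sqr ?scale1r //.
by rewrite -[in RHS](setD1K iX) fsignUj.
Qed.

Lemma cdn_ann i j x : cdn i (ann j x) = ann j (cdn i x).
Proof.
apply/ffunP => -[X a]; rewrite cdnE !annE cdnE.
have [iX|iX] := boolP (i \in X); first by rewrite scaler0 if_same.
by have [aM|aM] := ltnP (a j) M; rewrite ?scaler0 // !scalerA; congr (_ *: _); apply: mulrC.
Qed.

Lemma cup_cre i j x : cup i (cre j x) = cre j (cup i x).
Proof.
apply/ffunP => -[X a]; rewrite cupE !creE cupE.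
have [iX|iX] := boolP (i \in X); last by rewrite scaler0.
by rewrite !scalerA; congr (_ *: _); apply: mulrC.
Qed.

Lemma cup_ann i j x : cup i (ann j x) = ann j (cup i x).
Proof.
apply/ffunP => -[X a]; rewrite cupE !annE cupE.
have [iX|iX] := boolP (i \in X); last by rewrite scaler0 if_same.
by have [aM|aM] := ltnP (a j) M; rewrite ?scaler0 // !scalerA; congr (_ *: _); apply: mulrC.
Qed.

Lemma cdn_cre i j x : cdn i (cre j x) = cre j (cdn i x).
Proof.
apply/ffunP => -[X a]; rewrite cdnE !creE cdnE.
have [iX|iX] := boolP (i \in X); first by rewrite scaler0.
by rewrite !scalerA; congr (_ *: _); apply: mulrC.
Qed.

Lemma cup_mulV j (T : 'M[C]_N) x : cup j (mulV T x) = mulV T (cup j x).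
Proof.
apply/ffunP => -[X a]; rewrite mulVE !cupE mulVE.
by case: ifP => _; rewrite ?mulmx0 // scalemxAr.
Qed.

Lemma cdn_mulV j (T : 'M[C]_N) x : cdn j (mulV T x) = mulV T (cdn j x).
Proof.
apply/ffunP => -[X a]; rewrite mulVE !cdnE mulVE.
by case: ifP => _; rewrite ?mulmx0 // scalemxAr.
Qed.

Lemma nm_cdn j x : nm (cdn j x) <= nm x.
Proof.
rewrite nm_le_sqr ?nm_ge0 // sqr_nm rip_cdn ripC -[leRHS]mul1r -rip_dg_cst.
have -> : cup j (cdn j x) = dg (fun q : S * multi => ((j \in q.1)%:R : R)%:C) x.
  apply/ffunP => -[X a]; rewrite cup_cdn dgE /=.
  by case: ifP => _; rewrite ?scale1r ?scale0r.
by apply: rip_dg_le => q _; case: (_ \in _); rewrite ?ler01.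
Qed.

Lemma nm_cup j x : nm (cup j x) <= nm x.
Proof.
rewrite nm_le_sqr ?nm_ge0 // rip_cup car eqxx scale1r ripBr -rip_cdn sqr_nm.
by rewrite lerBlDr lerDl rip_ge0.
Qed.

(** The Koszul differential plus its adjoint. Both preserve |a| - |X|, hence the excess and the
    parity for the shifts s + |X|. *)
Definition koszul x : V := \sum_j (cup j (cre j x) + cdn j (ann j x)).

Lemma koszul_linear : linear koszul.
Proof.
move=> c x y; rewrite /koszul scaler_sumr -big_split; apply: eq_bigr => j _.
by rewrite cre_linear ann_linear cup_linear cdn_linear scalerDr addrACA.
Qed.
HB.instance Definition _ := GRing.isLinear.Build C V V _ koszul koszul_linear.

Lemma rip_koszul x y : rip (koszul x) y = rip x (koszul y).
Proof.
rewrite rip_suml rip_sumr; apply: eq_bigr => j _.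
rewrite ripDl ripDr addrC rip_cdn rip_ann -cup_cre; congr (_ + _).
by rewrite rip_cup rip_cre -cdn_ann.
Qed.

(** The eigenvalue of the square of [koszul]. The subtraction is exact because |X| is at most d, and
    the value is 0 only for a = 0 and X the full set. *)
Definition tq (q : S * multi) : nat := (deg q.2 + d - #|q.1|)%N.

(** The terms with two [cup] or two [cdn] are antisymmetric in the fermionic and symmetric in the
    bosonic indices, and cancel. The mixed terms cancel off the diagonal and leave the boson number
    plus 1 minus the fermion number for each index. *)
Lemma koszulK D x : (D < M)%N -> x \in coordv (low S d M D) ->
  koszul (koszul x) = dgr (fun q => (tq q)%:R) x.
Proof.
move=> DM xD.
have anti (T : 'I_d -> 'I_d -> V) : (forall i j, T i j = - T j i) -> \sum_i \sum_j T i j = 0.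
  move=> hT; have h : \sum_i \sum_j T i j = - \sum_i \sum_j T i j.
    rewrite {1}exchange_big /= -sumrN; apply: eq_bigr => i _.
    by rewrite -sumrN; apply: eq_bigr => j _; rewrite hT.
  have : (2%:R : C) *: (\sum_i \sum_j T i j) = 0.
    by rewrite scaler_nat mulr2n {1}h addNr.
  by move/eqP; rewrite scaler_eq0 pnatr_eq0 /= => /eqP.
transitivity (\sum_i \sum_j (cup i (cup j (cre i (cre j x))) + cup i (cdn j (cre i (ann j x))) +
    (cdn i (cup j (ann i (cre j x))) + cdn i (cdn j (ann i (ann j x)))))).
  rewrite /koszul; apply: eq_bigr => i _.
  rewrite (raddf_sum (cre i)) (raddf_sum (ann i)) (raddf_sum (cup i)) (raddf_sum (cdn i)) /=.
  rewrite -big_split; apply: eq_bigr => j _ /=.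
  rewrite (raddfD (cre i)) (raddfD (ann i)) (raddfD (cup i)) (raddfD (cdn i)) /=.
  by rewrite -cup_cre -cdn_cre -cup_ann -cdn_ann.
rewrite (eq_bigr (fun i => \sum_j cup i (cup j (cre i (cre j x))) +
   \sum_j cdn i (cdn j (ann i (ann j x))) +
   (\sum_j cup i (cdn j (cre i (ann j x))) + \sum_j cdn i (cup j (ann i (cre j x)))))); last first.
  move=> i _; rewrite -!big_split; apply: eq_bigr => j _ /=.
  by rewrite [X in _ + X = _]addrC addrACA.
rewrite big_split /= big_split /= anti; last by move=> i j; rewrite cup_cup cre_cre.
rewrite anti ?addr0 ?add0r; last by move=> i j; rewrite cdn_cdn ann_ann.
rewrite big_split /= [X in X + _]exchange_big /= -big_split /=.
transitivity (\sum_i (cre i (ann i x) + (x - cup i (cdn i x)))).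
  apply: eq_bigr => i _; rewrite -big_split /= (bigD1 i) //= big1 ?addr0.
    rewrite (ccr i i DM xD) eqxx scale1r (raddfD (cup i)) (raddfD (cdn i)) /=.
    by rewrite !car eqxx !scale1r addrA [X in X + _ = _]addrC subrK.
  move=> j ji; rewrite (ccr i j DM xD) eq_sym (negPf ji) scale0r addr0.
  by rewrite car eq_sym (negPf ji) scale0r sub0r subrr.
apply/ffunP => -[X a]; rewrite sum_ffunE dgrE /tq /=.
under eq_bigr => i _ do rewrite ffunE cre_ann dgE subVE cup_cdn /=.
rewrite big_split sumrB /= -scaler_suml sumr_const card_ord -big_mkcond /= sumr_const.
rewrite -[_ *+ d]scaler_nat -[_ *+ #|X|]scaler_nat -scalerBl -scalerDl.
congr (_ *: _); rewrite natrB; last first.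
  by rewrite (leq_trans (max_card _)) // card_ord leq_addl.
rewrite rmorphB natrD rmorphD /= !rmorph_nat addrA; congr (_ + _ - _).
by rewrite -[in RHS](rmorph_nat (real_complex R)) /deg natr_sum rmorph_sum.
Qed.

(** The only transitions made by [koszul] are the moves in the hypothesis and their inverses. *)
Lemma koszul_dgr (f : S * multi -> R) x :
    (forall X (a : multi) j, (a j < M)%N -> j \notin X -> f (j |: X, inc j a) = f (X, a)) ->
  koszul (dgr f x) = dgr f (koszul x).
Proof.
move=> hf.
have sC (c1 c2 : C) (v : 'cV[C]_N) : c1 *: (c2 *: v) = c2 *: (c1 *: v).
  by rewrite !scalerA mulrC.
rewrite /koszul (raddf_sum (dgr f)); apply: eq_bigr => j _ /=.
rewrite (raddfD (dgr f)) /=; congr (_ + _); apply/ffunP => -[X a].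
  rewrite dgrE !cupE; case: ifP => jX; last by rewrite scaler0.
  rewrite !creE dgrE; have [a0|a0] := posnP (a j).
    by rewrite a0 /rt sqrtr0 scale0r !scaler0 scale0r !scaler0.
  have aM : (dec j a j < M)%N by rewrite decE eqxx subn1 prednK // -ltnS.
  have e := hf (X :\ j) (dec j a) j aM (negbT (setD11 j X)).
  rewrite (setD1K jX) (decK a0) in e; rewrite e.
  by rewrite (sC (rt _ _)%:C) (sC (fsign _ _)).
rewrite dgrE !cdnE; case: ifPn => jX; first by rewrite scaler0.
rewrite !annE; have [aM|aM] := ltnP (a j) M; last by rewrite !scaler0.
by rewrite dgrE (hf _ _ _ aM jX) (sC (rt _ _)%:C) (sC (fsign _ _)).
Qed.

Lemma tq_move X (a : multi) j : (a j < M)%N -> j \notin X -> tq (j |: X, inc j a) = tq (X, a).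
Proof. by move=> aM jX; rewrite /tq /= deg_inc // cardsU1 jX add1n addSn subSS. Qed.

(** The quadratic terms commute; what [ccr] leaves contains no creation or annihilation operator, so
    the commutator has a bound independent of the degree. *)
Lemma Dop_koszul (P Q : 'I_d -> 'M[C]_N) D x : (D < M)%N -> x \in coordv (low S d M D) ->
  Dop P Q (koszul x) - koszul (Dop P Q x) =
  \sum_j (cup j (mulV (Q j) x) - cdn j (mulV (P j) x)).
Proof.
move=> DM xD.
have low_mul (T : 'M[C]_N) : mulV T x \in coordv (low S d M D) by apply: coordv_mulV.
have -> : Dop P Q (koszul x) = \sum_i \sum_j
   (cup j (mulV (P i) (cre i (cre j x))) + cdn j (mulV (P i) (cre i (ann j x))) +
   (cup j (mulV (Q i) (ann i (cre j x))) + cdn j (mulV (Q i) (ann i (ann j x))))).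
  rewrite /Dop /koszul; apply: eq_bigr => i _.
  rewrite (raddf_sum (cre i)) (raddf_sum (ann i)) (raddf_sum (mulV (P i)))
    (raddf_sum (mulV (Q i))) /=.
  rewrite -big_split; apply: eq_bigr => j _ /=.
  rewrite (raddfD (cre i)) (raddfD (ann i)) (raddfD (mulV (P i))) (raddfD (mulV (Q i))) /=.
  by rewrite -cup_cre -cdn_cre -cup_ann -cdn_ann !cup_mulV !cdn_mulV.
have -> : koszul (Dop P Q x) = \sum_i \sum_j
   (cup j (mulV (P i) (cre i (cre j x))) + cdn j (mulV (P i) (ann j (cre i x))) +
   (cup j (mulV (Q i) (cre j (ann i x))) + cdn j (mulV (Q i) (ann i (ann j x))))).
  rewrite /Dop /koszul exchange_big /=; apply: eq_bigr => j _.
  rewrite (raddf_sum (cre j)) (raddf_sum (ann j)) (raddf_sum (cup j)) (raddf_sum (cdn j)) /=.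
  rewrite -big_split; apply: eq_bigr => i _ /=.
  rewrite (raddfD (cre j)) (raddfD (ann j)) (raddfD (cup j)) (raddfD (cdn j)) /=.
  by rewrite -!mulV_cre -!mulV_ann cre_cre (ann_ann j i) [RHS]addrACA.
rewrite -sumrB; apply: eq_bigr => i _; rewrite -sumrB (bigD1 i) //= big1 ?addr0.
  rewrite (ccr i i DM xD) eqxx scale1r (raddfD (mulV (P i))) (raddfD (mulV (Q i))) /=.
  rewrite (raddfD (cup i)) (raddfD (cdn i)) /=.
  move: (cup i _) (cdn i _) (cup i _) (cup i _) (cdn i _) (cdn i _) => u1 u2 u3 u4 u5 u6.
  (* The two surviving summands come first, then each other one beside its opposite. *)
  by rewrite !opprD !addrA (ACl (4*8*(1*6)*(2*7)*(3*9)*(5*10))%AC) /= !subrr !addr0.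
by move=> j ji; rewrite !(ccr _ _ DM xD) (negPf ji) eq_sym (negPf ji) !scale0r !addr0 subrr.
Qed.


Lemma coordv_koszul (A A' : {set S * multi}) x :
    (forall X (a : multi) j, (a j < M)%N -> j \notin X ->
       ((X, a) \in A -> (j |: X, inc j a) \in A') /\
       ((j |: X, inc j a) \in A -> (X, a) \in A')) ->
  x \in coordv A -> koszul x \in coordv A'.
Proof.
move=> hA xA; apply/coordvP => -[X a] XA'; rewrite /koszul sum_ffunE big1 // => j _.
rewrite ffunE cupE cdnE; have [jX|jX] := boolP (j \in X).
  rewrite addr0 creE; have [a0|a0] := posnP (a j).
    by rewrite a0 /rt sqrtr0 scale0r scaler0.
  have aM : (dec j a j < M)%N by rewrite decE eqxx subn1 prednK // -ltnS.
  have [h _] := hA (X :\ j) (dec j a) j aM (negbT (setD11 j X)).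
  rewrite (setD1K jX) (decK a0) in h.
  by rewrite (coordvE xA) ?scaler0 //; apply: contra XA'; apply: h.
rewrite add0r annE; have [aM|aM] := ltnP (a j) M; last by rewrite scaler0.
have [_ h] := hA X a j aM jX.
by rewrite (coordvE xA) ?scaler0 //; apply: contra XA'; apply: h.
Qed.

Lemma nm_koszul D x : (D < M)%N -> x \in coordv (low S d M D) ->
  nm (koszul x) <= rt R (D + d) * nm x.
Proof.
move=> DM xD; rewrite nm_le_sqr ?mulr_ge0 ?nm_ge0 ?sqrtr_ge0 // exprMn sqr_nm.
rewrite [rt R _ ^+ 2]expr2 rt_sqr rip_koszul (koszulK DM xD) ripC -rip_dg_cst.
apply: rip_dg_le => -[X a] xa; rewrite ler_nat /tq /= leq_subLR.
rewrite (leq_trans _ (leq_addl _ _)) // leq_add2r leqNgt.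
by apply: contraNN xa => /(lowE X xD) ->.
Qed.

Lemma nm_Dop_koszul (P Q : 'I_d -> 'M[C]_N) D x : (D < M)%N -> x \in coordv (low S d M D) ->
  nm (Dop P Q (koszul x) - koszul (Dop P Q x)) <=
  (\sum_j (mxbound (P j) + mxbound (Q j))) * nm x.
Proof.
move=> DM xD; rewrite (Dop_koszul P Q DM xD) mulr_suml.
apply: le_trans (nm_sum _ _ _) _; apply: ler_sum => j _.
apply: le_trans (nmB _ _) _; rewrite mulrDl addrC; apply: lerD.
  exact: le_trans (nm_cdn _ _) (nm_mulV _ _).
exact: le_trans (nm_cup _ _) (nm_mulV _ _).
Qed.

(** With this weight [nkoszul] is the unitary phase of [koszul], an involution off its kernel; on
    the kernel the convention 0^-1 = 0 makes it vanish. *)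
Definition kweight (q : S * multi) : R := (rt R (tq q))^-1.
Definition nkoszul x : V := koszul (dgr kweight x).

Lemma nkoszul_linear : linear nkoszul.
Proof. by move=> c x y; rewrite /nkoszul dgr_linear koszul_linear. Qed.

Lemma kweight_move X (a : multi) j :
  (a j < M)%N -> j \notin X -> kweight (j |: X, inc j a) = kweight (X, a).
Proof. by move=> aM jX; rewrite /kweight tq_move. Qed.

Lemma rip_nkoszul x y : rip (nkoszul x) y = rip x (nkoszul y).
Proof.
by rewrite /nkoszul rip_koszul rip_dgr_sym (koszul_dgr _ kweight_move).
Qed.

Lemma nkoszulK D x : (D < M)%N -> x \in coordv (low S d M D) ->
  (forall q, x q != 0 -> (0 < tq q)%N) -> nkoszul (nkoszul x) = x.
Proof.
move=> DM xD x0; rewrite /nkoszul -(koszul_dgr _ kweight_move) dgrM.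
rewrite (@koszulK D) //; last exact: coordv_dgr.
rewrite dgrM; apply/ffunP => q; rewrite dgrE.
have [->|xq] := eqVneq (x q) 0; first by rewrite scaler0.
rewrite /kweight -invfM rt_sqr divff ?scale1r // pnatr_eq0 -lt0n; exact: x0.
Qed.

Section Comparison.
Variables (P Q : 'I_d -> 'M[C]_N) (k B : R) (s : nat).
Let sh (X : S) := (s + #|X|)%N.
Local Notation HH := (hamiltonian P Q k B sh).

Lemma par_move X (a : multi) j : (a j < M)%N -> j \notin X ->
  par sh (j |: X, inc j a) = par sh (X, a).
Proof.
move=> aM jX; rewrite /par /sh /= deg_inc // cardsU1 jX add1n addnS addSn addnS /=.
by rewrite negbK.
Qed.

Lemma excess_move X (a : multi) j : (a j < M)%N -> j \notin X ->
  excess R sh (j |: X, inc j a) = excess R sh (X, a).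
Proof.
move=> aM jX; rewrite /excess /sh /= deg_inc // cardsU1 jX add1n addnS -!natr1.
by rewrite opprD addrACA subrr addr0.
Qed.

Lemma nkoszul_dgr (f : S * multi -> R) x :
    (forall X (a : multi) j, (a j < M)%N -> j \notin X -> f (j |: X, inc j a) = f (X, a)) ->
  nkoszul (dgr f x) = dgr f (nkoszul x).
Proof. by move=> hf; rewrite /nkoszul dgr_comm koszul_dgr. Qed.

(** Two errors occur. The commutator with [koszul] has order zero and carries the weight 1/K. The
    commutator with the weight is at most 2K times the step K^-3 of the weight, and the outer
    [koszul] contributes another factor 2K. Hence 1/K + 4/K. *)
Lemma nm_Dop_nkoszul (P' Q' : 'I_d -> 'M[C]_N) D K x :
    (D.+1 < M)%N -> (0 < K)%N -> (D.+1 + d <= 4 * K ^ 2)%N ->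
    x \in coordv (low S d M D) -> (forall q, x q != 0 -> (K ^ 2 < deg q.2)%N) ->
  nm (Dop P' Q' (nkoszul x) - nkoszul (Dop P' Q' x)) <=
  5 * (\sum_j (mxbound (P' j) + mxbound (Q' j))) / K%:R * nm x.
Proof.
move=> DM K0 DK xD xK; have DM' := ltnW DM.
set cst := \sum_j _.
have cst0 : 0 <= cst by apply: sumr_ge0 => j _; rewrite addr_ge0 ?mxbound_ge0.
have KR : 0 < K%:R :> R by rewrite ltr0n.
have rtK n : (K ^ 2 <= n)%N -> K%:R <= rt R n.
  move=> nK; rewrite -(@ler_pXn2r _ 2) ?nnegrE ?ler0n ?sqrtr_ge0 //.
  by rewrite [rt R n ^+ 2]expr2 rt_sqr -natrX ler_nat.
have rt2K n : (n <= 4 * K ^ 2)%N -> rt R n <= 2 * K%:R.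
  move=> nK; rewrite -(@ler_pXn2r _ 2) ?nnegrE ?mulr_ge0 ?ler0n ?sqrtr_ge0 //.
  by rewrite [rt R n ^+ 2]expr2 rt_sqr exprMn -!natrX -natrM ler_nat.
(* The weight is frozen where [tq] is below K^2, so that its steps, of order n^(-3/2), are at most
   K^-3 in all degrees. Nothing changes in degrees K^2 and above. *)
pose F (X : S) t : R := (rt R (maxn (K ^ 2) (t + d - #|X|)))^-1.
have Xd (X : S) : (#|X| <= d)%N by rewrite (leq_trans (max_card _)) ?card_ord.
have step n : `|(rt R (maxn (K ^ 2) n))^-1 - (rt R (maxn (K ^ 2) n.+1))^-1| <=
    (K%:R ^+ 3)^-1.
  have [nK|nK] := ltnP n (K ^ 2)%N.
    by rewrite !(maxn_idPl _) ?subrr ?normr0 ?invr_ge0 ?exprn_ge0 // ltnW.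
  have nK' := leq_trans nK (leqnSn n).
  rewrite (maxn_idPr nK').
  have h1 := rtK _ nK; have h2 := rtK _ nK'.
  have h3 : rt R n.+1 * rt R n.+1 = rt R n * rt R n + 1 by rewrite !rt_sqr natr1.
  move: (rt R n) (rt R n.+1) (K%:R) KR h1 h2 h3 => a b c c0 ca cb ab.
  have a0 : 0 < a by lra.
  have b0 : 0 < b by lra.
  have ab' : a <= b by nra.
  rewrite ger0_norm ?subr_ge0 ?lef_pV2 //.
  have -> : a^-1 - b^-1 = (b - a) / (a * b) by field; rewrite !gt_eqF.
  rewrite ler_pdivrMr ?mulr_gt0 // ler_pdivlMl ?exprn_gt0 //.
  have e1 : c * (b - a) <= 1 by nra.
  have e2 : c * c <= a * b by nra.
  have -> : c ^+ 3 * (b - a) = (c * (b - a)) * (c * c) by ring.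
  have f1 : 0 <= c * (b - a) by nra.
  have f2 : 0 <= c * c by nra.
  by apply: le_trans (ler_pM f1 f2 e1 e2) _; rewrite mul1r.
have Fstep (X : S) t : (t <= D)%N -> `|F X t - F X t.+1| <= (K%:R ^+ 3)^-1.
  move=> _; have -> : F X t.+1 = (rt R (maxn (K ^ 2) (t + d - #|X|).+1))^-1.
    by rewrite /F addSn subSn // (leq_trans (Xd X)) // leq_addl.
  exact: step.
have Fk (q : S * multi) : (K ^ 2 <= deg q.2)%N -> kweight q = F q.1 (deg q.2).
  move=> qK; rewrite /kweight /F /tq (maxn_idPr _) // -addnBA // (leq_trans qK) //.
  exact: leq_addr.
have xF : dgr kweight x = dgr (fun q => F q.1 (deg q.2)) x.
  by apply: eq_dgr => q /xK qK; apply: Fk; apply: ltnW.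
(* [Dop] lowers the degree by at most one, so its values stay in degrees at least K^2; this uses the
   strict inequality in [xK]. *)
have DF : dgr kweight (Dop P' Q' x) = dgr (fun q => F q.1 (deg q.2)) (Dop P' Q' x).
  apply: eq_dgr => -[X a] h; apply: Fk; rewrite leqNgt; apply: contra h => /= aK.
  have x0 b : (deg b <= K ^ 2)%N -> x (X, b) = 0.
    by move=> bK; apply/eqP; apply: contraLR bK => /xK; rewrite -ltnNge.
  rewrite /Dop sum_ffunE big1 // => j _; rewrite ffunE !mulVE creE annE.
  have -> : (rt R (a j))%:C *: x (X, dec j a) = 0.
    have [a0|a0] := posnP (a j); first by rewrite a0 /rt sqrtr0 scale0r.
    rewrite x0 ?scaler0 //; apply: ltnW; apply: leq_ltn_trans aK.
    by rewrite -(deg_dec a0) leqnSn.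
  rewrite mulmx0 add0r; case: ifP => aM; last by rewrite mulmx0.
  by rewrite x0 ?scaler0 ?mulmx0 // deg_inc.
rewrite /nkoszul xF DF.
set y := dgr _ x; set w := dgr _ (Dop _ _ x).
have yD : y \in coordv (low S d M D) by apply: coordv_dgr.
have ynm : nm y <= (K%:R)^-1 * nm x.
  apply: nm_dgr => [|q /xK qK]; first by rewrite invr_ge0 ltW.
  rewrite -Fk; last exact: ltnW.
  rewrite /kweight ger0_norm ?invr_ge0 ?sqrtr_ge0 // lef_pV2 ?posrE //.
    apply: rtK; rewrite /tq -addnBA // (leq_trans (ltnW qK)) //; exact: leq_addr.
  rewrite sqrtr_gt0 ltr0n /tq -addnBA // (leq_trans _ (leq_addr _ _)) //.
  exact: leq_trans qK.
have -> : Dop P' Q' (koszul y) - koszul w =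
    (Dop P' Q' (koszul y) - koszul (Dop P' Q' y)) + koszul (Dop P' Q' y - w).
  by rewrite (raddfB koszul) /= addrA subrK.
have lowD z : z \in coordv (low S d M D) -> Dop P' Q' z \in coordv (low S d M D.+1).
  move=> zD; apply: memv_suml => j _; apply: memvD; apply: coordv_mulV.
    exact: low_cre.
  exact/(coordv_lowS (leqnSn D))/low_ann.
have comD : Dop P' Q' y - w \in coordv (low S d M D.+1).
  by apply: memvB; [apply: lowD | apply: coordv_dgr; apply: lowD].
have c3 : 0 <= (K%:R ^+ 3)^-1 :> R by rewrite invr_ge0 exprn_ge0 // ltW.
have hcom : nm (Dop P' Q' y - w) <= cst * rt R D.+1 * ((K%:R ^+ 3)^-1 * nm x).
  have h := nm_Dop_comm (R := R) (N := N) c3 Fstep P' Q' DM' xD; exact: h.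
apply: le_trans (nmD _ _) _.
have h1 : nm (Dop P' Q' (koszul y) - koszul (Dop P' Q' y)) <= cst * ((K%:R)^-1 * nm x).
  by apply: le_trans (nm_Dop_koszul P' Q' DM' yD) _; rewrite ler_wpM2l.
have h2 : nm (koszul (Dop P' Q' y - w)) <= 2 * K%:R * (cst * (2 * K%:R) * ((K%:R ^+ 3)^-1 * nm x)).
  apply: le_trans (nm_koszul DM comD) _; apply: ler_pM; rewrite ?nm_ge0 ?sqrtr_ge0 //.
    exact: rt2K.
  apply: le_trans hcom _; rewrite ler_wpM2r ?mulr_ge0 ?nm_ge0 // ler_wpM2l //.
  by apply: rt2K; rewrite (leq_trans _ DK) // leq_addr.
apply: le_trans (lerD h1 h2) _; rewrite le_eqVlt; apply/orP; left; apply/eqP.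
by field; rewrite gt_eqF.
Qed.

Lemma nm_dirac_nkoszul D K x : (D.+1 < M)%N -> (0 < K)%N -> (D.+1 + d <= 4 * K ^ 2)%N ->
    x \in coordv (low S d M D) -> (forall q, x q != 0 -> (K ^ 2 < deg q.2)%N) ->
  nm (dirac P Q sh (nkoszul x) - nkoszul (dirac P Q sh x)) <=
  5 * opbound P Q / K%:R * nm x.
Proof.
move=> DM K0 DK xD xK.
have prK b : pr sh b (nkoszul x) = nkoszul (pr sh b x).
  by rewrite /pr nkoszul_dgr // => X a j aM jX; rewrite par_move.
have prx b q : pr sh b x q != 0 -> (K ^ 2 < deg q.2)%N.
  by move=> h; apply: xK; apply: contraNneq h; rewrite prE => ->; case: ifP.
have := nm_Dop_nkoszul P Q DM K0 DK (coordv_dgr _ xD) (prx false).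
have := nm_Dop_nkoszul (fun j => adj (Q j)) (fun j => adj (P j)) DM K0 DK (coordv_dgr _ xD) (prx true).
rewrite -/(pr sh true x) -/(pr sh false x) => h2 h1.
rewrite /dirac !prK (_ : forall u v, nkoszul (u + v) = nkoszul u + nkoszul v); last first.
  by move=> u v; have := nkoszul_linear 1 u v; rewrite !scale1r.
rewrite opprD addrACA; apply: le_trans (nmD _ _) _.
rewrite /opbound mulrDr mulrDl mulrDl; apply: lerD.
  apply: le_trans h1 _; rewrite ler_wpM2l ?nm_pr // divr_ge0 ?ler0n // mulr_ge0 //.
  by apply: sumr_ge0 => j _; rewrite addr_ge0 ?mxbound_ge0.
apply: le_trans h2 _; rewrite ler_wpM2l ?nm_pr // divr_ge0 ?ler0n // mulr_ge0 //.
by apply: sumr_ge0 => j _; rewrite addr_ge0 ?mxbound_ge0.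
Qed.

(** Mass and window depend only on excess and parity, so they commute with [nkoszul]; only the Dirac
    part contributes an error, and only inside the window, where degrees exceed K^2. As [nkoszul] is
    isometric on these vectors, the form changes by less than [g] times the squared norm. *)
Lemma nkoszul_pos D K g x : (D.+1 < M)%N -> (0 < K)%N -> (D.+1 + d <= 4 * K ^ 2)%N ->
    (forall q : S * multi, window B sh q != 0 -> (K ^ 2 < deg q.2)%N) ->
    5 * opbound P Q / K%:R < g -> x \in coordv (low S d M D) -> x != 0 ->
    (forall q, x q != 0 -> (0 < tq q)%N) -> g * rip x x <= rip (HH x) x ->
  0 < rip (HH (nkoszul x)) (nkoszul x).
Proof.
move=> DM K0 DK hw hg xD x0 xt hx; have DM' := ltnW DM.
pose W : V -> V := dgr (window B sh).
pose com := dirac P Q sh (nkoszul (W x)) - nkoszul (dirac P Q sh (W x)).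
have WK y : W (nkoszul y) = nkoszul (W y).
  by rewrite /W nkoszul_dgr // => X a j aM jX; rewrite /window excess_move.
have massK y : dgr (mass k sh) (nkoszul y) = nkoszul (dgr (mass k sh) y).
  by rewrite nkoszul_dgr // => X a j aM jX; rewrite /mass excess_move // par_move.
have KB u v : nkoszul (u + v) = nkoszul u + nkoszul v.
  by have := nkoszul_linear 1 u v; rewrite !scale1r.
have HHU y : HH y = dgr (mass k sh) y + W (dirac P Q sh (W y)) by [].
have WD u v : W (u + v) = W u + W v by rewrite /W raddfD.
have HHE : HH (nkoszul x) = nkoszul (HH x) + W com.
  have -> : HH (nkoszul x) = nkoszul (dgr (mass k sh) x) + W (dirac P Q sh (nkoszul (W x))).
    by rewrite (HHU (nkoszul x)) massK WK.
  have -> : nkoszul (HH x) = nkoszul (dgr (mass k sh) x) + W (nkoszul (dirac P Q sh (W x))).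
    by rewrite (HHU x) KB (WK (dirac P Q sh (W x))).
  rewrite -addrA; congr (_ + _); rewrite -WD; congr (W _).
  by rewrite /com addrC subrK.
have hcom : nm com <= 5 * opbound P Q / K%:R * nm x.
  apply: le_trans (nm_dirac_nkoszul DM K0 DK (coordv_dgr _ xD) _) _.
    move=> q; rewrite dgrE => h; apply: hw; apply: contraNneq h => ->.
    by rewrite scale0r.
  rewrite ler_wpM2l ?divr_ge0 ?ler0n ?mulr_ge0 ?opbound_ge0 //.
  exact: nm_window.
have KK y : rip (nkoszul y) (nkoszul x) = rip y x.
  by rewrite rip_nkoszul (nkoszulK DM' xD xt).
have nmK : nm (nkoszul x) = nm x by rewrite /nm KK.
rewrite HHE ripDl KK.
have h := rip_CSN (W com) (nkoszul x).
have hW : nm (W com) <= 5 * opbound P Q / K%:R * nm x := le_trans (nm_window _ _ _) hcom.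
have x1 : 0 < nm x by rewrite sqrtr_gt0 rip_gt0.
move: h hW hx; rewrite nmK -sqr_nm.
move: (rip (W com) _) (nm (W com)) (rip (HH x) x) (nm x) (5 * _ / _) x1 hg => a b e r t r0 tg.
move=> h1 h2 h3; have h4 : b * r <= t * r * r by rewrite ler_wpM2r // ltW.
have h5 : t * r * r < g * r ^+ 2 by rewrite expr2 -mulrA ltr_pM2r ?mulr_gt0.
by lra.
Qed.

End Comparison.

End Koszul.

(** * Comparing sectors *)

Section InertiaMore.
Variables (R : realType) (I : finType) (N : nat).
Local Notation V := {ffun I -> 'cV[R[i]]_N}.

Lemma inertia_set0 (h : V -> V) (g : R) : inertia h set0 g 0.
Proof.
rewrite -[0%N](mul0n N) -(@cards0 I); apply: inertia_pos => x /coordvP x0.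
have -> : x = 0 by apply/ffunP => q; rewrite x0 ?inE // ffunE.
by rewrite !rip0r mulr0.
Qed.

(** [inertia_le] for the identity in both directions: a perturbation below the gap cannot destroy
    positivity. *)
Lemma inertia_close (h h' : V -> V) (A : {set I}) (g e : R) p p' : e < g -> 0 < g ->
    (forall x, x \in coordv A -> nm (h x - h' x) <= e * nm x) ->
  inertia h A g p -> inertia h' A g p' -> p = p'.
Proof.
move=> eg g0 hh hp hp'; apply/eqP; rewrite eqn_leq.
have id_lin : linear (@id V) by [].
have pos (f f' : V -> V) x : nm (f' x - f x) <= e * nm x -> x != 0 ->
    g * rip x x <= rip (f x) x -> 0 < rip (f' (id x)) (id x).
  move=> hx x0 fx; rewrite -[f' _](subrK (f x)) /= ripDl.
  have h1 := rip_CSN (f' x - f x) x; have x1 : 0 < nm x by rewrite sqrtr_gt0 rip_gt0.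
  move: h1 hx fx; rewrite -sqr_nm.
  move: (rip _ x) (nm _) (rip (f x) x) (nm x) x1 => a b u r r0 h1 h2 h3.
  have h4 : b * r <= e * r * r by rewrite ler_wpM2r // ltW.
  have h5 : e * r * r < g * r ^+ 2 by rewrite expr2 -mulrA ltr_pM2r ?mulr_gt0.
  by lra.
apply/andP; split.
  apply: inertia_le id_lin (ltW g0) (fun _ h => h) _ hp hp' => x xA.
  by apply: pos; rewrite -nmN opprB; apply: hh.
apply: inertia_le id_lin (ltW g0) (fun _ h => h) _ hp' hp => x xA.
by apply: pos; apply: hh.
Qed.

End InertiaMore.

Section Sectors.
Variables (R : realType) (d N : nat) (S : finType) (M : nat).
Local Notation C := R[i].
Local Notation multi := {ffun 'I_d -> 'I_M.+1}.
Local Notation V := {ffun S * multi -> 'cV[C]_N}.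
Implicit Types (x y : V).
Variables (P Q : 'I_d -> 'M[C]_N) (k B : R) (sh : S -> nat).
Local Notation HH := (hamiltonian P Q k B sh).

Definition sector (X : S) (E : pred multi) : {set S * multi} :=
  [set q | (q.1 == X) && E q.2].

(** The Hamiltonian never changes the first index, and the outer window prevents it from reaching
    the points of a fibre outside [A]. *)
Lemma coordv_sector_hamiltonian (A : {set S * multi}) x :
    (forall X a b, (X, a) \in A -> (X, b) \notin A -> window B sh (X, b) = 0) ->
  x \in coordv A -> HH x \in coordv A.
Proof.
move=> hA xA; have Dop0 P' Q' y (X : S) a : (forall b, y (X, b) = 0) -> Dop P' Q' y (X, a) = 0.
  move=> y0; rewrite /Dop sum_ffunE big1 // => j _; rewrite ffunE !mulVE creE annE.
  by rewrite !y0 !scaler0 if_same !mulmx0 addr0.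
apply: memvD; first exact: coordv_dgr.
apply/coordvP => -[X b] XA; rewrite dgrE.
have [/existsP[a aA]|] := boolP [exists a, (X, a) \in A].
  by rewrite (hA _ _ _ aA XA) scale0r.
rewrite negb_exists => /forallP h.
have x0 a : dgr (window B sh) x (X, a) = 0.
  by rewrite dgrE (coordvE xA (h a)) scaler0.
have pr0 c a : pr sh c (dgr (window B sh) x) (X, a) = 0 by rewrite prE x0 if_same.
have -> : dirac P Q sh (dgr (window B sh) x) (X, b) = 0; last by rewrite scaler0.
have ffD (u v : V) q : (u + v) q = u q + v q by rewrite ffunE.
rewrite /dirac ffD -[RHS]addr0; congr (_ + _).
  exact: Dop0 (pr0 false).
exact: Dop0 (pr0 true).
Qed.

Lemma inertia_bigcup (Z : pred S) (A : S -> {set S * multi}) (p : S -> nat) (g : R) :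
    (forall X q, q \in A X -> q.1 = X) ->
    (forall X a, (X, a) \notin A X -> window B sh (X, a) = 0 \/ A X = set0) ->
    (forall X, Z X -> inertia HH (A X) g (p X)) ->
  inertia HH (\bigcup_(X | Z X) A X) g (\sum_(X | Z X) p X).
Proof.
move=> hA hw hp; rewrite -!(big_filter (index_enum S)).
have: uniq [seq X <- index_enum S | Z X] by rewrite filter_uniq ?index_enum_uniq.
have : all Z [seq X <- index_enum S | Z X] by apply: filter_all.
elim: [seq X <- _ | _] => [|X l IH] /=; first by rewrite !big_nil => _ _; apply: inertia_set0.
case/andP => ZX Zl /andP[Xl ul]; rewrite !big_cons.
have memU (Y : S) b : (Y, b) \in \bigcup_(X <- l) A X = (Y \in l) && ((Y, b) \in A Y).
  apply/idP/idP => [|/andP[Yl YA]]; last first.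
    by rewrite (big_rem Y) //= inE YA.
  elim: (l) => [|Y' l' IH']; first by rewrite big_nil inE.
  rewrite big_cons !inE => /orP[h|/IH' /andP[-> ->]]; last by rewrite orbT.
  by have /= e := hA _ _ h; rewrite -e in h *; rewrite eqxx.
have pres (A' : {set S * multi}) : (forall Y a b, (Y, a) \in A' -> (Y, b) \notin A' ->
    (Y, a) \in A Y /\ (Y, b) \notin A Y) -> forall x, x \in coordv A' -> HH x \in coordv A'.
  move=> h x; apply: coordv_sector_hamiltonian => Y a b h1 h2; have [h3 h4] := h Y a b h1 h2.
  by case: (hw Y b h4) => // e; rewrite e inE in h3.
apply: inertia_setU => //; last 1 first.
- exact: IH.
- exact: hamiltonian_linear.
- rewrite -setI_eq0; apply/eqP/setP => -[Y b]; rewrite in_setI memU in_set0.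
  apply/negP => /andP[/hA /= e /andP[Yl _]]; by rewrite -e Yl in Xl.
- apply: pres => Y a b h1 h2; have /= e := hA _ _ h1.
  by subst Y.
- apply: pres => Y a b; rewrite !memU => /andP[-> ->] /=; by [].
- exact: hp.
Qed.

End Sectors.

(** * Transport of a sector to another index set *)

Section Relabel.
Variables (R : realType) (d N : nat) (S S' : finType) (M : nat).
Local Notation C := R[i].
Local Notation multi := {ffun 'I_d -> 'I_M.+1}.
Local Notation V := {ffun S * multi -> 'cV[C]_N}.
Local Notation V' := {ffun S' * multi -> 'cV[C]_N}.
Variables (P Q : 'I_d -> 'M[C]_N) (k B : R) (sh : S -> nat) (sh' : S' -> nat).
Variables (X : S) (X' : S').
Hypothesis shX : sh X = sh' X'.
Local Notation HH := (hamiltonian P Q k B).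

Definition relabel (x : V) : V' :=
  [ffun q : S' * multi => if q.1 == X' then x (X, q.2) else 0].

Lemma relabelE x Y a : relabel x (Y, a) = if Y == X' then x (X, a) else 0.
Proof. by rewrite [LHS]ffunE. Qed.

Lemma relabel_linear : linear relabel.
Proof.
move=> c x y; apply/ffunP => -[Y a]; rewrite [RHS]ffunE [X in _ = X + _]ffunE !relabelE.
by case: ifP => _; rewrite ?ffunE ?scaler0 ?addr0.
Qed.

Lemma relabelD x y : relabel (x + y) = relabel x + relabel y.
Proof. by have := relabel_linear 1 x y; rewrite !scale1r. Qed.

Lemma relabel_dgr (f : S * multi -> R) (f' : S' * multi -> R) x :
  (forall a, f (X, a) = f' (X', a)) -> relabel (dgr f x) = dgr f' (relabel x).
Proof.
move=> ff; apply/ffunP => -[Y a]; rewrite dgrE !relabelE dgrE.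
by have [->|_] := eqVneq Y X'; rewrite ?ff ?scaler0.
Qed.

Lemma relabel_Dop P' Q' x : relabel (Dop P' Q' x) = Dop P' Q' (relabel x).
Proof.
apply/ffunP => -[Y a]; rewrite relabelE /Dop !sum_ffunE.
have [->|YX] := eqVneq Y X'.
  apply: eq_bigr => j _; rewrite [LHS]ffunE [RHS]ffunE !mulVE !creE !annE !relabelE eqxx.
  by [].
rewrite big1 // => j _; rewrite ffunE !mulVE creE annE !relabelE (negPf YX).
by rewrite !scaler0 if_same !mulmx0 addr0.
Qed.

Lemma relabel_hamiltonian x : relabel (HH sh x) = HH sh' (relabel x).
Proof.
have prR b y : relabel (pr sh b y) = pr sh' b (relabel y).
  by apply: relabel_dgr => a; rewrite /par /= shX.
have DDR y : relabel (dirac P Q sh y) = dirac P Q sh' (relabel y).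
  rewrite [LHS]relabelD; congr (_ + _); rewrite -prR; exact: relabel_Dop.
have wR y : relabel (dgr (window B sh) y) = dgr (window B sh') (relabel y).
  by apply: relabel_dgr => a; rewrite /window /excess /= shX.
rewrite /hamiltonian relabelD wR DDR wR; congr (_ + _).
by apply: relabel_dgr => a; rewrite /mass /excess /par /= shX.
Qed.

Lemma rip_relabel E x y : x \in coordv (sector X E) -> rip (relabel x) (relabel y) = rip x y.
Proof.
move=> xE; have pairE (T : finType) (u : T * multi -> R) : \sum_q u q = \sum_Y \sum_a u (Y, a).
  by rewrite pair_bigA; apply: eq_bigr => -[].
rewrite /rip !pairE (bigD1 X') //= [RHS](bigD1 X) //=.
rewrite [X in _ + X = _]big1 ?[X in _ = _ + X]big1 ?addr0.
- by apply: eq_bigr => a _; apply: eq_bigr => l _; rewrite !relabelE eqxx.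
- move=> Y YX; apply: big1 => a _; apply: big1 => l _.
  by rewrite (coordvE xE) ?inE /= ?(negPf YX) // mxE rd0l.
- move=> Y YX; apply: big1 => a _; apply: big1 => l _.
  by rewrite relabelE (negPf YX) mxE rd0l.
Qed.

Lemma coordv_relabel E x : x \in coordv (sector X E) -> relabel x \in coordv (sector X' E).
Proof.
move=> xE; apply/coordvP => -[Y a]; rewrite relabelE inE /=.
case: eqP => //= _ aE; apply: (coordvE xE); by rewrite inE /= eqxx.
Qed.

End Relabel.

(** Sectors with different first index are decoupled, so the index depends on the label only through
    its shift. This links the family over one point to the family over all subsets. *)
Lemma inertia_sector (R : realType) (d N : nat) (S S' : finType) (M : nat)
    (P Q : 'I_d -> 'M[R[i]]_N) (k B : R) (sh : S -> nat) (sh' : S' -> nat)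
    (X : S) (X' : S') (E : pred {ffun 'I_d -> 'I_M.+1}) g p p' :
    0 < g -> sh X = sh' X' ->
    inertia (hamiltonian P Q k B sh) (sector X E) g p ->
    inertia (hamiltonian P Q k B sh') (sector X' E) g p' ->
  p = p'.
Proof.
have half (T T' : finType) (s : T -> nat) (s' : T' -> nat) (Y : T) (Y' : T') q q' :
    0 < g -> s Y = s' Y' -> inertia (hamiltonian P Q k B s) (sector Y E) g q ->
    inertia (hamiltonian P Q k B s') (sector Y' E) g q' -> (q <= q')%N.
  move=> g0 ss; apply: inertia_le (relabel_linear Y Y') (ltW g0) _ _.
    exact: coordv_relabel.
  move=> x xE x0 hx; rewrite -(relabel_hamiltonian P Q k B ss) ripC (rip_relabel _ _ xE) ripC.
  by apply: lt_le_trans hx; rewrite mulr_gt0 ?rip_gt0.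
move=> g0 ss hp hp'; apply/eqP; rewrite eqn_leq.
by rewrite (half _ _ _ _ _ _ _ _ g0 ss hp hp') (half _ _ _ _ _ _ _ _ g0 (esym ss) hp' hp).
Qed.

(** * Counting subsets and multi-indices, and the final congruence *)

Lemma card_set_parity (d : nat) (b : bool) :
  (0 < d)%N -> #|[set X : {set 'I_d} | odd #|X| == b]| = (2 ^ d.-1)%N.
Proof.
case: d => // d _ /=; pose F c := [set X : {set 'I_d.+1} | odd #|X| == c].
(* Toggling one element is an involution that reverses the parity. *)
pose t (X : {set 'I_d.+1}) := if ord0 \in X then X :\ ord0 else ord0 |: X.
have tK : involutive t.
  move=> X; rewrite /t; have [oX|oX] := boolP (ord0 \in X).
    by rewrite setD11 setD1K.
  by rewrite setU11 setU1K.
have todd X : odd #|t X| = ~~ odd #|X|.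
  rewrite /t; case: ifPn => oX; last by rewrite cardsU1 oX.
  by rewrite [in RHS](cardsD1 ord0 X) oX /= negbK.
have le c : (#|F c| <= #|F (~~ c)|)%N.
  rewrite -(card_imset _ (inv_inj tK)); apply/subset_leq_card/subsetP => _ /imsetP[X + ->].
  by rewrite !inE todd => /eqP ->.
have e c : #|F c| = #|F (~~ c)|.
  by apply/eqP; rewrite eqn_leq le -{2}[c]negbK le.
have tot : (#|F false| + #|F true| = 2 ^ d.+1)%N.
  have <- : #|powerset [set: 'I_d.+1]| = (2 ^ d.+1)%N by rewrite card_powerset cardsT card_ord.
  rewrite -cardsUI.
  rewrite (_ : F false :&: F true = set0) ?cards0 ?addn0.
    by apply: eq_card => X; rewrite !inE subsetT; case: (odd _).
  by apply/setP => X; rewrite !inE; case: (odd _).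
have h : #|F false| = (2 ^ d)%N.
  by apply/eqP; rewrite -(eqn_pmul2l (ltn0Sn 1)) -expnS -tot mul2n -addnn -(e false).
by case: b; rewrite -/(F _) ?h // -h (e false).
Qed.

(** Modulo 2N, [p i] depends only on the parity of i, so both sums are [2 ^ d.-1] times one value.
    The identity then says that [2 ^ d.-1] divides N times an odd integer, to which it is
    coprime. *)
Lemma parity_dvdn (d N : nat) (p : nat -> nat) : (0 < d)%N ->
    (forall i, (i.+2 <= d)%N -> p i.+2 = p i %[mod N * 2]) ->
    (\sum_(X : {set 'I_d} | odd #|X| == false) p #|X| + N * odd d =
     \sum_(X : {set 'I_d} | odd #|X| == true) p #|X| + N * ~~ odd d)%N ->
  (2 ^ d.-1 %| N)%N.
Proof.
move=> d0 hp; set v := (2 ^ d.-1)%N.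
have pmod i : (i <= d)%N -> p i = p (odd i) %[mod N * 2].
  elim/ltn_ind: i => -[|[|i]] IH // id; rewrite hp //= negbK.
  by apply: IH => //; apply: ltnW; apply: ltnW.
have sumE b : \sum_(X : {set 'I_d} | odd #|X| == b) p #|X| = v * p b %[mod N * 2].
  rewrite /v -(card_set_parity b d0) -sum_nat_const.
  under [in RHS]eq_bigl => X do rewrite inE.
  apply: (big_ind2 (fun x y => x = y %[mod N * 2])) => // [x1 x2 y1 y2 e1 e2|X /eqP <-].
    by rewrite -modnDm e1 e2 modnDm.
  by apply: pmod; rewrite (leq_trans (max_card _)) ?card_ord.
move=> hs; have {hs} : (v * p false + N * odd d = v * p true + N * ~~ odd d %[mod N * 2])%N.
  by rewrite -modnDml -sumE modnDml hs -modnDml sumE modnDml.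
move=> hs; suff : (v%:Z %| N%:Z)%Z by [].
have {hs} : ((N * 2)%:Z %| (v * p false + N * odd d)%:Z - (v * p true + N * ~~ odd d)%:Z)%Z.
  by rewrite -eqz_mod_dvd !modz_nat; apply/eqP; congr (_%:Z).
case/dvdzP => q hq.
have [u hu] : exists u : int, N%:Z * (q *+ 2 + 1 - (odd d)%:Z *+ 2) = v%:Z * u.
  exists ((p false)%:Z - (p true)%:Z); move: hq; rewrite !PoszD !PoszM.
  case: (odd d) => /= hq; lra.
have cop : coprimez v%:Z (q *+ 2 + 1 - (odd d)%:Z *+ 2).
  rewrite coprimezE /= coprimeXl // coprime2n.
  have [w ->] : exists w : int, q *+ 2 + 1 - (odd d)%:Z *+ 2 = w *+ 2 + 1.
    by exists (q - (odd d)%:Z); rewrite mulrnBl addrAC.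
  case: w => n.
    by rewrite (_ : _ + 1 = Posz n.*2.+1) ?absz_nat /= ?odd_double //; lia.
  by rewrite (_ : _ + 1 = - Posz n.*2.+1) ?abszN /= ?odd_double //; lia.
by rewrite -(Gauss_dvdzl _ cop) hu dvdz_mulr.
Qed.

(** Ordered partitions of t into [d.+1] parts; the bound [t <= M] keeps the truncation out of
    play. *)
Lemma card_deg (d M t : nat) : (t <= M)%N ->
  #|[set a : {ffun 'I_d.+1 -> 'I_M.+1} | deg a == t]| = 'C(d + t, d).
Proof.
move=> tM; rewrite -card_ord_partitions.
pose f (u : d.+1.-tuple 'I_t.+1) : {ffun 'I_d.+1 -> 'I_M.+1} := [ffun j => inord (tnth u j)].
have fE u j : f u j = tnth u j :> nat.
  by rewrite ffunE inordK // ltnS (leq_trans (leq_ord _)).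
have degf (u : d.+1.-tuple 'I_t.+1) : deg (f u) = (\sum_(i <- u) i)%N.
  by rewrite /deg big_tuple; apply: eq_bigr => j _; rewrite fE.
have f_inj : injective f.
  move=> u w uw; apply: eq_from_tnth => j; apply: val_inj => /=.
  by rewrite -!fE uw.
rewrite -(card_imset _ f_inj); apply: eq_card => a; rewrite inE.
apply/eqP/imsetP => [at_|[u + ->]]; last by rewrite inE degf => /eqP.
pose u : d.+1.-tuple 'I_t.+1 := [tuple inord (a j) | j < d.+1].
have fu : f u = a.
  apply/ffunP => j; apply: val_inj => /=; rewrite fE tnth_mktuple inordK //.
  by rewrite ltnS -at_ leq_deg.
by exists u; rewrite // inE -degf fu at_.
Qed.

(** Among the d consecutive factors of d! C(m + i, d), descending from m + i, one is m itself, since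
    i < d. *)
Lemma bin_even (d m i : nat) : (2 * d`! %| m)%N -> (i < d)%N -> ~~ odd 'C(m + i, d).
Proof.
move=> dm id; rewrite -dvdn2 -(dvdn_pmul2r (fact_gt0 d)) bin_ffact.
apply: dvdn_trans dm _; rewrite ffact_prod.
by rewrite (bigD1 (Ordinal id)) //= addnK dvdn_mulr.
Qed.

(** * Divisibility by a power of two *)

(** Choice of scales, with u = [opbound] and v = [garding_cst]. The window width b is fixed first,
    large against u / c; then K, whose square is the scale of the degrees and dominates b and the
    other constants. The factor d! of K serves the evenness of binomial coefficients. *)
Lemma cutoff_params (R : realType) (d : nat) (c u v : R) : 0 < c -> 0 <= u -> 0 <= v ->
  exists b K : nat, [/\ (32 <= b)%N, 128 * u <= c * b%:R, (0 < K)%N /\ (d`! %| K)%N,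
    (d.+1 + 4 * b + 2 <= K ^ 2)%N & 2 * v <= c ^+ 2 * K%:R ^+ 2 /\ 20 * u < c * K%:R ^+ 2].
Proof.
move=> c0 u0 v0; pose b := (32 + Num.bound (128 * u / c))%N.
pose m := (d.+1 + 4 * b + 2 + (Num.bound (2 * v / c ^+ 2) + Num.bound (20 * u / c)))%N.
pose K := (d`! * m)%N.
have c20 : 0 < c ^+ 2 by rewrite exprn_gt0.
have mK : (m <= K ^ 2)%N.
  apply: (@leq_trans K); first by rewrite leq_pmull ?fact_gt0.
  by rewrite -mulnn leq_pmull // muln_gt0 fact_gt0.
have mK' : m%:R <= K%:R ^+ 2 :> R by rewrite -natrX ler_nat.
have bd (x : R) n : 0 <= x -> (Num.bound x <= n)%N -> x < n%:R.
  by move=> x0 xn; apply: lt_le_trans (archi_boundP x0) _; rewrite ler_nat.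
have x1 : 0 <= 128 * u / c by rewrite divr_ge0 ?mulr_ge0 // ltW.
have x2 : 0 <= 2 * v / c ^+ 2 by rewrite divr_ge0 ?mulr_ge0 // ltW.
have x3 : 0 <= 20 * u / c by rewrite divr_ge0 ?mulr_ge0 // ltW.
exists b, K; split.
- exact: leq_addr.
- by rewrite [c * _]mulrC -ler_pdivrMr // ltW // bd // leq_addl.
- by rewrite muln_gt0 fact_gt0 dvdn_mulr.
- by rewrite (leq_trans _ mK) // leq_addr.
split.
- rewrite [c ^+ 2 * _]mulrC -ler_pdivrMr //; apply: le_trans mK'; apply: ltW.
  by apply: bd => //; rewrite /m addnA addnAC leq_addl.
- rewrite [c * _]mulrC -ltr_pdivrMr //; apply: lt_le_trans mK'.
  by apply: bd => //; rewrite /m addnA leq_addl.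
Qed.

Section Parity.
Variables (R : realType) (d N : nat) (P Q : 'I_d.+1 -> 'M[R[i]]_N) (c : R).
Hypotheses (c0 : 0 < c) (ell : elliptic P Q c).
Hypothesis ella : elliptic (fun j => adj (Q j)) (fun j => adj (P j)) c.
Variables (b K T s : nat).
Hypotheses (b32 : (32 <= b)%N) (bop : 128 * opbound P Q <= c * b%:R).
Hypotheses (K0 : (0 < K)%N) (dK : (d`! %| K)%N).
Hypotheses (TK : (T + d.+2 = 2 * K ^ 2)%N) (sT : (s + 2 * b = T)%N).
Hypotheses (Ks : (K ^ 2 + 2 * b < s)%N) (dK2 : (d.+1 <= 2 * K ^ 2)%N).
Hypotheses (Kgc : 2 * garding_cst P Q <= c ^+ 2 * K%:R ^+ 2).
Hypothesis Kop : 20 * opbound P Q < c * K%:R ^+ 2.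

(** For the shift s, the window lies between K^2 and T = s + 2b. The shifts used go up to s + d + 1,
    so D is the largest degree needed, with D + 1 = 2 K^2; M leaves the margin required by
    [garding]. *)
Let D := (T + d.+1)%N.
Let M := D.+2.
(** The mass has size cK/2 at the inner edge b of the window and cK = 4g at the outer edge 2b. *)
Let k : R := c * K%:R / (2 * b%:R).
Let g : R := c * K%:R / 4.
Local Notation multi := {ffun 'I_d.+1 -> 'I_M.+1}.
Local Notation HH := (hamiltonian P Q k b%:R).

Let KR : 0 < K%:R :> R. Proof. by rewrite ltr0n. Qed.
Let bR : 32 <= b%:R :> R. Proof. by rewrite (ler_nat R 32). Qed.
Let b0 : 0 < b%:R :> R. Proof. by apply: lt_le_trans bR; rewrite ltr0n. Qed.
Let k0 : 0 <= k. Proof. by rewrite divr_ge0 ?mulr_ge0 ?ler0n // ltW. Qed.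
Let g0 : 0 < g. Proof. by rewrite divr_gt0 ?mulr_gt0. Qed.
Let kb : k * (2 * b%:R) = 4 * g.
Proof. by rewrite /k /g; field; rewrite gt_eqF. Qed.
Let DK : (D.+1 = 2 * K ^ 2)%N. Proof. by rewrite /D -TK !addnS. Qed.

Let rtD : rt R D.+1 <= 2 * K%:R.
Proof.
rewrite -(@ler_pXn2r _ 2) ?nnegrE ?mulr_ge0 ?ler0n ?sqrtr_ge0 //.
by rewrite [rt R _ ^+ 2]expr2 rt_sqr exprMn -!natrX -natrM ler_nat DK leq_mul2r orbT.
Qed.

Lemma window_low (S : finType) (sh : S -> nat) (q : S * multi) : (forall X, s <= sh X)%N ->
  window (b%:R : R) sh q != 0 -> (K ^ 2 < deg q.2)%N.
Proof.
move=> hs; apply: contraNltn => qK; apply/eqP; apply: cutoff0 => //.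
have h : (deg q.2 + 2 * b <= sh q.1)%N.
  by apply: leq_trans (hs q.1); apply: leq_trans (ltnW Ks); rewrite leq_add2r.
have : (deg q.2)%:R + 2 * b%:R <= (sh q.1)%:R :> R by rewrite -natrM -natrD ler_nat.
by have := b0; rewrite /excess => b0' h'; rewrite ler0_norm; lra.
Qed.

Lemma window_high (S : finType) (sh : S -> nat) (q : S * multi) :
  (sh q.1 + 2 * b <= deg q.2)%N -> window (b%:R : R) sh q = 0.
Proof.
move=> h; apply: cutoff0 => //.
have : (sh q.1)%:R + 2 * b%:R <= (deg q.2)%:R :> R by rewrite -natrM -natrD ler_nat.
by have := b0; rewrite /excess => b0' h'; rewrite ger0_norm; lra.
Qed.

(** By [bop] and [rtD], the commutator with the window is at most g/16. *)
Let Lb : 0 <= opbound P Q * rt R D.+1 / b%:R <= c * K%:R / 64.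
Proof.
have o0 := opbound_ge0 P Q; have r0 : 0 <= rt R D.+1 by apply: sqrtr_ge0.
rewrite divr_ge0 ?mulr_ge0 ?ler0n //= ler_pdivrMr //.
move: bop rtD o0 r0 KR; move: (opbound P Q) (rt R D.+1) (K%:R : R) => o r u h1 h2 o0 r0 u0.
have h3 : o * r <= o * (2 * u) by rewrite ler_wpM2l.
have h4 : 128 * o * u <= c * b%:R * u by rewrite ler_wpM2r // ltW.
by lra.
Qed.

(** The same gap serves all index sets and all shifts from s on, which makes their indices
    comparable. *)
Lemma spectral_gap (S : finType) (sh : S -> nat) (x : {ffun S * multi -> 'cV[R[i]]_N}) :
    (forall X, s <= sh X)%N -> x \in coordv (low S d.+1 M D) ->
  g ^+ 2 * rip x x <= rip (HH sh x) (HH sh x).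
Proof.
move=> hs xD; pose G : R := c ^+ 2 * K%:R ^+ 2 / 4.
have K1 : K%:R != 0 :> R by rewrite gt_eqF.
have lowW (q : S * multi) : window (b%:R : R) sh q != 0 -> (K ^ 2 <= deg q.2)%N.
  by move=> h; apply: ltnW; apply: window_low hs h.
have h1 : 2 * G <= c ^+ 2 * (K ^ 2)%:R - garding_cst P Q.
  by move: Kgc; rewrite /G natrX; move: (c ^+ 2 * _) (garding_cst _ _) => u v; lra.
have h2 : 0 <= G by rewrite divr_ge0 ?mulr_ge0 ?exprn_ge0 // ltW.
have h3 : G <= (k * b%:R) ^+ 2.
  have -> : k * b%:R = c * K%:R / 2 by rewrite /k; field; rewrite gt_eqF.
  by rewrite /G le_eqVlt; apply/orP; left; apply/eqP; field.
have := hamiltonian_gap b0 k0 ell ella (ltnSn D.+1) xD lowW h1 h2 h3.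
apply: le_trans; rewrite ler_wpM2r ?rip_ge0 //.
have -> : k * (opbound P Q * rt R D.+1) = c * K%:R / 2 * (opbound P Q * rt R D.+1 / b%:R).
  by rewrite /k; field; rewrite gt_eqF.
(* With u = cK, the claim amounts to 1/4 - 1/64^2 - 1/128 >= 1/16. *)
rewrite /G /g; have /andP[] := Lb; have := mulr_gt0 c0 KR; rewrite -exprMn.
move: (c * K%:R) (_ / b%:R) => u t u0 t0 tu.
have h4 : t ^+ 2 <= (u / 64) ^+ 2 by rewrite ler_sqr ?nnegrE //; lra.
have h5 : u / 2 * t <= u / 2 * (u / 64) by rewrite ler_wpM2l //; lra.
by move: h4 h5; rewrite !exprMn; have := sqr_ge0 u; lra.
Qed.

Lemma inertia_ex (S : finType) (sh : S -> nat) (A : {set S * multi}) : (forall X, s <= sh X)%N ->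
    (forall q, q \in A -> (deg q.2 <= D)%N) ->
    (forall X a a', (X, a) \in A -> (X, a') \notin A -> window (b%:R : R) sh (X, a') = 0) ->
  exists p, inertia (HH sh) A g p.
Proof.
move=> hs AD Aw; apply: inertia_exists => //.
- exact: hamiltonian_linear.
- exact: rip_hamiltonian.
- by move=> x; apply: coordv_sector_hamiltonian.
- move=> x xA; apply: spectral_gap hs _; apply: lowP => X a aD.
  by apply: (coordvE xA); apply: contraTN aD => /AD /=; rewrite leqNgt.
Qed.


Lemma card_sector (S : finType) (X : S) t : (t <= D)%N ->
  #|sector X (fun a : multi => deg a == t)| = 'C(d + t, d).
Proof.
move=> tD; rewrite -(@card_deg d M); last by rewrite (leq_trans tD) // leqW.
have inj : injective (fun a : multi => (X, a)) by move=> a a' [].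
rewrite -[RHS](card_imset _ inj).
apply: eq_card => -[Y a]; rewrite !inE /=; apply/andP/imsetP => [[/eqP -> h]|[a' + [-> ->]]].
  by exists a; rewrite ?inE.
by rewrite inE.
Qed.

(** In a single degree beyond the window the Hamiltonian is a scalar, of absolute value at least g
    and with the sign of the mass. *)
Lemma inertia_off (S : finType) (sh : S -> nat) (X : S) (t : nat) :
    (t <= D)%N -> (sh X + 2 * b <= t)%N ->
  inertia (HH sh) (sector X (fun a : multi => deg a == t)) g
    (if odd (t + sh X) then 0 else 'C(d + t, d) * N)%N.
Proof.
move=> tD tX.
have tR : (sh X)%:R + 2 * b%:R <= t%:R :> R by rewrite -natrM -natrD ler_nat.
have kt : g <= k * (t%:R - (sh X)%:R).
  have h : k * (2 * b%:R) <= k * (t%:R - (sh X)%:R) by rewrite ler_wpM2l //; lra.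
  apply: le_trans h; rewrite kb; have := g0; lra.
have HHE x : x \in coordv (sector X (fun a : multi => deg a == t)) ->
    HH sh x = dgr (fun=> (-1) ^+ odd (t + sh X) * (k * (t%:R - (sh X)%:R))) x.
  move=> xA; rewrite (hamiltonian_off P Q k (sh := sh) _ xA).
    apply: eq_dgr => -[Y a] xq; have : (Y, a) \in sector X (fun a : multi => deg a == t).
      by apply: contraNT xq => h; rewrite (coordvE xA h).
    by rewrite inE /= => /andP[/eqP -> /eqP e]; rewrite /mass /par /excess /= e.
  by move=> [Y a]; rewrite inE /= => /andP[/eqP -> /eqP e]; apply: window_high; rewrite /= e.
have ripE x : x \in coordv (sector X (fun a : multi => deg a == t)) ->
    rip (HH sh x) x = (-1) ^+ odd (t + sh X) * (k * (t%:R - (sh X)%:R)) * rip x x.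
  by move=> xA; rewrite (HHE x xA) -rip_dg_cst.
case: ifPn => odt.
  apply: inertia_neg => x xA; rewrite (ripE x xA) odt expr1 mulN1r mulNr lerN2.
  by rewrite ler_wpM2r ?rip_ge0.
rewrite -(card_sector X tD); apply: inertia_pos => x xA.
by rewrite (ripE x xA) (negPf odt) expr0 mul1r ler_wpM2r ?rip_ge0.
Qed.

(** For the shift s + i, the degree T + i = (s + i) + 2b is the upper edge of the window, so the
    Hamiltonian does not cross this bound. *)
Let upto i : pred multi := fun a => (deg a <= T + i)%N.
Let shu (i : nat) : unit -> nat := fun=> (s + i)%N.

Lemma unit_inertia : exists p : nat -> nat, forall i, (i <= d.+1)%N ->
  inertia (HH (shu i)) (sector tt (upto i)) g (p i).
Proof.
have ex (i : 'I_d.+2) : exists p, inertia (HH (shu i)) (sector tt (upto i)) g p.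
  apply: inertia_ex => [X|[u a]|u a a'].
  - exact: leq_addr.
  - by rewrite inE /= => h; rewrite (leq_trans h) // leq_add2l -ltnS.
  rewrite !inE /= => _ h; apply: window_high; rewrite /= /shu.
  by rewrite addnAC sT ltnW // ltnNge.
have [p hp] := fin_all_exists ex.
exists (fun i => p (inord i)) => i id.
by have := hp (inord i); rewrite inordK.
Qed.

(* [s + i] can be replaced by [s + i.+2] at no cost; of the two degrees added, the
   first has negative and the second positive mass. *)
Lemma inertia_step i p p' : (i.+2 <= d.+1)%N ->
  inertia (HH (shu i)) (sector tt (upto i)) g p ->
  inertia (HH (shu i.+2)) (sector tt (upto i.+2)) g p' ->
  p' = (p + 'C(2 * K ^ 2 + i, d) * N)%N.
Proof.
move=> id hp hp'.
have st : (s + 2 * b)%N = T := sT.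
(* The sum equals 2(s + b + i) + 1. *)
have odd1 : odd (T + i.+1 + (s + i))
  by rewrite -st !(oddD, oddM, addnS) /=; case: (odd s) (odd i) => -[].
have odd2 : odd (T + i.+2 + (s + i)) = false by rewrite addnS addSn /= odd1.
have i1D : (T + i.+1 <= D)%N by rewrite leq_add2l ltnW.
have i2D : (T + i.+2 <= D)%N by rewrite leq_add2l.
have off t : (T + i <= t)%N -> (s + i + 2 * b <= t)%N by rewrite addnAC st.
have l1 : (T + i <= T + i.+1)%N by rewrite leq_add2l.
have l2 : (T + i <= T + i.+2)%N by rewrite leq_add2l ltnW.
have h1 := inertia_off (sh := shu i) (X := tt) i1D (off _ l1).
have h2 := inertia_off (sh := shu i) (X := tt) i2D (off _ l2).
rewrite /= odd1 in h1; rewrite /= odd2 in h2.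
set E1 := sector tt _ in h1; set E2 := sector tt _ in h2.
have E12 q : (q \in E1) || (q \in E2) -> window (b%:R : R) (shu i) q = 0.
  case: q => -[] a; rewrite !inE /= => h; apply: window_high; apply: off.
  by case/orP: h => /eqP ->.
have offp (A : {set unit * multi}) : A \subset E1 :|: E2 ->
    forall x, x \in coordv A -> HH (shu i) x \in coordv A.
  move=> AE x xA; rewrite (hamiltonian_off P Q k (sh := shu i) _ xA); first exact: coordv_dgr.
  by move=> q /(subsetP AE); rewrite inE; apply: E12.
have h0 : forall x, x \in coordv (sector tt (upto i)) ->
    HH (shu i) x \in coordv (sector tt (upto i)).
  move=> x; apply: coordv_sector_hamiltonian => -[] a a'; rewrite !inE /= => _ h.
  by apply: window_high; apply: off; rewrite ltnW // ltnNge.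
have d12 : [disjoint E1 & E2].
  rewrite -setI_eq0; apply/eqP/setP => -[[] a]; rewrite !inE /=.
  by apply/negP => /andP[/eqP ->]; rewrite eqn_add2l eqn_leq ltnn andbF.
have d0 : [disjoint sector tt (upto i) & E1 :|: E2].
  rewrite -setI_eq0; apply/eqP/setP => -[[] a]; rewrite !inE /=.
  by apply/negP => /andP[h /orP[]/eqP e]; move: h; rewrite /upto e leq_add2l ?ltnn // ltnNge leqnSn.
have h12 := inertia_setU (hamiltonian_linear P Q k b%:R (shu i)) d12
  (offp _ (subsetUl _ _)) (offp _ (subsetUr _ _)) h1 h2.
have h := inertia_setU (hamiltonian_linear P Q k b%:R (shu i)) d0 h0 (offp _ (subxx _)) hp h12.
have eU : sector tt (upto i) :|: (E1 :|: E2) = sector tt (upto i.+2).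
  apply/setP => -[[] a]; rewrite !inE /= /upto !addnS (leq_eqVlt _ _.+2) ltnS.
  by rewrite (leq_eqVlt _ _.+1) ltnS orbC -orbA orbCA [(_ == _) || (_ <= _)%N]orbC orbA orbAC.
rewrite eU add0n in h.
have -> : (2 * K ^ 2 + i = d + (T + i.+2))%N by rewrite -TK; ring.
pose L := opbound P Q * rt R D.+1 / b%:R.
(* From b >= 32 one gets 2k <= g/8, and [Lb] gives 4L <= g/4. *)
have eg : 2 * k + 4 * L < g.
  have kg : 2 * k <= g / 8.
    have -> : 2 * k = 4 * g / b%:R by rewrite -kb; field; rewrite gt_eqF.
    rewrite ler_pdivrMr //; have h8 : g * 32 <= g * b%:R by rewrite ler_wpM2l // ltW.
    by move: h8; lra.
  have Lg : L <= g / 16.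
    have /andP[_ h9] := Lb; apply: le_trans h9 _; rewrite /g; move: (c * K%:R) => u; lra.
  by have := g0; move: kg Lg; lra.
have e2 : shu i.+2 = (fun u => (shu i u).+2) by rewrite /shu !addnS.
apply: (inertia_close eg g0 _ hp' h) => x xA.
have xD : x \in coordv (low unit d.+1 M D).
  apply: lowP => u a aD; apply: (coordvE xA).
  by rewrite inE /= /upto -ltnNge (leq_ltn_trans _ aD) // leq_add2l.
have aux sh2 : sh2 = (fun u => (shu i u).+2) ->
    nm (HH sh2 x - HH (shu i) x) <= (2 * k + 4 * L) * nm x.
  move=> ->; exact: (hamiltonian_shift P Q b0 k0 (shu i) (ltnW (ltnSn D.+1)) xD).
exact: aux e2.
Qed.

Let mshu (X : {set 'I_d.+1}) := (s + #|X|)%N.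
Local Notation SS := {set 'I_d.+1}.
(** The condition on [tq] removes the kernel of [koszul], so that [nkoszul] is an involution on what
    remains. *)
Let blk (X : SS) : {set SS * multi} :=
  sector X (fun a => (deg a <= T + #|X|) && (0 < tq (X, a)))%N.

Let Xd (X : SS) : (#|X| <= d.+1)%N.
Proof. by rewrite (leq_trans (max_card _)) ?card_ord. Qed.

Let tq_gt0 (X : SS) (a : multi) : (0 < tq (X, a))%N = (X != setT) || (0 < deg a)%N.
Proof.
rewrite /tq /= subn_gt0; have [->|XT] := eqVneq X setT.
  by rewrite cardsT card_ord -{1}[d.+1]add0n ltn_add2r.
rewrite ltn_addl //; have : X \proper setT by rewrite properT.
by move/proper_card; rewrite cardsT card_ord.
Qed.

Let blk_window X (a : multi) : (X, a) \notin blk X -> window (b%:R : R) mshu (X, a) = 0.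
Proof.
rewrite inE /= eqxx /= negb_and -ltnNge -leqNgt leqn0 => /orP[h|/eqP h].
  by apply: window_high; rewrite /= /mshu addnAC sT ltnW.
apply: contraTeq isT => /(window_low (sh := mshu) (fun X => leq_addr _ _)) /= Ka.
move: (tq_gt0 X a); rewrite h ltnn => /esym/norP[_]; by rewrite (leq_trans _ Ka).
Qed.

Lemma block_inertia : exists p : SS -> nat, forall X, inertia (HH mshu) (blk X) g (p X).
Proof.
have ex X : exists p, inertia (HH mshu) (blk X) g p.
  apply: inertia_ex => [Y|[Y a]|Y a a'].
  - exact: leq_addr.
  - by rewrite inE /= => /andP[_ /andP[h _]]; rewrite (leq_trans h) // leq_add2l.
  by rewrite {1}inE /= => /andP[/eqP -> _]; apply: blk_window.
have [p hp] := fin_all_exists ex.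
by exists p.
Qed.

(* The only vector of the full sector missed by [blk] is the vacuum of the top
   subset, where the mass is positive because [s + d.+1] is odd. *)
Lemma block_inertiaE p q X : inertia (HH mshu) (blk X) g p ->
    inertia (HH (shu #|X|)) (sector tt (upto #|X|)) g q ->
  q = (p + N * (X == setT))%N.
Proof.
move=> hp hq; have [XT|XT] := eqVneq X setT; last first.
  have eb : blk X = sector X (upto #|X|).
    by apply: eq_finset => -[Y a] /=; rewrite tq_gt0 XT andbT.
  rewrite muln0 addn0; rewrite eb in hp.
  exact: (inertia_sector (sh := shu #|X|) (sh' := mshu) g0 _ hq hp).
have Xc : #|X| = d.+1 by rewrite XT cardsT card_ord.
pose vac := sector X (fun a : multi => deg a == 0%N).
have card_vac : #|vac| = 1%N by rewrite card_sector // addn0 binn.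
(* T + d + 2 = 2 K^2 and T - s = 2b are even, hence so is s + d. *)
have odd_s : odd (s + d.+1).
  have : odd (T + d.+2) = false by rewrite TK oddM.
  have e2b : odd (2 * b) = false by rewrite oddM.
  rewrite -sT (oddD (s + 2 * b)) (oddD s (2 * b)) e2b (oddD s) /= addbF.
  by case: (odd s) (odd d) => -[].
have vac0 z : z \in vac -> window (b%:R : R) mshu z = 0.
  rewrite inE => /andP[_ /eqP a0]; apply: contraTeq isT => h.
  by have := window_low (fun X => leq_addr _ _ : (s <= mshu X)%N) h; rewrite a0.
have hvac : inertia (HH mshu) vac g N.
  suff : inertia (HH mshu) vac g (#|vac| * N) by rewrite card_vac mul1n.
  apply: inertia_pos => x xA.
  rewrite (hamiltonian_off P Q k vac0 xA) -rip_dg_cst; apply: rip_dg_le => z xz.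
  have : z \in vac by apply: contraNT xz => h; rewrite (coordvE xA h).
  rewrite inE => /andP[/eqP e1 /eqP e2]; rewrite /mass /par /excess e1 e2 add0n /mshu Xc odd_s.
  rewrite expr1 mulN1r -mulrN sub0r opprK.
  have sR : 2 * b%:R <= (s + d.+1)%:R :> R.
    rewrite -natrM ler_nat (leq_trans _ (leq_addr _ _)) //.
    by rewrite (leq_trans _ (ltnW Ks)) // leq_addl.
  apply: (@le_trans _ _ (k * (2 * b%:R))); last by rewrite ler_wpM2l.
  by rewrite kb; have := g0; lra.
have eU : blk X :|: vac = sector X (upto #|X|).
  apply/setP => -[Y a]; rewrite !inE /=; have [_|//] := eqVneq Y X.
  by rewrite tq_gt0 XT eqxx /= lt0n /upto; case: eqP => [->|]; rewrite ?orbT ?andbT ?orbF.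
have dis : [disjoint blk X & vac].
  rewrite -setI_eq0; apply/eqP/setP => -[Y a]; rewrite !inE /=; have [_|//] := eqVneq Y X.
  by rewrite tq_gt0 XT eqxx /= lt0n; case: eqP; rewrite ?andbF.
have pb x : x \in coordv (blk X) -> HH mshu x \in coordv (blk X).
  apply: coordv_sector_hamiltonian => Y a a'; rewrite {1}inE /= => /andP[/eqP -> _]; exact: blk_window.
have pv x : x \in coordv vac -> HH mshu x \in coordv vac.
  by move=> xA; rewrite (hamiltonian_off P Q k vac0 xA); apply: coordv_dgr.
have h := inertia_setU (hamiltonian_linear P Q k b%:R mshu) dis pb pv hp hvac.
rewrite eU in h; rewrite muln1.
exact: (inertia_sector (sh := shu #|X|) (sh' := mshu) g0 _ hq h).
Qed.

(** [nkoszul] moves |X| and |a| by one in the same direction, so it respects the degree bounds while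
    exchanging the parities of |X|; by [nkoszul_pos] it keeps positive vectors positive. *)
Lemma koszul_inertia p (e : bool) : (forall X, inertia (HH mshu) (blk X) g (p X)) ->
  (\sum_(X : SS | odd #|X| == e) p X <= \sum_(X : SS | odd #|X| == ~~ e) p X)%N.
Proof.
move=> hp; pose A e := \bigcup_(X : SS | odd #|X| == e) blk X.
have memA e' X a : ((X, a) \in A e') =
    [&& odd #|X| == e', (deg a <= T + #|X|)%N & (0 < tq (X, a))%N].
  apply/bigcupP/and3P => [[Y Ye]|[Xe aT aq]].
    by rewrite inE /= => /andP[/eqP -> /andP[]].
  by exists X => //; rewrite inE /= eqxx aT.
have hA e' : inertia (HH mshu) (A e') g (\sum_(X : SS | odd #|X| == e') p X).
  apply: inertia_bigcup => [X [Y a]|X a h|X _] //.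
    by rewrite inE /= => /andP[/eqP].
  by left; apply: blk_window.
apply: inertia_le (@nkoszul_linear R d.+1 N M) (ltW g0) _ _ (hA e) (hA (~~ e)).
  move=> x xA; apply: (coordv_koszul _ (coordv_dgr _ xA)) => X a j aM jX.
  rewrite !memA tq_move // deg_inc // cardsU1 jX add1n /= addnS ltnS.
  by case: (odd _) e {xA} => -[].
move=> x xA x0 hx.
have xD : x \in coordv (low SS d.+1 M D).
  apply: lowP => X a aD; apply: (coordvE xA); rewrite memA; apply: contraTN aD.
  by case/and3P => _ h _; rewrite -leqNgt (leq_trans h) // leq_add2l.
have bK : (D.+1 + d.+1 <= 4 * K ^ 2)%N.
  by rewrite DK (leq_trans (leq_add (leqnn _) dK2)) // -mulnDl.
have opg : 5 * opbound P Q / K%:R < g.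
  rewrite ltr_pdivrMr // /g; move: Kop; move: (opbound P Q) (K%:R : R) => o u; lra.
have wlow (z : SS * multi) : window (b%:R : R) mshu z != 0 -> (K ^ 2 < deg z.2)%N.
  exact: window_low (fun X => leq_addr _ _ : (s <= mshu X)%N).
apply: (nkoszul_pos (g := g) (ltnSn _) K0 bK wlow opg xD x0) hx => -[X a] xq.
have : (X, a) \in A e by apply: contraNT xq => h; rewrite (coordvE xA h).
by rewrite memA => /and3P[].
Qed.

Lemma pow2_dvdn : (2 ^ d %| N)%N.
Proof.
have [p hp] := unit_inertia; have [q hq] := block_inertia.
apply: (@parity_dvdn d.+1 N p) => //.
  move=> i id; rewrite (inertia_step id (hp i _) (hp i.+2 id)); last by rewrite ltnW // ltnW.
  (* The number 2 K^2 is a multiple of 2 d!, so the increment of the index is a multiple of 2N. *)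
  have : ~~ odd 'C(2 * K ^ 2 + i, d).
    by apply: bin_even => //; rewrite dvdn_mul // expnS dvdn_mulr.
  rewrite -dvdn2 => /dvdnP[m ->]; by rewrite -mulnA [(2 * N)%N]mulnC addnC modnMDl.
(* The two indices differ only at the full set, whose cardinality has the parity of [d.+1]. *)
have pq e : (\sum_(X : SS | odd #|X| == e) p #|X| =
    \sum_(X : SS | odd #|X| == e) q X + N * (odd d.+1 == e))%N.
  rewrite (eq_bigr (fun X => q X + N * (X == setT)))%N; last first.
    by move=> X _; apply: block_inertiaE (hq X) (hp _ (Xd X)).
  rewrite big_split /=; congr (_ + _)%N; rewrite -big_distrr /=; congr (_ * _)%N.
  have Tc : #|[set: 'I_d.+1]| = d.+1 by rewrite cardsT card_ord.
  case: eqP => [<-|h]; last first.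
    by rewrite big1 // => X /eqP hX; case: eqP => // XT; case: h; rewrite -hX XT Tc.
  by rewrite (bigD1 setT) ?Tc //= eqxx big1 // => X /andP[_ /negPf ->].
have qq : (\sum_(X : SS | odd #|X| == false) q X = \sum_(X : SS | odd #|X| == true) q X)%N.
  by apply/eqP; rewrite eqn_leq (koszul_inertia false hq) (koszul_inertia true hq).
rewrite !pq qq -!addnA -!mulnDr; by case: (odd d.+1).
Qed.

End Parity.

Theorem elliptic_dvdn (R : realType) (d N : nat) (P Q : 'I_d.+1 -> 'M[R[i]]_N) (c : R) :
    0 < c -> elliptic P Q c -> elliptic (fun j => adj (Q j)) (fun j => adj (P j)) c ->
  (2 ^ d %| N)%N.
Proof.
move=> c0 e1 e2.
have gc0 : 0 <= garding_cst P Q by rewrite addr_ge0 // sumr_ge0 // => j _; rewrite sqr_ge0.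
have [b [K [b32 bop [K0 dK] Kbig [Kgc Kop]]]] := cutoff_params d c0 (opbound_ge0 P Q) gc0.
(* T and s are solved from [TK] and [sT]; [Kbig] makes the subtractions exact. *)
apply: (@pow2_dvdn R d N P Q c c0 e1 e2 b K (2 * K ^ 2 - d.+2) (2 * K ^ 2 - d.+2 - 2 * b)) => //.
all: move: (K ^ 2)%N Kbig => K2 h; clear - h; lia.
Qed.

(** * From trilinear forms to linear families of invertible matrices *)

Section LowerBound.
Import boolp classical_sets topology normedtype derive.
Import numFieldNormedType.Exports.
Local Open Scope classical_set_scope.

Lemma continuous_sumr (R : realType) (T : topologicalType) (I : Type) (r : seq I)
    (F : I -> T -> R) : (forall j, continuous (F j)) ->
  continuous (fun x => \sum_(j <- r) F j x).
Proof.
move=> cF; elim: r => [|j r IH] x.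
  rewrite (_ : (fun x => _) = fun=> 0); first exact: cvg_cst.
  by apply/funext => y; rewrite big_nil.
rewrite (_ : (fun x => _) = fun y => F j y + \sum_(i <- r) F i y).
  exact: (cvgD (cF j x) (IH x)).
by apply/funext => y; rewrite big_cons.
Qed.

(** The product of two unit spheres is a closed subset of a cube, hence compact, and a positive
    continuous function on it attains a positive minimum. *)
Lemma product_of_spheres_min (R : realType) m n (f : 'rV[R]_(m + n) -> R) :
    continuous f ->
    (exists u : 'rV[R]_(m + n),
       \sum_(j < m) u 0 (lshift n j) ^+ 2 = 1 /\ \sum_(j < n) u 0 (rshift m j) ^+ 2 = 1) ->
    (forall u : 'rV[R]_(m + n), \sum_(j < m) u 0 (lshift n j) ^+ 2 = 1 ->
       \sum_(j < n) u 0 (rshift m j) ^+ 2 = 1 -> 0 < f u) ->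
  exists2 c : R, 0 < c & forall u : 'rV[R]_(m + n), \sum_(j < m) u 0 (lshift n j) ^+ 2 = 1 ->
    \sum_(j < n) u 0 (rshift m j) ^+ 2 = 1 -> c <= f u.
Proof.
move=> cf [u0 [u01 u02]] fpos.
pose gl (u : 'rV[R]_(m + n)) := \sum_(j < m) u 0 (lshift n j) ^+ 2.
pose gr (u : 'rV[R]_(m + n)) := \sum_(j < n) u 0 (rshift m j) ^+ 2.
pose A := gl @^-1` [set x | x = 1] `&` gr @^-1` [set x | x = 1].
have csq (j : 'I_(m + n)) : continuous (fun u : 'rV[R]_(m + n) => u 0 j ^+ 2).
  by move=> u; apply: (cvgM (@coord_continuous R 1 (m + n) 0 j u)
    (@coord_continuous R 1 (m + n) 0 j u)).
have cl : continuous gl by apply: continuous_sumr => j; apply: csq.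
have cr : continuous gr by apply: continuous_sumr => j; apply: csq.
have clA : closed A.
  by apply: closedI; apply: preimage_closed (@closed_eq _ _) => u _; [apply: cl | apply: cr].
have le1 p (h : 'I_p -> R) j : \sum_i h i ^+ 2 = 1 -> - 1 <= h j <= 1.
  move=> h1; rewrite -ler_norml -[leRHS]normr1 -ler_sqr ?nnegrE // !real_normK ?num_real //.
  by rewrite expr1n -h1 (bigD1 j) //= lerDl sumr_ge0 // => i _; rewrite sqr_ge0.
have cptA : compact A.
  have cube : compact [set v : 'rV[R]_(m + n) | forall i, `[(- 1 : R), 1]%classic (v ord0 i)].
    apply: (@rV_compact _  _ (fun=> `[(- 1 : R), 1]%classic)) => _; exact: segment_compact.
  apply: subclosed_compact clA cube _ => u [h1 h2] i /=.
  rewrite in_itv /=; case: (splitP i) => j ij.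
    have -> : i = lshift n j by apply: val_inj.
    exact: (le1 m (fun j => u 0 (lshift n j))).
  have -> : i = rshift m j by apply: val_inj.
  exact: (le1 n (fun j => u 0 (rshift m j))).
have [|v vA vmin] := @EVT_min_rV R (m + n) f A _ cptA (continuous_subspaceT cf).
  by exists u0.
move: vA; rewrite in_setE => -[v1 v2].
exists (f v); first exact: fpos.
by move=> u u1 u2; apply: vmin; rewrite in_setE.
Qed.

(** By homogeneity in [x] and [w] it suffices to treat pairs of unit vectors, where invertibility
    makes the right side positive. The constant is the square root of the minimum. *)
Lemma bounded_below (R : realType) m N (L : 'I_m -> 'M[R]_N) :
    (forall x : 'rV[R]_m, x != 0 -> \sum_j x 0 j *: L j \in unitmx) ->
  exists2 c : R, 0 < c & forall (x : 'rV[R]_m) (w : 'cV[R]_N),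
    c ^+ 2 * ((\sum_j x 0 j ^+ 2) * (\sum_l w l 0 ^+ 2)) <=
    \sum_l ((\sum_j x 0 j *: L j) *m w) l 0 ^+ 2.
Proof.
move=> Lu; pose Lx (x : 'rV[R]_m) := \sum_j x 0 j *: L j.
pose f (u : 'rV[R]_(m + N)) := \sum_l (Lx (lsubmx u) *m (rsubmx u)^T) l 0 ^+ 2.
have fE u : f u = \sum_l (\sum_k (\sum_j u 0 (lshift N j) * L j l k) * u 0 (rshift m k)) ^+ 2.
  apply: eq_bigr => l _; rewrite mxE; congr (_ ^+ 2); apply: eq_bigr => k _.
  rewrite !mxE summxE; congr (_ * _); apply: eq_bigr => j _.
  by rewrite !mxE.
have cf : continuous f.
  rewrite (_ : f = fun u =>
    \sum_l (\sum_k (\sum_j u 0 (lshift N j) * L j l k) * u 0 (rshift m k)) ^+ 2).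
    have co j : continuous (fun u : 'rV[R]_(m + N) => u 0 j) by apply: coord_continuous.
    apply: continuous_sumr => l u.
    have h : continuous (fun u : 'rV[R]_(m + N) =>
        \sum_k (\sum_j u 0 (lshift N j) * L j l k) * u 0 (rshift m k)).
      apply: continuous_sumr => k v; apply: (cvgM _ (co _ v)).
      by apply: continuous_sumr => j {}v; apply: (cvgM (co _ v) (cvg_cst _)).
    exact: (cvgM (h u) (h u)).
  by apply/funext => u; apply: fE.
have sq0 p (h : 'I_p -> R) : 0 <= \sum_j h j ^+ 2 by apply: sumr_ge0 => j _; rewrite sqr_ge0.
have norm1 p (h : 'I_p -> R) : \sum_j h j ^+ 2 != 0 ->
    \sum_j (h j / Num.sqrt (\sum_j h j ^+ 2)) ^+ 2 = 1.
  move=> h0; under eq_bigr => j _ do rewrite exprMn exprVn sqr_sqrtr //.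
  by rewrite -mulr_suml divff.
have fpos (u : 'rV[R]_(m + N)) : \sum_(j < m) u 0 (lshift N j) ^+ 2 = 1 ->
    \sum_(j < N) u 0 (rshift m j) ^+ 2 = 1 -> 0 < f u.
  move=> h1 h2; rewrite lt_def sq0 andbT; apply/negP => /eqP f0.
  have u1 : lsubmx u != 0.
    apply/eqP => e; move/eqP: h1; rewrite big1 ?(eq_sym 0) ?oner_eq0 // => j _.
    by have := congr1 (fun A : 'rV_m => A 0 j) e; rewrite !mxE => ->; rewrite expr0n.
  have L0 : Lx (lsubmx u) *m (rsubmx u)^T = 0.
    apply/matrixP => l z; rewrite ord1 [RHS]mxE; apply/eqP.
    have : (Lx (lsubmx u) *m (rsubmx u)^T) l 0 ^+ 2 == 0.
      have := psumr_eq0P (fun l _ => sqr_ge0 ((Lx (lsubmx u) *m (rsubmx u)^T) l 0)) f0.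
      by move/(_ l isT) ->.
    by rewrite sqrf_eq0.
  have e : (rsubmx u)^T = 0 by rewrite -(mulKmx (Lu _ u1) (rsubmx u)^T) L0 mulmx0.
  move/eqP: h2; rewrite big1 ?(eq_sym 0) ?oner_eq0 // => j _.
  by have := congr1 (fun A : 'cV_N => A j 0) e; rewrite !mxE => ->; rewrite expr0n.
pose unit_pair (x : 'rV[R]_m) (w : 'cV[R]_N) : 'rV[R]_(m + N) :=
  row_mx ((Num.sqrt (\sum_j x 0 j ^+ 2))^-1 *: x) ((Num.sqrt (\sum_l w l 0 ^+ 2))^-1 *: w)^T.
have up1 (x : 'rV[R]_m) (w : 'cV[R]_N) : \sum_j x 0 j ^+ 2 != 0 ->
    \sum_j unit_pair x w 0 (lshift N j) ^+ 2 = 1.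
  by move/norm1 <-; apply: eq_bigr => j _; rewrite row_mxEl mxE mulrC.
have up2 (x : 'rV[R]_m) (w : 'cV[R]_N) : \sum_l w l 0 ^+ 2 != 0 ->
    \sum_l unit_pair x w 0 (rshift m l) ^+ 2 = 1.
  by move/norm1 <-; apply: eq_bigr => j _; rewrite row_mxEr !mxE mulrC.
(* Without pairs of unit vectors one of the two norms is always zero, and any constant will do. *)
have [ne|ne] := pselect (exists u : 'rV[R]_(m + N),
  \sum_(j < m) u 0 (lshift N j) ^+ 2 = 1 /\ \sum_(j < N) u 0 (rshift m j) ^+ 2 = 1); last first.
  exists 1 => // x w; rewrite expr1n mul1r.
  have [->|x0] := eqVneq (\sum_j x 0 j ^+ 2) 0; first by rewrite mul0r sq0.
  have [->|w0] := eqVneq (\sum_l w l 0 ^+ 2) 0; first by rewrite mulr0 sq0.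
  by case: ne; exists (unit_pair x w); rewrite up1 ?up2.
have [c c0 cmin] := product_of_spheres_min cf ne fpos.
exists (Num.sqrt c); first by rewrite sqrtr_gt0.
move=> x w; rewrite (sqr_sqrtr (ltW c0)).
have [->|x0] := eqVneq (\sum_j x 0 j ^+ 2) 0; first by rewrite mul0r mulr0; apply: sq0.
have [->|w0] := eqVneq (\sum_l w l 0 ^+ 2) 0; first by rewrite !mulr0 sq0.
have xp : 0 < \sum_j x 0 j ^+ 2 by rewrite lt_def x0 sq0.
have wp : 0 < \sum_l w l 0 ^+ 2 by rewrite lt_def w0 sq0.
have := cmin _ (up1 x w x0) (up2 x w w0).
rewrite -ler_pdivlMr ?mulr_gt0 //; move=> h; apply: le_trans h _.
rewrite /f /unit_pair row_mxKl row_mxKr trmxK.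
have LZ a : Lx (a *: x) = a *: Lx x.
  by rewrite /Lx scaler_sumr; apply: eq_bigr => j _; rewrite mxE scalerA.
rewrite LZ -scalemxAl -scalemxAr le_eqVlt; apply/orP; left; apply/eqP.
rewrite [RHS]mulr_suml; apply: eq_bigr => l _; rewrite 2!mxE !exprMn !exprVn !sqr_sqrtr //.
by rewrite invfM -/(Lx x); ring.
Qed.

End LowerBound.

(** * Complex coordinates for a real family of matrices *)

Section RealFamily.
Variables (R : realType) (d N : nat).
Local Notation C := R[i].

(** With z_j = x_j + i x_(d+j), the real combination of the [L j] becomes the sum of the z_j P_j +
    conj(z_j) Q_j for P = [holo L] and Q = [antiholo L]. *)
Definition holo (L : 'I_(d + d) -> 'M[R]_N) (j : 'I_d) : 'M[C]_N :=
  \matrix_(k, l) Complex (L (lshift d j) k l / 2) (- (L (rshift d j) k l / 2)).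
Definition antiholo (L : 'I_(d + d) -> 'M[R]_N) (j : 'I_d) : 'M[C]_N :=
  \matrix_(k, l) Complex (L (lshift d j) k l / 2) (L (rshift d j) k l / 2).

Lemma adj_holo L j : adj (holo L j) = antiholo (fun k => (L k)^T) j.
Proof.
by apply/matrixP => k l; rewrite !mxE; apply/eqP; rewrite eq_complex /= opprK !eqxx.
Qed.

Lemma adj_antiholo L j : adj (antiholo L j) = holo (fun k => (L k)^T) j.
Proof. by apply/matrixP => k l; rewrite !mxE; apply/eqP; rewrite eq_complex /= !eqxx. Qed.

Lemma sum_Complex (I : Type) (r : seq I) (u v : I -> R) :
  \sum_(j <- r) Complex (u j) (v j) = Complex (\sum_(j <- r) u j) (\sum_(j <- r) v j).
Proof.
elim: r => [|j r IH]; first by rewrite !big_nil.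
by rewrite !big_cons IH.
Qed.

(** The real matrix acts separately on the real and the imaginary part of [w], and the bound holds
    for each. *)
Lemma elliptic_real (L : 'I_(d + d) -> 'M[R]_N) (c : R) :
    (forall (x : 'rV[R]_(d + d)) (w : 'cV[R]_N),
      c ^+ 2 * ((\sum_j x 0 j ^+ 2) * (\sum_l w l 0 ^+ 2)) <=
      \sum_l ((\sum_j x 0 j *: L j) *m w) l 0 ^+ 2) ->
  elliptic (holo L) (antiholo L) c.
Proof.
move=> hL z w.
pose x : 'rV[R]_(d + d) := row_mx (\row_j complex.Re (z j)) (\row_j complex.Im (z j)).
pose w1 : 'cV[R]_N := \col_l complex.Re (w l 0).
pose w2 : 'cV[R]_N := \col_l complex.Im (w l 0).
pose A := \sum_j x 0 j *: L j.
have AE k l : A k l = \sum_(j < d) (complex.Re (z j) * L (lshift d j) k l +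
    complex.Im (z j) * L (rshift d j) k l).
  rewrite /A summxE big_split_ord /= big_split /=.
  by congr (_ + _); apply: eq_bigr => j _; rewrite mxE ?row_mxEl ?row_mxEr mxE.
have xE : \sum_j x 0 j ^+ 2 = \sum_(j < d) (complex.Re (z j) ^+ 2 + complex.Im (z j) ^+ 2).
  rewrite big_split_ord big_split /=.
  by congr (_ + _); apply: eq_bigr => j _; rewrite ?row_mxEl ?row_mxEr mxE.
have -> : \sum_j vn (z j *: w) =
    (\sum_j x 0 j ^+ 2) * (\sum_l w1 l 0 ^+ 2) + (\sum_j x 0 j ^+ 2) * (\sum_l w2 l 0 ^+ 2).
  rewrite xE -mulrDr -big_split /= mulr_suml; apply: eq_bigr => j _.
  rewrite mulr_sumr; apply: eq_bigr => l _; rewrite !mxE.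
  by move: (z j) (w l 0) => [a b] [e f]; rewrite /rd /=; ring.
pose v := \sum_j (holo L j *m (z j *: w) + antiholo L j *m ((z j)^* *: w)).
have vE k : v k 0 = Complex ((A *m w1) k 0) ((A *m w2) k 0).
  rewrite /v summxE [(A *m w1) k 0]mxE [(A *m w2) k 0]mxE -sum_Complex.
  under eq_bigr => j _ do rewrite mxE !mxE -big_split /=.
  rewrite exchange_big; apply: eq_bigr => l _ /=; rewrite AE !mulr_suml -sum_Complex.
  apply: eq_bigr => j _; rewrite !mxE.
  move: (z j) (w l 0) => [a b] [e f]; apply/eqP; rewrite eq_complex /=.
  by apply/andP; split; apply/eqP; field.
have -> : vn v = \sum_l (A *m w1) l 0 ^+ 2 + \sum_l (A *m w2) l 0 ^+ 2.
  by rewrite -big_split /=; apply: eq_bigr => k _; rewrite vE /rd /= !expr2.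
by rewrite mulrDr; apply: lerD; apply: hL.
Qed.

End RealFamily.

(** The adjoint symbol belongs to the transposed matrices, which are invertible as well; the smaller
    of the two constants serves both. *)
Lemma unitmx_family_dvdn (R : realType) (d N : nat) (L : 'I_(d.+1 + d.+1) -> 'M[R]_N) :
    (forall x : 'rV[R]_(d.+1 + d.+1), x != 0 -> \sum_j x 0 j *: L j \in unitmx) ->
  (2 ^ d %| N)%N.
Proof.
move=> Lu; have [c c0 hc] := bounded_below Lu.
have [|c' c'0 hc'] := @bounded_below _ _ _ (fun j => (L j)^T).
  move=> x /Lu h; rewrite (_ : \sum_j _ = (\sum_j x 0 j *: L j)^T) ?unitmx_tr //.
  by rewrite raddf_sum; apply: eq_bigr => j _ /=; rewrite linearZ.
have mono (P Q : 'I_d.+1 -> 'M[R[i]]_N) (e e' : R) : 0 <= e' <= e ->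
    elliptic P Q e -> elliptic P Q e'.
  move=> /andP[e0 ee] h z w; apply: le_trans (h z w); rewrite ler_wpM2r //.
    by apply: sumr_ge0 => j _; apply: sumr_ge0 => l _; apply: rd_ge0.
  by rewrite ler_sqr ?nnegrE // (le_trans e0).
have m0 : 0 < Num.min c c' by rewrite lt_min c0.
apply: (@elliptic_dvdn R d N (holo L) (antiholo L) _ m0).
  apply: mono (elliptic_real hc); by rewrite ltW //= ge_min lexx.
rewrite (_ : (fun j => adj (antiholo L j)) = holo (fun j => (L j)^T)); last first.
  by apply/funext => j; apply: adj_antiholo.
rewrite (_ : (fun j => adj (holo L j)) = antiholo (fun j => (L j)^T)); last first.
  by apply/funext => j; apply: adj_holo.
by apply: mono (elliptic_real hc'); rewrite ltW //= ge_min lexx orbT.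
Qed.

(** Without zero divisors, multiplication by a nonzero [x] is injective, hence bijective in finite
    dimension. *)
Lemma bilinear_unitmx_family (R : realType) p N (m : 'rV[R]_p -> 'rV[R]_N -> 'rV[R]_N) :
    (forall w, linear (m^~ w)) -> (forall x, linear (m x)) ->
    (forall x w, m x w = 0 -> x = 0 \/ w = 0) ->
  exists L : 'I_p -> 'M[R]_N, forall x : 'rV[R]_p, x != 0 -> \sum_j x 0 j *: L j \in unitmx.
Proof.
move=> ml mr m0.
pose ML w : {linear 'rV[R]_p -> 'rV[R]_N} :=
  HB.pack (m^~ w) (GRing.isLinear.Build _ _ _ _ (m^~ w) (ml w)).
pose MR x : {linear 'rV[R]_N -> 'rV[R]_N} :=
  HB.pack (m x) (GRing.isLinear.Build _ _ _ _ (m x) (mr x)).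
exists (fun j => lin1_mx (MR (delta_mx 0 j))) => x x0.
rewrite -row_free_unit -kermx_eq0; apply/rowV0P => w /sub_kermxP wx.
have mE : m x w = w *m (\sum_j x 0 j *: lin1_mx (MR (delta_mx 0 j))).
  rewrite [in LHS](row_sum_delta x) -[LHS]/(ML w _) linear_sum mulmx_sumr.
  by apply: eq_bigr => j _; rewrite linearZ -scalemxAr (mul_rV_lin1 (MR _)).
by case: (m0 x w); [rewrite mE wx | move/eqP; rewrite (negPf x0) |].
Qed.

(** For odd N the characteristic polynomial of [L j1 *m invmx (L ord0)] has a real root a, and then
    [L j1] - a [L ord0] is singular. *)
Lemma unitmx_family_even (R : realType) m N (L : 'I_m.+2 -> 'M[R]_N) :
    (forall x : 'rV[R]_m.+2, x != 0 -> \sum_j x 0 j *: L j \in unitmx) ->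
  ~~ odd N.
Proof.
move=> Lu; apply/negP => oddN; pose j1 : 'I_m.+2 := lift ord0 ord0.
have comb (a b : R) : a != 0 \/ b != 0 -> a *: L ord0 + b *: L j1 \in unitmx.
  move=> ab; have := Lu (a *: delta_mx 0 ord0 + b *: delta_mx 0 j1).
  rewrite big_ord_recl big_ord_recl big1 => [|j _]; last first.
    by rewrite !mxE /= !mulr0 addr0 scale0r.
  rewrite !mxE /= !mulr1 !mulr0 addr0 add0r addr0; apply.
  apply/eqP => /rowP e; have := e ord0; have := e j1;
    rewrite !mxE /= !mulr1 !mulr0 addr0 add0r => eb ea.
  by case: ab => /eqP; [rewrite ea | rewrite eb].
have L0 : L ord0 \in unitmx.
  by have := comb 1 0; rewrite scale1r scale0r addr0; apply; left; rewrite oner_eq0.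
have [|a] := @odd_poly_root R (char_poly (L j1 *m invmx (L ord0))).
  by rewrite size_char_poly /= oddN.
rewrite -eigenvalue_root_char => /eigenvalueP[v va v0].
have e : v *m ((- a) *: L ord0 + 1 *: L j1) = 0.
  rewrite scale1r mulmxDr -scalemxAr -[in X in _ + X](mulmxKV L0 (L j1)) mulmxA va.
  by rewrite scaleNr -scalemxAl addNr.
have := comb (- a) 1; rewrite oner_eq0 => /(_ (or_intror isT)) u.
by move/eqP: v0; apply; rewrite -(mulmxK u v) e mul0mx.
Qed.

(** For d >= 4 the power 2^d exceeds 2d + 2; among smaller d, the value 2 is excluded since 4 does
    not divide 6. *)
Lemma dim_37 n d : (2 < n)%N -> n.+1 = (d.+1 + d.+1)%N -> (2 ^ d %| n.+1)%N -> (n = 3 \/ n = 7)%N.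
Proof.
move=> n2 nd; case: (ltnP d 4) => d4.
  case: d nd d4 => [|[|[|[|]]]] // nd _; case: nd => nE; subst n => //.
  - by left.
  - by right.
move/dvdn_leq => /(_ isT); rewrite nd leqNgt; suff -> : (d.+1 + d.+1 < 2 ^ d)%N by [].
elim: d d4 {nd} => // d IH; rewrite leq_eqVlt => /orP[/eqP <- //|/IH h].
rewrite expnS; move: (2 ^ d)%N h => z; lia.
Qed.

Lemma unitmx_family_37 (R : realType) n (L : 'I_n.+1 -> 'M[R]_n.+1) : (2 < n)%N ->
    (forall x : 'rV[R]_n.+1, x != 0 -> \sum_j x 0 j *: L j \in unitmx) ->
  (n = 3 \/ n = 7)%N.
Proof.
move=> n2 Lu; have oddn : odd n.
  by case: n n2 L Lu => // n _ L /unitmx_family_even /=; rewrite negbK.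
have [d nd] : exists d, n = (d + d.+1)%N.
  by exists n./2; rewrite -[LHS]odd_double_half oddn -addnn addnS.
by subst n; apply: (@dim_37 _ d) => //; apply: unitmx_family_dvdn Lu.
Qed.

(** * The algebra of the cross product, and the theorem *)

Section CrossProduct.
Variables (R : realType) (n : nat) (T : 'rV[R]_n -> 'rV[R]_n -> 'rV[R]_n -> R).
Hypotheses (T_lin : trilinear_form T) (T_alt : alternating T).
Local Notation rV := ('rV[R]_n).

Definition dot (a b : rV) : R := (a *m b^T) 0 0.
Definition cross (a b : rV) : rV := \row_i T a b (delta_mx 0 i).

Lemma dotDl a b c : dot (a + b) c = dot a c + dot b c.
Proof. by rewrite /dot mulmxDl mxE. Qed.

Lemma dotZl k a c : dot (k *: a) c = k * dot a c.
Proof. by rewrite /dot -scalemxAl mxE. Qed.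

Lemma dotC a b : dot a b = dot b a.
Proof. by rewrite /dot !mxE; apply: eq_bigr => i _; rewrite !mxE mulrC. Qed.

Lemma dot_ge0 a : 0 <= dot a a.
Proof. by rewrite /dot mxE sumr_ge0 // => i _; rewrite mxE -expr2 sqr_ge0. Qed.

Lemma dot_eq0 a : dot a a = 0 -> a = 0.
Proof.
rewrite /dot mxE => h; apply/rowP => i; rewrite [RHS]mxE; apply/eqP; rewrite -sqrf_eq0.
have p0 j : true -> 0 <= a 0 j * a^T j 0 by rewrite mxE -expr2 sqr_ge0.
by have := psumr_eq0P p0 h (i := i) isT; rewrite mxE expr2 => ->.
Qed.

Lemma dot_cross a b x : dot (cross a b) x = T a b x.
Proof.
have [_ _ T3] := T_lin.
pose f : {scalar rV} := HB.pack (T a b) (GRing.isLinear.Build _ _ _ _ (T a b) (T3 a b)).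
rewrite -[RHS]/(f x) {2}(row_sum_delta x) linear_sum /dot mxE; apply: eq_bigr => i _.
by rewrite linearZ !mxE mulrC.
Qed.

Lemma cross_linearl b : linear (cross^~ b).
Proof. by have [T1 _ _] := T_lin; move=> k u v; apply/rowP => i; rewrite !mxE T1. Qed.

Lemma cross_linearr a : linear (cross a).
Proof. by have [_ T2 _] := T_lin; move=> k u v; apply/rowP => i; rewrite !mxE T2. Qed.

(* The product of [x0 + a] and [t + b] in the algebra [R + R^n] of the cross product. *)
Definition mulT (u w : 'rV[R]_(1 + n)) : 'rV[R]_(1 + n) :=
  row_mx ((lsubmx u 0 0 * lsubmx w 0 0 - dot (rsubmx u) (rsubmx w))%:M)
    (lsubmx u 0 0 *: rsubmx w + lsubmx w 0 0 *: rsubmx u + cross (rsubmx u) (rsubmx w)).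

Lemma mulT_linearl w : linear (mulT^~ w).
Proof.
move=> k u v; rewrite /mulT scale_row_mx add_row_mx !linearP /=.
congr row_mx.
  apply/matrixP => i j; rewrite !ord1 !mxE !dotDl dotZl /=; ring.
rewrite cross_linearl; apply/rowP => i; rewrite !mxE; ring.
Qed.

Lemma mulT_linearr u : linear (mulT u).
Proof.
move=> k v w; rewrite /mulT scale_row_mx add_row_mx !linearP /=.
congr row_mx.
  apply/matrixP => i j; rewrite !ord1 !mxE !(dotC (rsubmx u)) !dotDl dotZl /=; ring.
rewrite cross_linearr; apply/rowP => i; rewrite !mxE; ring.
Qed.

Hypothesis nonsingular : forall a b, (forall x, T a b x = 0) -> b = 0 \/ exists k, a = k *: b.

(** The scalar part gives <a, b> = x0 t. Pairing the vector part with a gives (x0^2 + |a|^2) t = 0,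
    and then pairing with b gives x0 |b|^2 = 0. If x0 = 0, the cross product of the orthogonal
    vectors a and b vanishes, and nonsingularity forces b = 0. *)
Lemma mulT_eq0 u w : mulT u w = 0 -> u = 0 \/ w = 0.
Proof.
move=> h; set x0 := lsubmx u 0 0; set t := lsubmx w 0 0.
set a := rsubmx u; set b := rsubmx w.
have rowE (v : 'rV[R]_(1 + n)) : lsubmx v 0 0 = 0 -> rsubmx v = 0 -> v = 0.
  move=> v1 v2; rewrite -[v]hsubmxK v2 (_ : lsubmx v = 0) ?row_mx0 //.
  by apply/matrixP => i j; rewrite !ord1 v1 mxE.
have h1 : x0 * t - dot a b = 0.
  have := congr1 (@lsubmx R 1 1 n) h; rewrite row_mxKl => /matrixP/(_ 0 0).
  by rewrite [LHS]mxE eqxx mulr1n => ->; rewrite !mxE.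
have h2 : x0 *: b + t *: a + cross a b = 0.
  have := congr1 (@rsubmx R 1 1 n) h; rewrite row_mxKr => ->; exact: linear0.
have dotE c : x0 * dot b c + t * dot a c + T a b c = 0.
  by rewrite -dot_cross -!dotZl -!dotDl h2 /dot mul0mx mxE.
have Taba : T a b a = 0 by apply: T_alt; right; right.
have Tabb : T a b b = 0 by apply: T_alt; right; left.
have [u0|u0] := eqVneq (x0 ^+ 2 + dot a a) 0.
  left; have a0 := dot_ge0 a; have s0 := sqr_ge0 x0.
  have x00 : x0 = 0 by apply/eqP; rewrite -sqrf_eq0; apply/eqP; lra.
  by apply: rowE => //; apply: dot_eq0; lra.
right; have dab : dot b a = x0 * t by rewrite dotC; lra.
have t0 : t = 0.
  have := dotE a; rewrite Taba dab => e; apply/eqP.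
  have : (x0 ^+ 2 + dot a a) * t == 0 by apply/eqP; lra.
  by rewrite mulf_eq0 (negPf u0).
apply: rowE => //; have := dotE b; rewrite Tabb t0 mul0r !addr0 => /eqP.
rewrite mulf_eq0 => /orP[/eqP x00|/eqP]; last exact: dot_eq0.
have ab0 : dot b a = 0 by rewrite dab t0 mulr0.
have Tab x : T a b x = 0 by have := dotE x; rewrite x00 t0 !mul0r !add0r.
case: (nonsingular Tab) => // -[k ak]; apply: dot_eq0.
move: ab0; rewrite ak dotC dotZl => /eqP; rewrite mulf_eq0 => /orP[/eqP k0|/eqP //].
by case/eqP: u0; rewrite x00 ak k0 scale0r /dot mul0mx mxE expr0n addr0.
Qed.

Lemma nonsingular_dim : (2 < n)%N -> (n = 3 \/ n = 7)%N.
Proof.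
move=> n2; have [L Lu] := bilinear_unitmx_family mulT_linearl mulT_linearr mulT_eq0.
exact: unitmx_family_37 n2 Lu.
Qed.

End CrossProduct.

Import VectorInternalTheory.
Local Close Scope ring_scope.

Theorem theorem2 (R : realType) (n : nat) (V : vectType R)
    (T : V -> V -> V -> R) :
  2 < n -> n <> 3 -> n <> 7 -> \dim {:V} = n ->
  trilinear_form T -> alternating T ->
  exists a b : V, singular_line T a b.
Proof.
move=> n2 n3 n7 dimV [T1 T2 T3] T_alt; apply: contrapT => nsing.
rewrite dimvf in dimV; subst n.
(* Coordinates transport the form to row vectors, where [nonsingular_dim] applies. *)
pose f := @r2v R V; pose T' a b x := T (f a) (f b) (f x).
have T'_lin : trilinear_form T'.
  by split=> u v k x y; rewrite /T' /f linearP ?T1 ?T2 ?T3.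
have T'_alt : alternating T'.
  by move=> x y z h; apply: T_alt; case: h => [->|[->|->]]; [left | right; left | right; right].
case: (nonsingular_dim T'_lin T'_alt _ n2) => // a b Tab.
have [->|b0] := eqVneq b 0%R; [by left | right; apply: contrapT => nk; apply: nsing].
exists (f a), (f b); split=> [|x]; last by rewrite -[x]v2rK; apply: Tab.
rewrite free_cons seq1_free span_seq1; apply/andP; split.
  apply/negP => /vlineP[k e]; apply: nk; exists k; apply: (@r2v_inj R V).
  by rewrite linearZ.
by rewrite -(inj_eq (@r2v_inj R V)) linear0 in b0.
Qed.
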